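(* Let $n,m\ge 1$ be integers and let $F:(\mathcal S_0^n)^m\longrightarrow \mathbb R$ be separately additive (with respect to the radial sum) and positively homogeneous. Assume also that $F$ satisfies at least one of the following conditions: (A) $F=F^+-F^-$, where $F^+,F^-:(\mathcal S_0^n)^m\longrightarrow [0,\infty)$ are also separately additive and positively homogeneous. (B) $F$ is separately bounded. Then the following are equivalent: (1) $F(L_1,\ldots,L_m)=0$ whenever there exist distinct indices $1\le i_1,i_2\le m$ such that $L_{i_1}\cap L_{i_2}=\{o\}$. (2) $F$ is symmetric and the associated polynomial $P_F(L)=F(L,\ldots,L)$ satisfies $P_F(L\tilde{+}M)=P_F(L)+P_F(M)$ for all $L,M\in\mathcal S_0^n$ with $L\cap M=\{o\}$. (3) There exists a regular (finite, signed) measure $\mu:\Sigma_n\longrightarrow\mathbb R$ such that for all $(L_1,\ldots,L_m)\in(\mathcal S_0^n)^m$ $$F(L_1,\ldots,L_m)=\int_{S^{n-1}}\rho_{L_1}(t)\cdots\rho_{L_m}(t)\,d\mu(t).$$ Moreover, if $m=n\ge 2$, $F$ satisfies the equivalent conditions (1)–(3), and $F$ is rotationally invariant, then there exists a constant $c\in\mathbb R$ such that $F(L_1,\ldots,L_n)=c\,\tilde V(L_1,\ldots,L_n)$ for all $L_1,\ldots,L_n\in\mathcal S_0^n$.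
   Context: $S^{n-1}$ is the Euclidean unit sphere of $\mathbb R^n$, $\Sigma_n$ is its Borel $\sigma$-algebra, and $o$ is the origin. A star body is a set $L\subset\mathbb R^n$ containing $o$ such that every line through $o$ meets $L$ in a (possibly degenerate) closed bounded line segment, and whose radial function $\rho_L:S^{n-1}\to[0,\infty)$, $\rho_L(x)=\max\{c : cx\in L\}$, is continuous. $\mathcal S_0^n$ denotes the set of star bodies in $\mathbb R^n$; the map $L\mapsto\rho_L$ is a bijection from $\mathcal S_0^n$ onto the set of continuous functions $S^{n-1}\to[0,\infty)$. The radial sum $L\tilde{+}M$ is the star body with radial function $\rho_L+\rho_M$. A function $F:(\mathcal S_0^n)^m\to\mathbb R$ is separately additive if, in each variable with the others fixed, $F(\ldots,L\tilde{+}M,\ldots)=F(\ldots,L,\ldots)+F(\ldots,M,\ldots)$; it is positively homogeneous if in each variable $F(\ldots,\lambda L,\ldots)=\lambda F(\ldots,L,\ldots)$ for all $\lambda\ge0$. $F$ is separately bounded if for every choice of $(L_2,\ldots,L_m)\in(\mathcal S_0^n)^{m-1}$ there is a constant $C$ such that $|F(L,L_2,\ldots,L_m)|\le C$ for every star body $L$ contained in the unit ball of $\mathbb R^n$, and the same condition holds when the role of the first variable is played by any other variable. $F$ is symmetric if it is invariant under permutations of its arguments. $F$ is rotationally invariant if $F(\phi L_1,\ldots,\phi L_m)=F(L_1,\ldots,L_m)$ for every rotation $\phi$ of $\mathbb R^n$. The dual mixed volume of $L_1,\ldots,L_n\in\mathcal S_0^n$ is $\tilde V(L_1,\ldots,L_n)=\frac1n\int_{S^{n-1}}\rho_{L_1}(u)\cdots\rho_{L_n}(u)\,du$,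 where $du$ is the spherical Lebesgue measure. *)

(* Defs.v *)
From HB Require Import structures.
From mathcomp Require Import all_boot all_order all_algebra all_fingroup.
From mathcomp Require Import ring lra.
From mathcomp Require Import all_classical all_reals all_analysis.

Set Implicit Arguments.
Unset Strict Implicit.
Unset Printing Implicit Defensive.

Import Order.TTheory GRing.Theory Num.Theory.
Import numFieldNormedType.Exports.

Local Open Scope classical_set_scope.
Local Open Scope ring_scope.

(* The topology of ['rV[R]_n] is the usual one, but its library norm is the
   sup norm, whence the Euclidean norm below. *)
Definition enorm (R : realType) (n : nat) (x : 'rV[R]_n) : R :=
  Num.sqrt (\sum_(i < n) x 0 i ^+ 2).

Definition unit_ball (R : realType) (n : nat) : set 'rV[R]_n :=
  [set x | enorm x <= 1].

Definition unit_sphere (R : realType) (n : nat) : set 'rV[R]_n :=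
  [set x | enorm x = 1].

Arguments unit_ball : clear implicits.
Arguments unit_sphere : clear implicits.

(* The library requires measurable types to be pointed, so the ambient space is
   written ['rV[R]_n.+1]: [sphere R n] is the unit sphere of R^(n+1). *)
Definition sphere (R : realType) (n : nat) : Type :=
  set_type (unit_sphere R n.+1).

Section EuclideanNorm.
Variables (R : realType) (n : nat).
Implicit Types x : 'rV[R]_n.

Lemma enorm_ge0 x : 0 <= enorm x.
Proof. exact: sqrtr_ge0. Qed.

Lemma enormZ (a : R) x : enorm (a *: x) = `|a| * enorm x.
Proof.
rewrite /enorm -sqrtr_sqr -sqrtrM ?sqr_ge0//; congr Num.sqrt.
by rewrite mulr_sumr; apply: eq_bigr => i _; rewrite mxE exprMn.
Qed.

Lemma enorm_eq0 x : enorm x = 0 -> x = 0.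
Proof.
move=> /eqP; rewrite sqrtr_eq0 => h; apply/rowP => i; rewrite mxE.
have : \sum_(i < n) x 0 i ^+ 2 == 0.
  by rewrite eq_le h sumr_ge0// => j _; rewrite sqr_ge0.
rewrite psumr_eq0 => [/allP/(_ i)|j _]; last exact: sqr_ge0.
by rewrite mem_index_enum => /(_ isT) /=; rewrite sqrf_eq0 => /eqP.
Qed.

Lemma enorm_mulmx (A : 'M[R]_n) x : A *m A^T = 1%:M -> enorm (x *m A) = enorm x.
Proof.
move=> hA; suff E (y : 'rV[R]_n) : \sum_(i < n) y 0 i ^+ 2 = (y *m y^T) 0 0.
  by rewrite /enorm !E trmx_mul -mulmxA (mulmxA A) hA mul1mx.
by rewrite mxE; apply: eq_bigr => i _; rewrite mxE expr2.
Qed.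

End EuclideanNorm.

Section SphereStructure.
Variables (R : realType) (n : nat).

Lemma unit_sphere_delta : unit_sphere R n.+1 (delta_mx 0 0).
Proof.
rewrite /unit_sphere /= /enorm (bigD1 ord0)//= big1 => [|i i0].
  by rewrite mxE !eqxx expr1n addr0 sqrtr1.
by rewrite mxE (negPf i0) andbF expr0n.
Qed.

HB.instance Definition _ :=
  Topological.copy (sphere R n) (set_type (unit_sphere R n.+1)).
HB.instance Definition _ := isPointed.Build (sphere R n)
  (exist _ (delta_mx 0 0) (mem_set unit_sphere_delta) : sphere R n).

End SphereStructure.

Definition borel_sphere (R : realType) (n : nat) :=
  g_sigma_algebraType (@open (sphere R n)).

Section StarBodies.
Variables (R : realType) (n : nat).
Local Notation V := 'rV[R]_n.+1.

Definition segment (x y : V) : set V :=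
  [set t *: x + (1 - t) *: y | t in `[0, 1]].

Definition line (v : V) : set V := [set t *: v | t in [set: R]].

Definition radial (L : set V) (u : sphere R n) : R :=
  sup [set c | L (c *: \val u)].

Definition is_star_body (L : set V) : Prop :=
  [/\ L 0,
      forall v, v != 0 -> exists x y, L `&` line v = segment x y
    & continuous (radial L)].

Record star_body := StarBody { body :> set V; bodyP : is_star_body body }.

Lemma star_body_eq (L M : star_body) : (L : set V) = M -> L = M.
Proof.
case: L M => [L pL] [M pM] /= E; subst M.
by congr StarBody; exact: Prop_irrelevance.
Qed.

Definition radial_set (f : sphere R n -> R) : set V :=
  [set x | exists u c, 0 <= c <= f u /\ x = c *: \val u].

Lemma sphere1 (u : sphere R n) : enorm (\val u) = 1.
Proof. by case: u => u /= /set_mem. Qed.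

Lemma sphere_neq0 (u : sphere R n) : \val u != 0.
Proof.
apply/eqP => u0; have := sphere1 u; rewrite u0 -(scale0r 0) enormZ normr0 mul0r.
by move=> /esym/eqP; rewrite oner_eq0.
Qed.

Definition mk_sphere (x : V) (hx : unit_sphere R n.+1 x) : sphere R n :=
  exist (fun x => x \in unit_sphere R n.+1) x (mem_set hx).

Lemma sphereN_subproof (u : sphere R n) : unit_sphere R n.+1 (- \val u).
Proof.
by rewrite /unit_sphere/= -scaleN1r enormZ normrN1 mul1r sphere1.
Qed.

Definition sphereN (u : sphere R n) : sphere R n :=
  mk_sphere (sphereN_subproof u).

Lemma sphereN_val u : \val (sphereN u) = - \val u. Proof. by []. Qed.

Lemma polar (x : V) : exists (u : sphere R n), x = enorm x *: \val u.
Proof.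
have [x0|x0] := eqVneq (enorm x) 0.
  by exists point; rewrite x0 scale0r; exact: enorm_eq0.
have xS : unit_sphere R n.+1 ((enorm x)^-1 *: x).
  rewrite /unit_sphere/= enormZ ger0_norm ?invr_ge0 ?enorm_ge0//.
  by rewrite mulVf.
by exists (mk_sphere xS); rewrite /= scalerA mulfV// scale1r.
Qed.

Lemma radial_set_ray (f : sphere R n -> R) (u : sphere R n) (c : R) :
  (forall u, 0 <= f u) -> 0 <= c -> radial_set f (c *: \val u) <-> c <= f u.
Proof.
move=> f0 c0; split; last by move=> cf; exists u, c; rewrite c0 cf.
move=> [w [c' [/andP[c'0 c'f] E]]].
have := congr1 (@enorm R n.+1) E; rewrite !enormZ !sphere1 !mulr1.
rewrite !ger0_norm// => cc'.
move: E; rewrite -cc' => E; have [->//|cN0] := eqVneq c 0.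
suff -> : u = w by rewrite cc'.
by apply/val_inj/(scalerI cN0).
Qed.

(* A star body cuts the line through [u] in a closed interval containing 0. *)
Lemma star_section (L : set V) (u : sphere R n) :
  L 0 -> (forall v, v != 0 -> exists x y, L `&` line v = segment x y) ->
  exists a b, [/\ a <= 0, 0 <= b & forall c, L (c *: \val u) <-> a <= c <= b].
Proof.
move=> L0 /(_ _ (sphere_neq0 u)) [x [y E]].
have [/= _ [a _ ax]] : (L `&` line (\val u)) x.
  rewrite E; exists 1 => /=; first by rewrite in_itv/= ler01 lexx.
  by rewrite scale1r subrr scale0r addr0.
have [/= _ [b _ bY]] : (L `&` line (\val u)) y.
  rewrite E; exists 0 => /=; first by rewrite in_itv/= ler01 lexx.
  by rewrite scale0r subr0 scale1r add0r.
have injl (s t : R) : s *: \val u = t *: \val u -> s = t.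
  move=> /eqP; rewrite -subr_eq0 -scalerBl scaler_eq0.
  rewrite (negPf (sphere_neq0 u)) orbF.
  by rewrite subr_eq0 => /eqP.
have H c : L (c *: \val u) <-> exists2 t, 0 <= t <= 1 & t * a + (1 - t) * b = c.
  split=> [Lc|[t t01 tE]].
    have : (L `&` line (\val u)) (c *: \val u) by split => //; exists c.
    rewrite E => -[t /=]; rewrite in_itv/= => t01.
    rewrite -ax -bY !scalerA -scalerDl.
    by move=> /injl tE; exists t.
  suff [] : (L `&` line (\val u)) (c *: \val u) by [].
  rewrite E; exists t; first by rewrite /= in_itv.
  by rewrite -ax -bY !scalerA -scalerDl tE.
have K c : L (c *: \val u) <-> Num.min a b <= c <= Num.max a b.
  rewrite H; split.
    move=> [t /andP[t0 t1] <-]; rewrite ge_min le_max.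
    case: (lerP a b) => ab; apply/andP; split; apply/orP;
      [left|right|right|left]; nra.
  have [->|ab] := eqVneq a b.
    rewrite minxx maxxx => /andP[h1 h2]; exists 0; first by rewrite lexx ler01.
    lra.
  have ba : a - b != 0 by rewrite subr_eq0.
  have cE : (c - b) / (a - b) * a + (1 - (c - b) / (a - b)) * b = c by field.
  move=> hc; exists ((c - b) / (a - b)) => //.
  move: hc; case: (ltrgtP a b) ab => // hab _ /andP[h1 h2].
    rewrite -[X in 0 <= X <= _]mulrNN -invrN !opprB.
    have h : 0 < b - a by rewrite subr_gt0.
    rewrite divr_ge0 ?ler_pdivrMr//=; lra.
  have h : 0 < a - b by rewrite subr_gt0.
  rewrite divr_ge0 ?ler_pdivrMr//=; lra.
exists (Num.min a b), (Num.max a b).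
have /K/andP[? ?] : L (0 *: \val u) by rewrite scale0r.
by split.
Qed.

Lemma sup_itv_star (L : set V) (u : sphere R n) a b :
  a <= b -> (forall c, L (c *: \val u) <-> a <= c <= b) -> radial L u = b.
Proof.
move=> ab H; rewrite /radial; set S := [set _ | _].
have Sb : S b by apply/H; rewrite ab lexx.
have bS : ubound S b by move=> c /H /andP[].
apply/eqP; rewrite eq_le ge_sup//=; last by exists b.
by apply: ub_le_sup => //; exists b.
Qed.

Lemma radial_ray (L : star_body) (u : sphere R n) (c : R) :
  0 <= c -> (L : set V) (c *: \val u) <-> c <= radial L u.
Proof.
move=> c0; case: L => L [L0 Ll Lc] /=.
have [a [b [a0 b0 H]]] := star_section u L0 Ll.
by rewrite (sup_itv_star (le_trans a0 b0) H) H (le_trans a0 c0).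
Qed.

Lemma radial_ge0 (L : star_body) (u : sphere R n) : 0 <= radial L u.
Proof. by apply/radial_ray => //; rewrite scale0r; case: L => L []. Qed.

Lemma radial_continuous (L : star_body) : continuous (radial L).
Proof. by case: L => L []. Qed.

Lemma radialK (L : star_body) : radial_set (radial L) = L.
Proof.
apply/seteqP; split=> [_ [u [c [/andP[c0 cL] ->]]]|x Lx].
  exact/radial_ray.
have [u xu] := polar x; exists u, (enorm x); split=> //.
by rewrite enorm_ge0/=; apply/radial_ray; rewrite ?enorm_ge0// -xu.
Qed.

Section RadialSet.
Variable f : sphere R n -> R.
Hypothesis f0 : forall u, 0 <= f u.

Lemma radial_set_section u c :
  radial_set f (c *: \val u) <-> - f (sphereN u) <= c <= f u.
Proof.
have fu := f0 u; have fNu := f0 (sphereN u).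
have [c0|c0] := leP 0 c.
  rewrite (@radial_set_ray f u c)//; split=> [->|/andP[]//].
  by rewrite andbT; lra.
have -> : c *: \val u = (- c) *: \val (sphereN u).
  by rewrite sphereN_val scalerN scaleNr opprK.
rewrite (@radial_set_ray f (sphereN u) (- c)) //; last by rewrite oppr_ge0 ltW.
by split=> [h|/andP[h _]]; [apply/andP; split; lra|lra].
Qed.

Lemma radial_setK : radial (radial_set f) = f.
Proof.
apply/funext => u; apply: (sup_itv_star _ (@radial_set_section u)).
have := f0 u; have := f0 (sphereN u); lra.
Qed.

Hypothesis fc : continuous f.

Lemma radial_set_star : is_star_body (radial_set f).
Proof.
split; last by rewrite radial_setK.
  by exists point, 0; rewrite lexx f0 scale0r.
move=> v v0; have [u vu] := polar v.
have ev : enorm v != 0 by apply: contra_neq v0; exact: enorm_eq0.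
exists (f u *: \val u), ((- f (sphereN u)) *: \val u).
have fu := f0 u; have fNu := f0 (sphereN u).
apply/seteqP; split=> [x [+ [t _ tv]]|x [t /=]].
  rewrite -tv vu scalerA => /radial_set_section; set c := _ * _ => /andP[c1 c2].
  have [s0|s0] := eqVneq (f u + f (sphereN u)) 0.
    exists 0; first by rewrite /= in_itv/= ler01 lexx.
    rewrite scale0r add0r subr0 scale1r; congr (_ *: _); lra.
  have s1 : 0 < f u + f (sphereN u) by rewrite lt_neqAle eq_sym s0 addr_ge0.
  exists ((c + f (sphereN u)) / (f u + f (sphereN u))).
    rewrite /= in_itv/=; apply/andP; split; last by rewrite ler_pdivrMr//; lra.
    by apply: divr_ge0; lra.
  by rewrite !scalerA -scalerDl; congr (_ *: _); field.
rewrite in_itv/= => /andP[t0 t1] <-; rewrite !scalerA -scalerDl; split.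
  have h1 : 0 <= t * (f u + f (sphereN u)) by rewrite mulr_ge0 ?addr_ge0.
  have h2 : 0 <= (1 - t) * (f u + f (sphereN u)).
    by apply: mulr_ge0; lra.
  by apply/radial_set_section; apply/andP; split; lra.
exists ((t * f u + (1 - t) * - f (sphereN u)) / enorm v) => //.
by rewrite [X in _ *: X = _]vu scalerA divfK.
Qed.

End RadialSet.

Definition star_of (f : sphere R n -> R) (f0 : forall u, 0 <= f u)
  (fc : continuous f) : star_body := StarBody (radial_set_star f0 fc).

Lemma radial_add_ge0 (L M : star_body) u : 0 <= radial L u + radial M u.
Proof. by rewrite addr_ge0 ?radial_ge0. Qed.

Lemma radial_add_continuous (L M : star_body) :
  continuous (fun u => radial L u + radial M u).
Proof.
move=> u.
apply: (@continuousD _ _ _ (radial L) (radial M) u).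
  exact: (@radial_continuous L u).
exact: (@radial_continuous M u).
Qed.

Definition radial_sum (L M : star_body) : star_body :=
  star_of (@radial_add_ge0 L M) (@radial_add_continuous L M).

Lemma dilate_subproof (a : R) (a0 : 0 <= a) (L : star_body) :
  is_star_body [set a *: x | x in (L : set V)].
Proof.
have f0 u : 0 <= a * radial L u by rewrite mulr_ge0 ?radial_ge0.
have fc : continuous (fun u => a * radial L u).
  move=> u; apply: (@continuousM _ _ (cst a) (radial L) u).
    exact: cst_continuous.
  exact: (@radial_continuous L u).
rewrite (_ : [set _ | _ in _] = radial_set (fun u => a * radial L u)).
  exact: radial_set_star.
apply/seteqP; split=> [_ [x Lx <-]|_ [u [c [/andP[c0 ca] ->]]]].
  move: Lx; rewrite -{1}radialK => -[u [c [/andP[c0 cL] ->]]].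
  by exists u, (a * c); rewrite scalerA mulr_ge0//= ler_wpM2l.
have [a00|aN0] := eqVneq a 0.
  exists 0; first by case: L {f0 fc ca} => L [].
  move: ca; rewrite a00 mul0r => cle0.
  by rewrite (_ : c = 0) ?scale0r//; apply/eqP; rewrite eq_le cle0 c0.
have a1 : 0 < a by rewrite lt_neqAle eq_sym aN0 a0.
exists ((c / a) *: \val u); last by rewrite scalerA mulrC divfK.
by apply/radial_ray; rewrite ?divr_ge0// ler_pdivrMr// mulrC.
Qed.

Definition dilate (a : R) (a0 : 0 <= a) (L : star_body) : star_body :=
  StarBody (dilate_subproof a0 L).

Definition is_rotation (A : 'M[R]_n.+1) : Prop := A *m A^T = 1%:M /\ \det A = 1.

Lemma rotate_sphere_subproof (A : 'M[R]_n.+1) (hA : A *m A^T = 1%:M)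
  (u : sphere R n) : unit_sphere R n.+1 (\val u *m A).
Proof. by rewrite /unit_sphere/= enorm_mulmx// sphere1. Qed.

Definition rotate_sphere (A : 'M[R]_n.+1) (hA : A *m A^T = 1%:M)
  (u : sphere R n) : sphere R n := mk_sphere (rotate_sphere_subproof hA u).

Lemma mulmxr_continuous (A : 'M[R]_n.+1) : continuous (fun x : V => x *m A).
Proof.
move=> x; apply/(@cvgrPdist_lt _ _ _ (nbhs x) (nbhs_filter x)) => e e0.
have e1 : 0 < e / (1 + \sum_j \sum_k `|A k j|).
  by rewrite divr_gt0// ltr_pwDl// sumr_ge0// => j _; rewrite sumr_ge0.
apply: (@filterS _ (nbhs x) (nbhs_filter x) (ball x _)); last first.
  exact: (nbhsx_ballx x _ e1).
move=> y; rewrite -ball_normE /ball_/= => xy; rewrite -mulmxBl.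
have coo (z : V) i : `|z 0 i| <= `|z|.
  rewrite [leRHS]mx_normrE.
  exact: (le_bigmax _ (fun ij : 'I_1 * 'I_n.+1 => `|z ij.1 ij.2|) (0, i)).
have S0 : 0 <= \sum_j \sum_k `|A k j|.
  by rewrite sumr_ge0// => j _; rewrite sumr_ge0.
rewrite [ltLHS]mx_normrE.
apply: (@le_lt_trans _ _ (`|x - y| * \sum_j \sum_k `|A k j|)).
  apply: bigmax_le => [|[i j] _ /=]; first by rewrite mulr_ge0.
  rewrite mxE (le_trans (ler_norm_sum _ _ _))//.
  apply: (@le_trans _ _ (\sum_k `|x - y| * `|A k j|)).
    by apply: ler_sum => k _; rewrite normrM ler_wpM2r// ord1 coo.
  rewrite -mulr_sumr ler_wpM2l// [leRHS](bigD1 j)//= lerDl sumr_ge0// => k _.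
  by rewrite sumr_ge0.
move: xy; rewrite ltr_pdivlMr; last by rewrite ltr_pwDl.
by apply: le_lt_trans; rewrite mulrDr mulr1 lerDr.
Qed.

Lemma rotate_sphere_continuous (A : 'M[R]_n.+1) (hA : A *m A^T = 1%:M) :
  continuous (rotate_sphere hA).
Proof.
apply: (@continuous_comp_initial (sphere R n) _ _ set_val (rotate_sphere hA)).
move=> u.
rewrite (_ : _ \o _ =
    (fun x : V => x *m A) \o (set_val : sphere R n -> V)).
  apply: continuous_comp; first exact: initial_continuous.
  exact: mulmxr_continuous.
by apply/funext.
Qed.

Lemma rotation_tr (A : 'M[R]_n.+1) : is_rotation A -> A^T *m A^T^T = 1%:M.
Proof. by move=> [hA _]; rewrite trmxK; exact: mulmx1C. Qed.

Lemma rotate_subproof (A : 'M[R]_n.+1) (hA : is_rotation A) (L : star_body) :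
  is_star_body [set x *m A | x in (L : set V)].
Proof.
pose f := radial L \o rotate_sphere (rotation_tr hA).
have f0 u : 0 <= f u by exact: radial_ge0.
have fc : continuous f.
  move=> u; apply: continuous_comp; last exact: radial_continuous.
  exact: rotate_sphere_continuous.
rewrite (_ : [set _ | _ in _] = radial_set f); first exact: radial_set_star.
have hA' : A *m A^T = 1%:M by exact: (proj1 hA).
have hA'' : A^T *m A = 1%:M by apply: mulmx1C.
apply/seteqP; split=> [_ [x Lx <-]|_ [u [c [/andP[c0 ca] ->]]]].
  move: Lx; rewrite -{1}radialK => -[u [c [/andP[c0 cL] ->]]].
  exists (rotate_sphere hA' u), c; rewrite c0 -scalemxAl; split=> //=.
  rewrite /f /= (_ : rotate_sphere _ _ = u)//; apply/val_inj => /=.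
  by rewrite -mulmxA hA' mulmx1.
exists (c *: (\val u *m A^T)); last by rewrite -scalemxAl -mulmxA hA'' mulmx1.
by have := @radial_ray L (rotate_sphere (rotation_tr hA) u) c c0; move=> ->.
Qed.

(* Rotations act on row vectors by right multiplication. *)
Definition rotate (A : 'M[R]_n.+1) (hA : is_rotation A) (L : star_body) :
  star_body := StarBody (rotate_subproof hA L).

End StarBodies.

Arguments star_body : clear implicits.

Section Properties.
Variables (R : realType) (n m : nat).
Implicit Type F : ('I_m -> star_body R n) -> R.

Definition separately_additive F : Prop :=
  forall (i : 'I_m) (Ls : 'I_m -> star_body R n) (L M : star_body R n),
    F [eta Ls with i |-> radial_sum L M] =
    F [eta Ls with i |-> L] + F [eta Ls with i |-> M].

Definition positively_homogeneous F : Prop :=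
  forall (i : 'I_m) (Ls : 'I_m -> star_body R n) (a : R) (a0 : 0 <= a)
    (L : star_body R n),
    F [eta Ls with i |-> dilate a0 L] = a * F [eta Ls with i |-> L].

Definition separately_bounded F : Prop :=
  forall (i : 'I_m) (Ls : 'I_m -> star_body R n),
    exists C : R, forall L : star_body R n,
      (L : set _) `<=` unit_ball R n.+1 -> `|F [eta Ls with i |-> L]| <= C.

Definition difference_of_positive F : Prop :=
  exists Fp Fm : ('I_m -> star_body R n) -> R,
    [/\ separately_additive Fp /\ positively_homogeneous Fp,
        separately_additive Fm /\ positively_homogeneous Fm,
        forall Ls, 0 <= Fp Ls, forall Ls, 0 <= Fm Ls
      & forall Ls, F Ls = Fp Ls - Fm Ls].

Definition symmetric_function F : Prop :=
  forall (s : 'S_m) (Ls : 'I_m -> star_body R n), F (Ls \o s) = F Ls.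

Definition rotationally_invariant F : Prop :=
  forall (A : 'M[R]_n.+1) (hA : is_rotation A) (Ls : 'I_m -> star_body R n),
    F (fun i => rotate hA (Ls i)) = F Ls.

Definition associated_polynomial F (L : star_body R n) : R := F (fun=> L).

Definition vanishes_on_disjoint F : Prop :=
  forall Ls : 'I_m -> star_body R n,
    (exists i1 i2 : 'I_m,
       i1 != i2 /\ (Ls i1 : set _) `&` Ls i2 = [set 0]) ->
    F Ls = 0.

Definition orthogonally_additive (P : star_body R n -> R) : Prop :=
  forall L M : star_body R n, (L : set _) `&` M = [set 0] ->
    P (radial_sum L M) = P L + P M.

End Properties.

Section ChargeIntegral.
Context d (T : measurableType d) (R : realType).
Variable nu : {charge set T -> \bar R}.

Lemma Hahn_pair : exists PN : set T * set T, hahn_decomposition nu PN.1 PN.2.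
Proof. by have [P [N h]] := Hahn_decomposition nu; exists (P, N). Qed.

(* The positive, negative and total variations of [nu] do not depend on the
   chosen Hahn decomposition. *)
Definition charge_pos := jordan_pos (projT2 (cid Hahn_pair)).
Definition charge_neg := jordan_neg (projT2 (cid Hahn_pair)).
Definition charge_tv := charge_variation (projT2 (cid Hahn_pair)).

Definition charge_integral (f : T -> R) : R :=
  (\int[charge_pos]_x f x - \int[charge_neg]_x f x)%R.

End ChargeIntegral.

Definition regular_charge (R : realType) (n : nat)
    (mu : {charge set (borel_sphere R n) -> \bar R}) : Prop :=
  forall (A : set (borel_sphere R n)) (e : R), measurable A -> 0 < e ->
    exists K U : set (sphere R n),
      [/\ compact K, open U, K `<=` A, A `<=` U
        & (charge_tv mu (U `\` K) < e%:E)%E].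

Definition represented_by_measure (R : realType) (n m : nat)
    (F : ('I_m -> star_body R n) -> R) : Prop :=
  exists mu : {charge set (borel_sphere R n) -> \bar R},
    regular_charge mu /\
    forall Ls : 'I_m -> star_body R n,
      F Ls = charge_integral mu (fun t => \prod_(i < m) radial (Ls i) t).

(* Lebesgue measure of Borel subsets of R^n, by integrating the measures of the
   sections (Tonelli). *)
Fixpoint lebesgue_rV (R : realType) (n : nat) : set 'rV[R]_n -> \bar R :=
  match n with
  | 0 => fun A => (\1_A (0 : 'rV[R]_0))%:E
  | n'.+1 => fun A : set 'rV[R]_(1 + n') =>
      (\int[@lebesgue_measure R]_x
        lebesgue_rV [set y : 'rV[R]_n' | A (row_mx (const_mx x) y)])%E
  end.

(* Spherical Lebesgue measure as a cone measure: for a Borel set [A], the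
   surface area of [A] is [n.+1] times the volume of the cone over [A]. *)
Definition sphere_cone (R : realType) (n : nat) (A : set (sphere R n)) :
    set 'rV[R]_n.+1 :=
  [set x | exists t u, [/\ 0 < t <= 1, A u & x = t *: \val u]].

Definition sphere_measure (R : realType) (n : nat)
    (A : set (borel_sphere R n)) : \bar R :=
  (n.+1%:R%:E * lebesgue_rV (sphere_cone A))%E.

Definition dual_mixed_volume (R : realType) (n : nat)
    (Ls : 'I_n.+1 -> star_body R n) : R :=
  n.+1%:R^-1 * fine (\int[@sphere_measure R n]_(u in [set: borel_sphere R n])
                       (\prod_(i < n.+1) radial (Ls i) u)%:E)%E.

(* Main.v *)
(* Functionals on star bodies extend to linear functionals on C(S^{n-1}), and
   positivity or separate boundedness makes them bounded in each variable.

   (1) => (3): the key is that F depends only on the product of the radial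
   functions. For a bilinear b vanishing on disjointly supported pairs, write
   N f = sum_k k phi_k with tents phi_k supported in {|N f - k| <= 1}. Then
   N (b(f, g) - b(1, f g)) = - sum_k b(phi_k, (N f - k) g), and after truncating
   N f - k and grouping k by residues mod 4 the right-hand side is a sum of four
   terms b(Phi_r, Q_r) with Phi_r and Q_r bounded independently of N. By uniform
   boundedness it stays bounded, so b(f, g) = b(1, f g). Iterating,
   F(L_1, ..., L_m) is a bounded linear functional of the product, and the
   Riesz-Markov theorem applies to the two parts of its Jordan decomposition.

   (2) => (1): if the bodies split into two nonempty families, disjoint from each
   other, then orthogonal additivity and the polarization formula give F = 0. If
   L_i and L_j are only disjoint, truncate their radial functions, so that they
   are separated by a level gap of rho_{L_j} - rho_{L_i}, and cut the other bodies
   one by one inside the gap.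

   Rotation-invariant case: averaging a continuous function over finitely many
   rotations brings it uniformly close to a constant, so a rotation-invariant
   bounded linear functional is determined by its value at the unit ball.
   Spherical measure is rotation invariant because Lebesgue measure is, by
   uniqueness of translation-invariant measures. *)

From HB Require Import structures.
Require Import Defs.
From mathcomp Require Import all_boot all_order all_algebra all_fingroup.
From mathcomp Require Import ring lra zify.
From mathcomp Require Import all_classical all_reals all_analysis.
From mathcomp Require Import measurable_realfun.

Set Implicit Arguments.
Unset Strict Implicit.
Unset Printing Implicit Defensive.

Import Order.TTheory GRing.Theory Num.Theory.
Import numFieldNormedType.Exports.

Local Open Scope classical_set_scope.
Local Open Scope ring_scope.

(** * Continuous functions and the Riesz-Markov theorem *)

(** On the support of one tent [f] differs from [k / N] by at most [1 / N], so each of the roughly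
    [N] tents costs an error of order [1 / N]; merely adding these errors gains nothing.
    Orthogonality makes the difference: inside a residue class the tents do not interact, so a whole
    class acts as one pair of bounded functions and the total error is of order [1 / N]. The bound
    for one variable depends on the others, and no joint bound is assumed; since [Phi_r] changes
    with [N], pointwise bounds must first be made uniform. Polarization enters because (2) controls
    only the diagonal: in its alternating sum over subsets, a summand that ignores one index cancels
    in pairs. The rotation-invariant part replaces Haar measure on the rotation group by finite
    averages; they suffice because rotations are isometries, so all averages share one modulus of
    continuity. Spherical measure is built from a volume defined coordinate by coordinate, in which
    rotations are invisible; comparing that volume with its rotated copy on the unit ball fixes the
    constant left open by uniqueness. *)

Section ContinuousFunctions.
Variables (R : realType) (X : topologicalType).
Implicit Types f g : X -> R.

Lemma contD f g : continuous f -> continuous g ->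
  continuous (fun x => f x + g x).
Proof. by move=> fc gc x; apply: (@continuousD _ _ _ f g); [exact: fc|exact: gc]. Qed.

Lemma contB f g : continuous f -> continuous g ->
  continuous (fun x => f x - g x).
Proof. by move=> fc gc x; apply: (@continuousB _ _ _ f g); [exact: fc|exact: gc]. Qed.

Lemma contN f : continuous f -> continuous (fun x => - f x).
Proof. by move=> fc x; apply: (@continuousN _ _ _ f); exact: fc. Qed.

Lemma contM f g : continuous f -> continuous g ->
  continuous (fun x => f x * g x).
Proof. by move=> fc gc x; apply: (@continuousM _ _ f g); [exact: fc|exact: gc]. Qed.

Lemma cont_cst (c : R) : continuous (fun _ : X => c).
Proof. by move=> x; exact: cst_continuous. Qed.

Lemma contZ c f : continuous f -> continuous (fun x => c * f x).
Proof. by apply: contM; exact: cont_cst. Qed.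

Lemma cont_max f g : continuous f -> continuous g ->
  continuous (fun x => Num.max (f x) (g x)).
Proof. by move=> fc gc x; apply: (@continuous_max _ _ f g); [exact: fc|exact: gc]. Qed.

Lemma cont_min f g : continuous f -> continuous g ->
  continuous (fun x => Num.min (f x) (g x)).
Proof. by move=> fc gc x; apply: (@continuous_min _ _ f g); [exact: fc|exact: gc]. Qed.

Lemma cont_sum (I : Type) (r : seq I) (P : pred I) (h : I -> X -> R) :
  (forall i, P i -> continuous (h i)) -> continuous (fun x => \sum_(i <- r | P i) h i x).
Proof.
move=> hc; elim: r => [|i r ih].
  have -> : (fun x => \sum_(i <- [::] | P i) h i x) = cst 0.
    by apply/funext => x; rewrite big_nil.
  exact: cont_cst.
rewrite (_ : (fun x => \sum_(j <- i :: r | P j) h j x) =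
    fun x => (if P i then h i x else 0) + \sum_(j <- r | P j) h j x).
  by apply: contD => //; case: (boolP (P i)) => [/hc//|_]; exact: cont_cst.
by apply/funext => x; rewrite big_cons; case: ifPn => // _; rewrite add0r.
Qed.

Lemma cont_prod (I : Type) (r : seq I) (P : pred I) (h : I -> X -> R) :
  (forall i, P i -> continuous (h i)) -> continuous (fun x => \prod_(i <- r | P i) h i x).
Proof.
move=> hc; elim: r => [|i r ih].
  have -> : (fun x => \prod_(i <- [::] | P i) h i x) = cst 1.
    by apply/funext => x; rewrite big_nil.
  exact: cont_cst.
rewrite (_ : (fun x => \prod_(j <- i :: r | P j) h j x) =
    fun x => (if P i then h i x else 1) * \prod_(j <- r | P j) h j x).
  by apply: contM => //; case: (boolP (P i)) => [/hc//|_]; exact: cont_cst.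
by apply/funext => x; rewrite big_cons; case: ifPn => // _; rewrite mul1r.
Qed.

Lemma cont_open_lt f g : continuous f -> continuous g ->
  open [set x | f x < g x].
Proof.
move=> fc gc.
rewrite (_ : [set x | f x < g x] = (fun x => g x - f x) @^-1` [set y | 0 < y]).
  apply: open_comp; last exact: open_gt.
  by move=> x _; exact: contB.
by apply/seteqP; split => x /=; rewrite subr_gt0.
Qed.

End ContinuousFunctions.

Section CompactFunctions.
Variables (R : realType) (X : ptopologicalType).
Hypothesis compactX : compact [set: X].

Lemma cont_bounded (f : X -> R) : continuous f ->
  exists2 M, 0 < M & forall x, `|f x| <= M.
Proof.
move=> fc; have nfc : continuous (fun x => `|f x|).
  by move=> x; apply: continuous_comp; [exact: fc|exact: norm_continuous].
have [||c _ cM] := @compact_EVT_max X R (fun x => `|f x|) [set: X] _ compactX.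
- by exists point.
- by apply: continuous_subspaceT; exact: nfc.
exists (`|f c| + 1) => [|x]; first by rewrite ltr_pwDr.
by rewrite (le_trans (cM x _)) ?inE// lerDl.
Qed.

(** The largest index of a finite subcover already covers. This form of compactness yields the Dini
    argument in [fouter_ge] and the Lebesgue number in [sphere_uniform_continuity]. *)
Lemma increasing_open_cover (O : nat -> set X) :
  (forall n, open (O n)) -> (forall n, O n `<=` O n.+1) ->
  (forall x, exists n, O n x) -> exists n, O n = [set: X].
Proof.
move=> Oo Oinc Ocov; move: compactX; rewrite compact_cover => cX.
have [|D _ Dcov] := cX nat [set: nat] O (fun i _ => Oo i).
  by move=> x _; have [n Onx] := Ocov x; exists n.
have Omono m n : (m <= n)%N -> O m `<=` O n.
  elim: n => [|n ih]; first by rewrite leqn0 => /eqP ->.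
  rewrite leq_eqVlt => /predU1P[->//|]; rewrite ltnS => /ih.
  by move=> h; apply: subset_trans h _.
exists (\max_(i <- finmap.enum_fset D) i)%N; apply/seteqP; split => // x _.
have [i iD Oix] := Dcov x I.
by apply: (Omono i) => //; exact: leq_bigmax_seq.
Qed.

End CompactFunctions.

(** The enumeration [p] is chosen before [u], so that one reordering serves both the costs and the
    pointwise values of a doubly indexed cover. *)
Lemma nneseries_pair (R : realType) : exists p : nat -> nat * nat,
  forall u : nat -> nat -> \bar R, (forall i j, (0 <= u i j)%E) ->
  (\sum_(k <oo) u (p k).1 (p k).2 = \sum_(i <oo) \sum_(j <oo) u i j)%E.
Proof.
have /card_esym/ppcard_eqP[p] := card_nat2; exists p => u u0.
rewrite nneseries_esumT; last by move=> n; exact: u0.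
rewrite -(@reindex_esum _ _ _ setT setT p (fun x => u x.1 x.2)).
  under eq_eseriesr => i _ do rewrite nneseries_esumT//.
  rewrite nneseries_esumT; last by move=> n; exact: esum_ge0.
  rewrite esum_esum//; congr esum.
  by apply/seteqP; split.
exact: bij.
Qed.

Lemma cont_measurable (R : realType) (X : ptopologicalType) (f : X -> R) :
  continuous f -> measurable_fun [set: g_sigma_algebraType (@open X)] f.
Proof.
move=> fc; apply: (measurability _ (RGenOInfty.measurableE R)) => _ [_ [r ->] <-].
rewrite setTI; apply: sub_sigma_algebra.
rewrite (_ : _ @^-1` _ = [set x | r < f x]).
  by apply: cont_open_lt => //; exact: cont_cst.
by apply/seteqP; split => x /=; rewrite in_itv/= andbT.
Qed.

(** Layer-cake step: the slice of [a] between the heights [b] and [b + e] raises the truncation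
    level from [b] to [b + e]. Iterated in [riesz_le] and in [sum_ramp]. *)
Lemma min_layer (R : realFieldType) (a b e : R) : 0 < e ->
  Num.min a b + Num.min e (Num.max 0 (a - b)) = Num.min a (b + e).
Proof.
move=> e0; have [ab|ab] := leP a b.
  have h0 : a - b <= 0 by lra.
  have h1 : a <= b + e by lra.
  by rewrite (max_l h0) (min_r (ltW e0)) (min_l h1) addr0.
have h0 : 0 <= a - b by lra.
rewrite (max_r h0); have [abe|abe] := leP e (a - b).
  by rewrite min_r; lra.
by rewrite min_l; lra.
Qed.

(** * Riesz-Markov theorem by an outer measure *)

Section PositiveFunctional.
Variables (R : realType) (X : ptopologicalType) (I : (X -> R) -> R).
Implicit Types f g : X -> R.
Hypothesis compactX : compact [set: X].
Hypothesis open_pos : forall U : set X, open U ->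
  exists2 g : X -> R, continuous g /\ (forall x, 0 <= g x) & U = [set x | 0 < g x].
Hypothesis I_add : forall f g, continuous f -> continuous g ->
  I (fun x => f x + g x) = I f + I g.
Hypothesis I_hom : forall (a : R) f, continuous f -> I (fun x => a * f x) = a * I f.
Hypothesis I_ge0 : forall f, continuous f -> (forall x, 0 <= f x) -> 0 <= I f.
Implicit Types A : set X.

Lemma pfun0 : I (fun=> 0) = 0.
Proof.
transitivity (I (fun=> 0 * 0)); first by rewrite mulr0.
by rewrite I_hom ?mul0r//; exact: cont_cst.
Qed.

Lemma pfun_cst (a : R) : I (fun=> a) = a * I (fun=> 1).
Proof.
by rewrite -I_hom ?mulr1//; exact: cont_cst.
Qed.

Lemma pfunB f g : continuous f -> continuous g ->
  I (fun x => f x - g x) = I f - I g.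
Proof.
move=> fc gc; apply/(addIr (I g)); rewrite subrK -I_add//; last exact: contB.
by congr I; apply/funext => x; rewrite subrK.
Qed.

Lemma pfun_le f g : continuous f -> continuous g ->
  (forall x, f x <= g x) -> I f <= I g.
Proof.
move=> fc gc fg; rewrite -subr_ge0 -pfunB// I_ge0//; first exact: contB.
by move=> x; rewrite subr_ge0.
Qed.

Lemma pfun_sum (n : nat) (h : nat -> X -> R) : (forall k, continuous (h k)) ->
  I (fun x => \sum_(k < n) h k x) = \sum_(k < n) I (h k).
Proof.
move=> hc; elim: n => [|n ih].
  by rewrite big_ord0 -[RHS]pfun0; congr I; apply/funext => x; rewrite big_ord0.
rewrite big_ord_recr/= -ih -I_add//; last by apply: cont_sum.
by congr I; apply/funext => x; rewrite big_ord_recr.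
Qed.

Definition fcover A (c : nat -> X -> R) :=
  [/\ forall n, continuous (c n), forall n x, 0 <= c n x
    & forall x, A x -> (1 <= \sum_(n <oo) (c n x)%:E)%E].

Definition fcost (c : nat -> X -> R) : \bar R := (\sum_(n <oo) (I (c n))%:E)%E.

(* The outer measure generated by the functional, as in the Daniell approach:
   sets are covered by countable sums of nonnegative continuous functions. *)
Definition fouter A : \bar R := ereal_inf (fcost @` fcover A).

Local Open Scope ereal_scope.

Lemma fcost_ge0 A c : fcover A c -> 0 <= fcost c.
Proof. by case=> cc c0 _; apply: nneseries_ge0 => n _ _; rewrite lee_fin I_ge0. Qed.

Lemma fouter_ge0 A : 0 <= fouter A.
Proof. by apply: le_ereal_inf_tmp => _ [c cA <-]; exact: fcost_ge0 cA. Qed.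

Lemma fouter_le A c : fcover A c -> fouter A <= fcost c.
Proof. by move=> cA; apply: ereal_inf_lbound; exists c. Qed.

Lemma fcover1 A f : continuous f -> (forall x, 0 <= f x)%R ->
  (forall x, A x -> 1 <= f x)%R ->
  fcover A (fun n => if n is 0%N then f else fun=> 0%R).
Proof.
move=> fc f0 f1; split=> [[|n]//|[|n] x//|x Ax]; first exact: cont_cst.
rewrite nneseries_recl//; last by case=> [|n] _; rewrite lee_fin.
by rewrite eseries0 ?adde0 ?lee_fin ?f1// => -[].
Qed.

Lemma fouter1_le A f : continuous f -> (forall x, 0 <= f x)%R ->
  (forall x, A x -> 1 <= f x)%R -> fouter A <= (I f)%:E.
Proof.
move=> fc f0 f1; rewrite (le_trans (fouter_le (fcover1 fc f0 f1)))// /fcost.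
rewrite nneseries_recl//; last by case=> [|n] _; rewrite lee_fin; [exact: I_ge0|rewrite pfun0].
by rewrite eseries0 ?adde0// => -[|i] //= _ _; rewrite pfun0.
Qed.

Lemma fouter0 : fouter set0 = 0.
Proof.
apply/eqP; rewrite eq_le fouter_ge0 andbT.
by rewrite -[leRHS]/(0%R)%:E -[X in X%:E]pfun0 fouter1_le//; exact: cont_cst.
Qed.

Lemma fouter_homo : {homo fouter : A B / A `<=` B >-> A <= B}.
Proof.
move=> A B AB; apply: ereal_inf_le_tmp => _ [c [c1 c2 c3] <-].
by exists c => //; split=> // x /AB; exact: c3.
Qed.

Lemma fouter_sigma_subadditive : sigma_subadditive fouter.
Proof.
move=> A; have [[i ioo]|] := pselect (exists i, fouter (A i) = +oo).
  rewrite (eseries_pinfty _ _ ioo) ?leey// => n _.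
  by rewrite -ltNye (lt_le_trans _ (fouter_ge0 _)).
rewrite -forallNE => Aoo.
apply/lee_addgt0Pr => e e0.
rewrite (le_trans _ (epsilon_trick _ _ (ltW e0)))//; last first.
  by move=> n; exact: fouter_ge0.
pose P n c := fcover (A n) c /\ fcost c <= fouter (A n) + (e / (2 ^ n.+1)%:R)%:E.
have [c Pc] : {c : nat -> nat -> X -> R & forall n, P n (c n)}.
  apply: (@choice _ _ P) => n.
  have en1 : (0 < e / (2 ^ n.+1)%:R)%R by rewrite divr_gt0// ltr0n expn_gt0.
  have fn : fouter (A n) \is a fin_num.
    by rewrite ge0_fin_numE ?fouter_ge0// ltey; apply/eqP; exact: Aoo.
  have [_ [c cA <-] /ltW ?] := lb_ereal_inf_adherent en1 fn.
  by exists c.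
have c0 n k x : (0 <= c n k x)%R by have [[]] := Pc n.
have cc n k : continuous (c n k) by have [[]] := Pc n.
have [p pE] := @nneseries_pair R.
apply: (@le_trans _ _ (\sum_(n <oo) fcost (c n))); last first.
  apply: lee_nneseries => [n _ _|n _]; last by have [] := Pc n.
  by have [+ _] := Pc n; exact: fcost_ge0.
rewrite -(pE (fun n k => (I (c n k))%:E)); last by move=> i j; rewrite lee_fin I_ge0.
apply: (@fouter_le _ (fun k => c (p k).1 (p k).2)); split => // x [n _ Anx].
rewrite (pE (fun n k => (c n k x)%:E)); last by move=> i j; rewrite lee_fin.
have [[_ _ /(_ _ Anx) h] _] := Pc n; apply: (le_trans h).
apply: le_trans (nneseries_lim_ge n.+1 _) => /=; last first.
  by move=> *; apply: nneseries_ge0 => *; rewrite lee_fin.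
rewrite big_nat_recr//= leeDr// sume_ge0// => *; apply: nneseries_ge0 => *.
by rewrite lee_fin.
Qed.

HB.instance Definition _ := isOuterMeasure.Build R X fouter fouter0
  fouter_ge0 fouter_homo fouter_sigma_subadditive.

(** The functions [phi K = min(1, K g)] increase to the indicator of [G] and vanish off [G]. Split a
    cover [c] of [A] into [c * phi K] and [c * (1 - phi K)]: the second family covers the part of
    [A] outside [G], the first covers [A] inside [G] in the limit, and the two costs add up to that
    of [c]. The increments [psi] turn the limit in [K] into one countable cover. *)
Lemma pos_set_caratheodory g : continuous g -> (forall x, 0 <= g x)%R ->
  fouter.-caratheodory [set x | (0 < g x)%R].
Proof.
move=> gc g0; set G := [set x | _].
apply: le_caratheodory_measurable => A.
suff : fouter (A `&` G) + fouter (A `&` ~` G) <= fouter A by [].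
apply: le_ereal_inf_tmp => _ [c cA <-]; have [cc c0 c1] := cA.
pose phi (K : nat) (x : X) : R := (Num.min 1 (K%:R * g x))%R.
have phic K : continuous (phi K) by apply: cont_min; [exact: cont_cst|exact: contZ].
have phi0 K x : (0 <= phi K x)%R by rewrite le_min ler01 mulr_ge0.
have phi1 K x : (phi K x <= 1)%R by rewrite ge_min lexx.
pose psi K (x : X) : R := (phi K.+1 x - phi K x)%R.
have psic K : continuous (psi K) by apply: contB.
have psi0 K x : (0 <= psi K x)%R.
  rewrite subr_ge0 /phi le_min !ge_min lexx/= ler_wpM2r ?orbT//.
  by rewrite ler_nat.
have psiE K x : (\sum_(k < K) psi k x = phi K x)%R.
  rewrite -(big_mkord xpredT (psi^~ x)) telescope_sumr//.
  suff -> : phi 0%N x = 0%R by rewrite subr0.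
  by rewrite /phi mul0r minElt ltr10.
have AG : fouter (A `&` G) <= \sum_(k <oo) \sum_(n <oo) (I (fun x => c n x * psi k x)%R)%:E.
  have [p pE] := @nneseries_pair R.
  rewrite -(pE (fun k n => (I (fun x => c n x * psi k x)%R)%:E)); last first.
    by move=> i j; rewrite lee_fin I_ge0// => [|x]; [exact: contM|rewrite mulr_ge0].
  apply: (@fouter_le _ (fun j x => c (p j).2 x * psi (p j).1 x)%R); split.
  - by move=> n; exact: contM.
  - by move=> n x; rewrite mulr_ge0.
  move=> x [Ax Gx]; rewrite (pE (fun k n => (c n x * psi k x)%:E)); last first.
    by move=> i j; rewrite lee_fin mulr_ge0.
  (* At a fixed point of [G] the increments sum to exactly 1 after finitely many terms. *)
  have [K hK] : exists K, phi K x = 1%R.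
    exists (Num.bound (g x)^-1); apply/min_idPl.
    rewrite -ler_pdivrMr// div1r ltW// archi_boundP//.
    by rewrite invr_ge0.
  apply: le_trans (nneseries_lim_ge K _) => /=; last first.
    by move=> *; apply: nneseries_ge0 => *; rewrite lee_fin mulr_ge0.
  rewrite -nneseries_sum; last by move=> *; rewrite lee_fin mulr_ge0.
  apply: (le_trans (c1 x Ax)); apply: lee_nneseries => n *; first by rewrite lee_fin.
  by rewrite sumEFin lee_fin -mulr_sumr big_mkord psiE hK mulr1.
apply: le_trans (leeD2r _ AG) _.
have key K : \sum_(0 <= k < K) \sum_(n <oo) (I (fun x => c n x * psi k x)%R)%:E +
    fouter (A `&` ~` G) <= fcost c.
  have h : fouter (A `&` ~` G) <= \sum_(n <oo) (I (fun x => c n x * (1 - phi K x))%R)%:E.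
    apply: (@fouter_le _ (fun n x => c n x * (1 - phi K x))%R); split.
    - by move=> n; apply: contM => //; apply: contB => //; exact: cont_cst.
    - by move=> n x; rewrite mulr_ge0// subr_ge0.
    move=> x [Ax /negP]; rewrite -leNgt => gx.
    apply: (le_trans (c1 x Ax)); apply: lee_nneseries => n *; first by rewrite lee_fin.
    have gx0 : g x = 0%R by apply/eqP; rewrite eq_le gx g0.
    by rewrite /phi gx0 mulr0 minElt ltr10/= subr0 mulr1.
  apply: (le_trans (leeD2l _ h)).
  rewrite -nneseries_sum; last first.
    by move=> *; rewrite lee_fin I_ge0// => [|x]; [exact: contM|rewrite mulr_ge0].
  rewrite -nneseriesD.
  - apply: lee_nneseries => n *.
      rewrite adde_ge0// ?sume_ge0// => *; rewrite lee_fin I_ge0//.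
      + exact: contM.
      + by move=> *; rewrite mulr_ge0.
      + by apply: contM => //; apply: contB => //; exact: cont_cst.
      + by move=> *; rewrite mulr_ge0// subr_ge0.
    rewrite sumEFin -EFinD lee_fin big_mkord -(@pfun_sum _ (fun k x => c n x * psi k x)%R).
      rewrite -I_add//.
      * rewrite le_eqVlt; apply/orP; left; apply/eqP; congr I; apply/funext => x.
        by rewrite -mulr_sumr psiE -mulrDr subrKC mulr1.
      * by apply: cont_sum => *; exact: contM.
      * by apply: contM => //; apply: contB => //; exact: cont_cst.
    by move=> k; exact: contM.
  - move=> *; rewrite sume_ge0// => *; rewrite lee_fin I_ge0//; first exact: contM.
    by move=> *; rewrite mulr_ge0.
  - move=> *; rewrite lee_fin I_ge0//.
    + by apply: contM => //; apply: contB => //; exact: cont_cst.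
    + by move=> *; rewrite mulr_ge0// subr_ge0.
have cvgs : cvgn (fun K => \sum_(0 <= k < K) \sum_(n <oo) (I (fun x => c n x * psi k x)%R)%:E).
  apply: is_cvg_nneseries => *; apply: nneseries_ge0 => *.
  by rewrite lee_fin I_ge0// => [|x]; [exact: contM|rewrite mulr_ge0].
(* The limit in [K] is taken after subtracting the second outer measure, hence the case split on its
   finiteness. *)
move: key; move E : (fouter (A `&` ~` G)) => [r| |] key.
- rewrite -leeBrDr//; apply: (lime_le cvgs); apply: nearW => K.
  by rewrite leeBrDr.
- have := key 0%N; rewrite big_nil add0e leye_eq => /eqP ->; exact: leey.
- by have := fouter_ge0 (A `&` ~` G); rewrite E.
Qed.

(** Any cover of [A] sums to at least [h] everywhere. Its partial sums exceed [h - d] on increasing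
    open sets that exhaust [X], so by compactness a single finite sum exceeds [h - d] everywhere. *)
Lemma fouter_ge A (h : X -> R) : continuous h -> (forall x, h x <= 1)%R ->
  (forall x, ~ A x -> h x <= 0)%R -> (I h)%:E <= fouter A.
Proof.
move=> hc h1 h0; apply: le_ereal_inf_tmp => _ [c [cc c0 c1] <-].
apply/lee_addgt0Pr => e e0.
have I1 : (0 <= I (fun=> 1))%R by apply: I_ge0 => //; exact: cont_cst.
(* Chosen so that [d * I 1 <= e]; the added 1 keeps the denominator positive. *)
pose d := (e / (I (fun=> 1) + 1))%R.
have d0 : (0 < d)%R by rewrite divr_gt0// ltr_wpDl.
pose S n x : R := (\sum_(k < n) c k x)%R.
have Sc n : continuous (S n) by apply: cont_sum.
have Sinc n x : (S n x <= S n.+1 x)%R by rewrite /S big_ord_recr/= lerDl.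
have [||x|n On] := @increasing_open_cover X compactX (fun n => [set x | (h x - d < S n x)%R]).
- by move=> n; apply: cont_open_lt => //; apply: contB => //; exact: cont_cst.
- by move=> n x /= /lt_le_trans; apply.
- have [Ax|/h0 hx] := pselect (A x); last first.
    by exists 0%N; rewrite /= /S big_ord0; rewrite subr_lt0 (le_lt_trans hx).
  apply: contrapT => /forallNP H; move: (c1 x Ax).
  suff : (\sum_(n <oo) (c n x)%:E <= (1 - d)%:E).
    move=> /[swap] /le_trans /[apply]; rewrite lee_fin; lra.
  apply: lime_le; first by apply: is_cvg_nneseries => *; rewrite lee_fin.
  apply: nearW => n; rewrite sumEFin lee_fin big_mkord.
  have /negP := H n; rewrite /= -leNgt => /le_trans; apply.
  by rewrite lerB.
have hS x : (h x <= S n x + d)%R.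
  have : [set: X] x by []. rewrite -On /= => ?; lra.
have : (I h <= I (S n) + e)%R.
  have : (I h <= I (fun x => S n x + d))%R.
    by apply: pfun_le => //; apply: contD => //; exact: cont_cst.
  rewrite I_add//; last exact: cont_cst.
  move=> /le_trans; apply; rewrite lerD2l pfun_cst /d -mulrA ler_piMr ?(ltW e0)//.
  by rewrite mulrC ler_pdivrMr ?mul1r ?lerDl// ltr_wpDl.
rewrite pfun_sum// -lee_fin => /le_trans; apply; rewrite EFinD leeD2r//.
rewrite -sumEFin -(big_mkord xpredT (fun k => (I (c k))%:E)).
by apply: nneseries_lim_ge => *; rewrite lee_fin I_ge0.
Qed.

Lemma fouterT : fouter [set: X] = (I (fun=> 1%R))%:E.
Proof.
apply/eqP; rewrite eq_le; apply/andP; split.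
  by apply: fouter1_le => //; exact: cont_cst.
by apply: fouter_ge => // [|x []//]; exact: cont_cst.
Qed.

Definition riesz_measure (A : set (g_sigma_algebraType (@open X))) := fouter A.

Lemma borel_caratheodory (A : set X) : <<s @open X >> A -> fouter.-caratheodory A.
Proof.
apply: smallest_sub; last by move=> U /open_pos[g [gc g0] ->]; exact: pos_set_caratheodory.
split => [|B mB|B mB].
- exact: caratheodory_measurable_set0.
- by rewrite setTD; exact: caratheodory_measurable_setC.
- exact: caratheodory_measurable_bigcup.
Qed.

Let riesz_sigma_additive : semi_sigma_additive riesz_measure.
Proof.
move=> A mA tA mB.
apply: (@caratheodory_measure_sigma_additive R X fouter A) => //.
  by move=> i; exact: (borel_caratheodory (mA i)).
exact: (borel_caratheodory mB).
Qed.

HB.instance Definition _ := isMeasure.Build _ _ R riesz_measure fouter0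
  fouter_ge0 riesz_sigma_additive.

Let riesz_fin : fin_num_fun riesz_measure.
Proof.
move=> A _; rewrite ge0_fin_numE ?fouter_ge0//.
by rewrite (le_lt_trans (fouter_homo (@subsetT _ A)))// fouterT ltry.
Qed.

HB.instance Definition _ := @Measure_isFinite.Build _ _ R riesz_measure riesz_fin.

(** Slice [g] into layers [h k] of height [e]. Layer [k.+1] is at most [e] and lives on the set
    where layer [k] is full, whose measure is at most [I (h k) / e]. The shift by one leaves only
    the bottom layer, which costs at most [e * I 1]. *)
Let riesz_le g : continuous g -> (forall x, 0 <= g x)%R ->
  \int[riesz_measure]_x (g x)%:E <= (I g)%:E.
Proof.
move=> gc g0.
have [M M0 gM] := cont_bounded compactX gc.
have I1 : (0 <= I (fun=> 1))%R by apply: I_ge0 => //; exact: cont_cst.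
suff main (e : R) : (0 < e)%R ->
    \int[riesz_measure]_x (g x)%:E <= (I g + e * I (fun=> 1))%:E.
  apply/lee_addgt0Pr => e e0; rewrite -EFinD.
  have d0 : (0 < e / (I (fun=> 1) + 1))%R by rewrite divr_gt0// ltr_wpDl.
  apply: (le_trans (main _ d0)); rewrite lee_fin lerD2l -mulrA ler_piMr ?(ltW e0)//.
  by rewrite mulrC ler_pdivrMr ?mul1r ?lerDl// ltr_wpDl.
move=> e0.
pose h (k : nat) (x : X) : R := (Num.min e (Num.max 0 (g x - k%:R * e)))%R.
have hc k : continuous (h k).
  apply: cont_min; first exact: cont_cst.
  by apply: cont_max; [exact: cont_cst|apply: contB => //; exact: cont_cst].
have h0 k x : (0 <= h k x)%R by rewrite /h le_min (ltW e0) le_max lexx.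
have hE n x : (\sum_(k < n) h k x = Num.min (g x) (n%:R * e))%R.
  elim: n => [|n ih].
    by rewrite big_ord0 mul0r minElt; case: ltP => //; have := g0 x; lra.
  by rewrite big_ord_recr/= ih /h -natr1 mulrDl mul1r min_layer.
have hI1 k : \int[riesz_measure]_x (h k.+1 x)%:E <= (I (h k))%:E.
  pose A := [set x | (k.+1%:R * e < g x)%R].
  have mA : measurable (A : set (g_sigma_algebraType (@open X))).
    by apply: sub_sigma_algebra; apply: cont_open_lt => //; exact: cont_cst.
  apply: (@le_trans _ _ (\int[riesz_measure]_x (e%:E * (\1_A x)%:E))).
    apply: ge0_le_integral => //.
    - by move=> x _; rewrite lee_fin.
    - by apply/measurable_EFinP; exact: cont_measurable.
    - apply: measurable_funeM; apply/measurable_EFinP; exact: measurable_indic.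
    - move=> x _; rewrite -EFinM lee_fin indicE.
      have [xA|xA] := boolP (x \in A); first by rewrite mulr1 ge_min lexx.
      rewrite mulr0 ge_min; apply/orP; right.
      have : ~ A x by move=> /mem_set; rewrite (negPf xA).
      by move=> /negP; rewrite /A/= -leNgt ge_max lexx/= subr_le0.
  rewrite ge0_integralZl//; last 2 first.
  - by apply/measurable_EFinP; exact: measurable_indic.
  - by rewrite lee_fin ltW.
  rewrite integral_indic// setIT.
  have : riesz_measure A <= (I (fun x => e^-1 * h k x)%R)%:E.
    apply: fouter1_le; first exact: contZ.
      by move=> x; rewrite mulr_ge0// invr_ge0 ltW.
    move=> x /= Ax; rewrite mulrC ler_pdivlMr// mul1r le_min lexx/= le_max.
    by apply/orP; right; move: Ax; rewrite /A/= -natr1 mulrDl mul1r; lra.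
  rewrite I_hom// => h1.
  apply: (le_trans (lee_wpmul2l _ h1)); first by rewrite lee_fin ltW.
  by rewrite -EFinM mulrA divff ?gt_eqF// mul1r.
have hI0 : \int[riesz_measure]_x (h 0%N x)%:E <= (e * I (fun=> 1))%:E.
  apply: (@le_trans _ _ (\int[riesz_measure]_x (cst e%:E x))).
    apply: ge0_le_integral => //.
    - by move=> x _; rewrite lee_fin.
    - by apply/measurable_EFinP; exact: cont_measurable.
    - by move=> x _; rewrite lee_fin ge_min lexx.
  by rewrite integral_cst// EFinM -fouterT.
have [N gE] : exists N, forall x, g x = (\sum_(k < N.+1) h k x)%R.
  exists (Num.bound (M / e)) => x.
  rewrite hE; apply/esym/min_idPl; apply: (le_trans (ler_norm _)).
  apply: (le_trans (gM x)); rewrite -ler_pdivrMr//.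
  apply: (@le_trans _ _ (Num.bound (M / e))%:R); last by rewrite ler_nat.
  by rewrite ltW// archi_boundP// divr_ge0// ltW.
have -> : \int[riesz_measure]_x (g x)%:E =
    \sum_(k < N.+1) \int[riesz_measure]_x (h k x)%:E.
  rewrite -ge0_integral_sum//.
  - by apply: eq_integral => x _; rewrite gE sumEFin.
  - by move=> k; apply/measurable_EFinP; exact: cont_measurable.
  - by move=> k x _; rewrite lee_fin.
rewrite big_ord_recl/= addeC EFinD leeD//.
have -> : I g = I (fun x => \sum_(k < N.+1) h k x)%R by congr I; apply/funext.
rewrite pfun_sum// -sumEFin big_ord_recr/=.
apply: (@le_trans _ _ (\sum_(k < N) (I (h k))%:E)).
  by apply: lee_sum => k _; exact: hI1.
by rewrite leeDl// lee_fin I_ge0.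
Qed.

(** The upper bound holds for [g] and for [M - g], and the two sides agree on their sum because the
    total mass is [I 1]; hence neither bound is strict. *)
Let riesz_eq g : continuous g -> (forall x, 0 <= g x)%R ->
  \int[riesz_measure]_x (g x)%:E = (I g)%:E.
Proof.
move=> gc g0; apply/eqP; rewrite eq_le riesz_le//=.
have [M M0 gM] := cont_bounded compactX gc.
have gM0 x : (0 <= M - g x)%R by rewrite subr_ge0 (le_trans (ler_norm _)).
have gMc : continuous (fun x => M - g x)%R by apply: contB => //; exact: cont_cst.
have E : \int[riesz_measure]_x (M - g x)%:E + \int[riesz_measure]_x (g x)%:E =
    (M * I (fun=> 1))%:E.
  rewrite -ge0_integralD//.
  - rewrite EFinM -fouterT -[fouter _]/(riesz_measure setT) -integral_cst//.
    by apply: eq_integral => x _; rewrite -EFinD subrK.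
  - by move=> x _; rewrite lee_fin.
  - by apply/measurable_EFinP; exact: cont_measurable.
  - by move=> x _; rewrite lee_fin.
  - by apply/measurable_EFinP; exact: cont_measurable.
have := riesz_le gMc gM0; rewrite pfunB//; last exact: cont_cst.
rewrite pfun_cst; move: E (riesz_le gc g0).
have : 0 <= \int[riesz_measure]_x (g x)%:E.
  by apply: integral_ge0 => x _; rewrite lee_fin.
have : 0 <= \int[riesz_measure]_x (M - g x)%:E.
  by apply: integral_ge0 => x _; rewrite lee_fin.
case: (\int[riesz_measure]_x (g x)%:E) => [r| |] //.
case: (\int[riesz_measure]_x (M - g x)%:E) => [r'| |] //.
by move=> _ _ [<-] _; rewrite !lee_fin; lra.
Qed.

Theorem riesz_markov :
  exists mu : {finite_measure set (g_sigma_algebraType (@open X)) -> \bar R},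
  forall g, continuous g -> (forall x, 0 <= g x)%R -> \int[mu]_x (g x)%:E = (I g)%:E.
Proof. by exists riesz_measure; exact: riesz_eq. Qed.

End PositiveFunctional.

Lemma lipschitz_continuous_normed (R : realType) (V : normedModType R) (g : V -> R) :
  (forall x y, g x <= g y + `|x - y|) -> continuous g.
Proof.
move=> glip x; apply/(@cvgrPdist_lt _ _ _ (nbhs x) (nbhs_filter x)) => e e0.
apply: (@filterS _ (nbhs x) (nbhs_filter x) (ball x e)); last exact: nbhsx_ballx.
move=> y; rewrite -ball_normE /ball_/= => xy.
have h1 := glip x y; have h2 := glip y x; rewrite distrC in h2.
by rewrite ltr_norml; apply/andP; split; lra.
Qed.

(** The function is the distance to the complement, written as a supremum of radii of balls inside
    [O]. The cap at 1 keeps it finite when [O] is the whole space; the triangle inequality makes it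
    1-Lipschitz. *)
Lemma open_pos_normed (R : realType) (V : normedModType R) (O : set V) : open O ->
  exists2 g : V -> R, continuous g /\ (forall x, 0 <= g x) & O = [set x | 0 < g x].
Proof.
move=> oO; pose S x := [set r : R | 0 <= r <= 1 /\ ball x r `<=` O].
have S0 x : S x 0 by split; rewrite ?lexx ?ler01// => y; rewrite -ball_normE /ball_/= normr_lt0.
have Sub x : has_ubound (S x) by exists 1 => r [/andP[]].
have Sle x r : S x r -> r <= sup (S x) by move=> Sr; exact: ub_le_sup.
exists (fun x => sup (S x)); last first.
  apply/seteqP; split => x /=.
    move=> Ox; have /nbhs_ballP[e /= e0 eO] := open_nbhs_nbhs (conj oO Ox).
    apply: (@lt_le_trans _ _ (Num.min e 1)); first by rewrite lt_min e0 ltr01.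
    apply: Sle; split; first by rewrite le_min (ltW e0) ler01 ge_min lexx orbT.
    by move=> y /(@le_ball _ _ _ _ e) xy; apply/eO/xy; rewrite ge_min lexx.
  apply: contraPP => nOx; apply/negP; rewrite -leNgt.
  apply: ge_sup; first by exists 0.
  move=> r [_ rO]; rewrite leNgt; apply/negP => r0.
  exact/nOx/rO/ballxx.
split; last by move=> x; exact: Sle.
apply: lipschitz_continuous_normed => x y.
apply: ge_sup; first by exists 0.
move=> r [/andP[r0 r1] rO]; have [h|h] := leP r `|x - y|.
  by rewrite (le_trans h)// lerDr; exact: Sle.
rewrite -lerBlDr; apply: Sle; split.
  by rewrite subr_ge0 (ltW h) (le_trans _ r1)// gerBl.
move=> z; rewrite -ball_normE /ball_/= ltrBrDr => yz; apply: rO.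
rewrite -ball_normE /ball_/=; apply: le_lt_trans yz.
by rewrite -(subrKA y x) addrC ler_normD.
Qed.

(** * Regularity of finite Borel measures *)

Section Regularity.
Variables (R : realType) (X : ptopologicalType).
Hypothesis open_pos : forall U : set X, open U ->
  exists2 g : X -> R, continuous g /\ (forall x, 0 <= g x) & U = [set x | 0 < g x].
Local Notation B := (g_sigma_algebraType (@open X)).
Variable nu : {finite_measure set B -> \bar R}.
Local Open Scope ereal_scope.

Lemma decreasing_small_measure (F : nat -> set B) (e : R) : (0 < e)%R ->
  (forall n, measurable (F n)) -> (forall n, F n.+1 `<=` F n) ->
  (forall x, exists n, ~ F n x) -> exists n, nu (F n) < e%:E.
Proof.
move=> e0 mF Finc F0.
have capF : \bigcap_n F n = set0.
  by apply/seteqP; split => // x Fx; have [n] := F0 x; apply; exact: Fx.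
have : nu \o F @ \oo --> nu (\bigcap_n F n).
  apply: nonincreasing_cvg_mu => //.
  - by rewrite ltey_eq fin_num_measure.
  - by rewrite capF.
  - by apply/nonincreasing_seqP => n; apply/subsetPset.
rewrite capF measure0 => /fine_cvgP[_] /cvgrPdist_lt/(_ e e0)[N _ /(_ N (leqnn N))].
rewrite /= sub0r normrN ger0_norm ?fine_ge0// => h; exists N.
by rewrite -(@fineK _ (nu (F N))) ?fin_num_measure// lte_fin.
Qed.

Definition regular_set (A : set B) := measurable A /\ forall e : R, (0 < e)%R ->
  exists K U : set X, [/\ closed K, open U, K `<=` A, A `<=` U & nu (U `\` K) < e%:E].

Lemma borel_open (U : set X) : open U -> measurable (U : set B).
Proof. exact: sub_sigma_algebra. Qed.

Lemma borel_closed (K : set X) : closed K -> measurable (K : set B).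
Proof. by move=> cK; rewrite -[K]setCK; apply: measurableC; apply: borel_open; exact: closed_openC. Qed.

(** The closed sets where [g] is at least [1 / (n + 1)] increase to the set [U] where [g] is
    positive. *)
Lemma regular_open (U : set X) : open U -> regular_set U.
Proof.
move=> oU; split=> [|e e0]; first exact: borel_open.
have [g [gc g0] UE] := open_pos oU.
pose K n := [set x | (n.+1%:R^-1 <= g x)%R].
have cK n : closed (K n).
  rewrite -openC (_ : ~` K n = [set x | (g x < n.+1%:R^-1)%R]).
    by apply: cont_open_lt => //; exact: cont_cst.
  by apply/seteqP; split => x /=; rewrite /K/= ltNge => /negP.
have [|||n hn] := @decreasing_small_measure (fun n => U `\` K n) e e0.
- by move=> n; apply: measurableD; [exact: borel_open|exact: borel_closed].
- move=> n x [Ux nK]; split => // Kx; apply: nK.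
  by apply: le_trans Kx; rewrite lef_pV2 ?posrE// ler_nat.
- move=> x; have [Ux|nUx] := pselect (U x); last by exists 0%N => -[].
  exists (Num.bound (g x)^-1) => -[_]; apply; rewrite /K/=.
  move: Ux; rewrite UE/= => gx; rewrite -[leRHS]invrK lef_pV2 ?posrE ?invr_gt0//.
  by rewrite ltW// (lt_trans (archi_boundP _)) ?invr_ge0// ltr_nat.
exists (K n), U; split => // x; rewrite UE/=; apply: lt_le_trans.
by rewrite invr_gt0.
Qed.

Lemma regular_setC (A : set B) : regular_set A -> regular_set (~` A).
Proof.
move=> [mA rA]; split=> [|e /rA[K [U [cK oU KA AU KU]]]]; first exact: measurableC.
exists (~` U), (~` K); split; [exact: open_closedC|exact: closed_openC|exact: subsetC|exact: subsetC|].
by rewrite setDE setCK setIC -setDE.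
Qed.

(** Half of [e] is spread geometrically over the approximations of the [A n]. A countable union of
    closed sets need not be closed, so only finitely many are kept; the other half of [e] pays for
    the discarded tail. *)
Lemma regular_bigcup (A : nat -> set B) : (forall n, regular_set (A n)) ->
  regular_set (\bigcup_n A n).
Proof.
move=> rA; split=> [|e e0]; first by apply: bigcupT_measurable => n; have [] := rA n.
have e2 : (0 < e / 2)%R by rewrite divr_gt0.
have en n : (0 < e / 2 / (2 ^ n.+1)%:R)%R by rewrite divr_gt0// ltr0n expn_gt0.
pose P n (KU : set X * set X) := [/\ closed KU.1, open KU.2, KU.1 `<=` A n, A n `<=` KU.2
  & nu (KU.2 `\` KU.1) < (e / 2 / (2 ^ n.+1)%:R)%:E].
have [KU PKU] : {KU : nat -> set X * set X & forall n, P n (KU n)}.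
  apply: (@choice _ _ P) => n.
  by have [_ /(_ _ (en n))[K [U h]]] := rA n; exists (K, U).
pose U := \bigcup_n (KU n).2; pose K n := \bigcup_(k in `I_n) (KU k).1.
have mK n : measurable ((KU n).1 : set B) by have [cK] := PKU n => *; exact: borel_closed.
have mU n : measurable ((KU n).2 : set B) by have [_ oU] := PKU n => *; exact: borel_open.
have oU : open U by apply: bigcup_open => n _; have [] := PKU n.
have cK n : closed (K n).
  by apply: closed_bigcup; [exact: finite_II|move=> k _; have [] := PKU k].
have mKoo : measurable (\bigcup_n (KU n).1 : set B) by exact: bigcupT_measurable.
have [|||n hn] := @decreasing_small_measure (fun n => \bigcup_n (KU n).1 `\` K n) _ e2.
- by move=> n; apply: measurableD => //; exact: borel_closed.
- move=> n x [Kx nK]; split => // -[k /= kn Kk]; apply: nK; exists k => //=.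
  exact: ltn_trans kn _.
- move=> x; have [[k _ Kx]|nUx] := pselect ((\bigcup_n (KU n).1) x); last by exists 0%N => -[].
  by exists k.+1 => -[_]; apply; exists k => /=.
exists (K n), U; split => //.
- by move=> x [k _ Kx]; exists k => //; have [_ _ + _ _] := PKU k; apply.
- by move=> x [k _ Ax]; exists k => //; have [_ _ _ + _] := PKU k; apply.
have sub : U `\` K n `<=` (\bigcup_n ((KU n).2 `\` (KU n).1)) `|` (\bigcup_n (KU n).1 `\` K n).
  move=> x [[k _ Ux] nK]; have [Kx|nKx] := pselect ((\bigcup_n (KU n).1) x); first by right.
  by left; exists k => //; split => // Kx; apply: nKx; exists k.
have mD : measurable (\bigcup_n ((KU n).2 `\` (KU n).1) : set B).
  by apply: bigcupT_measurable => k; exact: measurableD.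
have mD' : measurable (\bigcup_n (KU n).1 `\` K n : set B).
  by apply: measurableD => //; exact: borel_closed.
have mUK : measurable (U `\` K n : set B).
  by apply: measurableD; [exact: borel_open|exact: borel_closed].
apply: (le_lt_trans (le_measure nu _ _ sub)); rewrite ?inE//; first exact: measurableU.
apply: (le_lt_trans (measureU2 _ _ _)) => //.
rewrite [e]splitr EFinD lee_ltD// ?fin_num_measure//.
have mUKk k : measurable ((KU k).2 `\` (KU k).1 : set B) by exact: measurableD.
apply: le_trans (measure_sigma_subadditive nu mUKk mD (@subset_refl _ _)) _.
apply: le_trans (epsilon_trick0 xpredT (ltW e2)).
apply: lee_nneseries => // k _; apply: ltW.
by have [] := PKU k.
Qed.

Theorem borel_regular (A : set B) (e : R) : measurable A -> (0 < e)%R ->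
  exists K U : set X, [/\ closed K, open U, K `<=` A, A `<=` U & nu (U `\` K) < e%:E].
Proof.
move=> mA e0; suff [_] : regular_set A by exact.
apply: (smallest_sub _ _ mA) => [|U oU]; last exact: regular_open.
split=> [|C|C].
- by apply: regular_open; exact: open0.
- by rewrite setTD; exact: regular_setC.
- exact: regular_bigcup.
Qed.

End Regularity.

(** * Star bodies as nonnegative continuous functions *)

Section SphereTopology.
Variables (R : realType) (n : nat).
Local Notation V := 'rV[R]_n.+1.
Local Notation S := (sphere R n).

Lemma sphere_val_continuous : continuous (fun u : S => \val u : V).
Proof. exact: initial_continuous. Qed.

Lemma enorm_continuous : continuous (@enorm R n.+1).
Proof.
have h : continuous (fun x : V => \sum_(i < n.+1) x 0 i ^+ 2).
  apply: cont_sum => i _.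
  have -> : (fun x : V => x 0 i ^+ 2) = (fun x : V => x 0 i * x 0 i).
    by apply/funext => x; rewrite expr2.
  by apply: contM; exact: coord_continuous.
by move=> x; apply: continuous_comp; [exact: h|exact: sqrt_continuous].
Qed.

Lemma coord_le_enorm m (x : 'rV[R]_m) i : `|x 0 i| <= enorm x.
Proof.
rewrite -sqrtr_sqr ler_wsqrtr// (bigD1 i)//= lerDl sumr_ge0// => j _.
exact: sqr_ge0.
Qed.

Lemma mx_norm_le_enorm m (x : 'rV[R]_m.+1) : `|x| <= enorm x.
Proof.
rewrite [leLHS]mx_normrE; apply: bigmax_le; first exact: enorm_ge0.
by move=> [i j] _ /=; rewrite ord1 coord_le_enorm.
Qed.

Lemma unit_sphere_compact : compact (unit_sphere R n.+1).
Proof.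
apply: bounded_closed_compact.
  exists 1; split; first exact: num_real.
  move=> M M1 x /= x1; rewrite (le_trans (mx_norm_le_enorm x))//.
  by rewrite [enorm x]x1 ltW.
rewrite (_ : unit_sphere R n.+1 = @enorm R n.+1 @^-1` [set 1])//.
by apply: closed_comp => [x _|]; [exact: enorm_continuous|exact: closed_eq].
Qed.

(** The filter is pushed to the ambient space, where it clusters on the compact unit sphere;
    neighbourhoods in the subtype are traces of ambient ones. *)
Lemma sphere_compact : compact [set: S].
Proof.
move=> F FF _.
pose F' := (fun u : S => \val u : V) @ F.
have F'S : F' (unit_sphere R n.+1).
  suff : F [set u : S | unit_sphere R n.+1 (\val u)] by [].
  by apply: (@filterS _ F _ setT) => [u _|]; [exact: (sphere1 u)|exact: filterT].
have F'P : ProperFilter F' by exact: fmap_proper_filter.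
have [x [xS xF]] := unit_sphere_compact F'P F'S.
exists (mk_sphere xS); split => // A B FA /=.
rewrite nbhsE => -[_ [[W oW <-] Wx] sB].
have F'A : F' [set \val u | u in A].
  suff : F [set u : S | exists2 v, A v & \val v = \val u] by [].
  by apply: (@filterS _ F _ A) => // u Au; exists u.
have [_ [[u Au <-] Wu]] := xF _ _ F'A (open_nbhs_nbhs (conj oW Wx)).
by exists u; split => //; exact: sB.
Qed.

Lemma sphere_open_pos (U : set S) : open U ->
  exists2 g : S -> R, continuous g /\ (forall x, 0 <= g x) & U = [set x | 0 < g x].
Proof.
move=> [W oW <-]; have [g [gc g0] WE] := open_pos_normed oW.
exists (fun u => g (\val u)); last by rewrite WE.
split=> // u; apply: continuous_comp; last exact: gc.
exact: sphere_val_continuous.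
Qed.

End SphereTopology.

Section StarBodyFunctions.
Variables (R : realType) (n : nat).
Local Notation S := (sphere R n).
Local Notation SB := (star_body R n).
Implicit Types (L M : SB) (f g : S -> R).

Lemma radial_inj L M : (forall u, radial L u = radial M u) -> L = M.
Proof.
move=> LM; apply: star_body_eq; rewrite -radialK -[RHS]radialK.
by congr radial_set; apply/funext.
Qed.

Lemma body_of_spec f : exists L : SB,
  continuous f -> forall u, radial L u = Num.max 0 (f u).
Proof.
have [fc|nfc] := pselect (continuous f); last first.
  by exists (star_of (fun _ : S => lexx 0) (@cont_cst R S 0)) => /nfc.
have f0 u : 0 <= Num.max 0 (f u) by rewrite le_max lexx.
have fc0 : continuous (fun u => Num.max 0 (f u)) by apply: cont_max => //; exact: cont_cst.
by exists (star_of f0 fc0) => _ u; rewrite /star_of/= radial_setK.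
Qed.

(* The star body with radial function max(f, 0); junk when [f] is not continuous. *)
Definition body_of f : SB := projT1 (cid (body_of_spec f)).

Lemma radial_body_of f u : continuous f -> radial (body_of f) u = Num.max 0 (f u).
Proof. by move=> fc; rewrite /body_of; case: cid => L /= ->. Qed.

Lemma radial_body_of_ge0 f u : continuous f -> (forall u, 0 <= f u) -> radial (body_of f) u = f u.
Proof. by move=> fc f0; rewrite radial_body_of// max_r. Qed.

Lemma body_ofK L : body_of (radial L) = L.
Proof.
by apply: radial_inj => u; rewrite radial_body_of_ge0//;
  [exact: radial_continuous|exact: radial_ge0].
Qed.

Lemma radial_sumE L M u : radial (radial_sum L M) u = radial L u + radial M u.
Proof. by rewrite /radial_sum radial_setK//; exact: radial_add_ge0. Qed.

Lemma radial_dilate (a : R) (a0 : 0 <= a) L u : radial (dilate a0 L) u = a * radial L u.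
Proof.
have f0 v : 0 <= a * radial L v by rewrite mulr_ge0 ?radial_ge0.
have -> : radial (dilate a0 L) u = radial (radial_set (fun v => a * radial L v)) u.
  congr (radial _ u); apply/seteqP; split=> [_ [x Lx <-]|_ [v [c [/andP[c0 ca] ->]]]].
    move: Lx; rewrite -{1}radialK => -[v [c [/andP[c0 cL] ->]]].
    by exists v, (a * c); rewrite scalerA mulr_ge0//= ler_wpM2l.
  have [aE|aN0] := eqVneq a 0.
    exists 0; first by case: L {f0 ca} => L [].
    by rewrite scaler0 (_ : c = 0) ?scale0r//; move: ca; rewrite aE mul0r; lra.
  have a1 : 0 < a by rewrite lt_neqAle eq_sym aN0 a0.
  exists ((c / a) *: \val v); last by rewrite scalerA mulrC divfK.
  by apply/radial_ray; rewrite ?divr_ge0// ler_pdivrMr// mulrC.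
by rewrite radial_setK.
Qed.

(** Turns the geometric hypothesis into the pointwise one used by all later arguments: on each ray,
    the point at the smaller of the two radii lies in both bodies. *)
Lemma disjoint_radial L M :
  (L : set _) `&` M = [set 0] <-> forall u, radial L u * radial M u = 0.
Proof.
split=> [LM u|LM].
  pose c := Num.min (radial L u) (radial M u).
  have c0 : 0 <= c by rewrite le_min !radial_ge0.
  have : ((L : set _) `&` M) (c *: \val u).
    by split; apply/radial_ray => //; rewrite ge_min lexx ?orbT.
  rewrite LM => /= /eqP; rewrite scaler_eq0 (negPf (sphere_neq0 u)) orbF.
  rewrite /c minElt; case: ifP => _ /eqP ->; first by rewrite mul0r.
  by rewrite mulr0.
apply/seteqP; split=> [x [Lx Mx]|x ->]; last by split; [case: L {LM} => L []|case: M {LM} => M []].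
have [u xE] := polar x; have x0 := enorm_ge0 x.
have : enorm x <= radial L u by apply/radial_ray => //; rewrite -xE.
have : enorm x <= radial M u by apply/radial_ray => //; rewrite -xE.
have /eqP := LM u; rewrite mulf_eq0 => /orP[] /eqP -> h1 h2; apply: enorm_eq0; lra.
Qed.

Lemma sub_unit_ballP L : (L : set _) `<=` unit_ball R n.+1 <-> forall u, radial L u <= 1.
Proof.
split=> [LB u|L1 x Lx].
  have : unit_ball R n.+1 (radial L u *: \val u).
    by apply: LB; apply/radial_ray => //; exact: radial_ge0.
  by rewrite /unit_ball/= enormZ sphere1 mulr1; apply: le_trans; exact: ler_norm.
have [u xE] := polar x; rewrite /unit_ball/= (le_trans _ (L1 u))//.
by apply/radial_ray; rewrite ?enorm_ge0// -xE.
Qed.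

Lemma radial_rotate (A : 'M[R]_n.+1) (hA : is_rotation A) L u :
  radial (rotate hA L) u = radial L (rotate_sphere (rotation_tr hA) u).
Proof.
have key c : 0 <= c -> (rotate hA L : set _) (c *: \val u) <->
    (L : set _) (c *: \val (rotate_sphere (rotation_tr hA) u)).
  have hA' : A *m A^T = 1%:M by exact: (proj1 hA).
  have hA'' : A^T *m A = 1%:M by apply: mulmx1C.
  move=> c0; rewrite /= scalemxAl; split.
    by move=> [x Lx xE]; rewrite -xE -mulmxA hA' mulmx1.
  by move=> Lx; exists (c *: \val u *m A^T) => //; rewrite -mulmxA hA'' mulmx1.
have h1 := radial_ge0 (rotate hA L) u.
have h2 := radial_ge0 L (rotate_sphere (rotation_tr hA) u).
apply/eqP; rewrite eq_le; apply/andP; split.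
  by apply/radial_ray => //; apply/key => //; exact/radial_ray.
by apply/radial_ray => //; apply/key => //; exact/radial_ray.
Qed.

End StarBodyFunctions.

Lemma uniform_approx_continuous (R : realType) (X : topologicalType) (f : X -> R) :
  (forall e, 0 < e -> exists2 g : X -> R, continuous g & forall x, `|f x - g x| <= e) ->
  continuous f.
Proof.
move=> H x; apply/(@cvgrPdist_lt _ _ _ (nbhs x) (nbhs_filter x)) => e e0.
have [g gc fg] := H (e / 4) ltac:(lra).
have /(@cvgrPdist_lt _ _ _ (nbhs x) (nbhs_filter x))/(_ (e / 4) ltac:(lra)) := gc x.
apply: (@filterS _ (nbhs x) (nbhs_filter x)) => y /=.
have h1 := fg x; have h2 := fg y.
move: h1 h2; rewrite !ler_norml !ltr_norml => /andP[? ?] /andP[? ?] /andP[? ?].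
apply/andP; split; lra.
Qed.

(** * Additive functionals on the cone of star bodies *)

Section Functionals.
Variables (R : realType) (n : nat).
Local Notation S := (sphere R n).
Local Notation SB := (star_body R n).
Implicit Types (T : SB -> R) (L M : SB) (f g : S -> R).

Definition additive_homogeneous T :=
  (forall L M, T (radial_sum L M) = T L + T M) /\
  (forall (a : R) (a0 : 0 <= a) L, T (dilate a0 L) = a * T L).

Definition ball_bounded T (C : R) := forall L, (forall u, radial L u <= 1) -> `|T L| <= C.

(** Since [body_of] truncates at 0, the two bodies carry the positive and negative parts of [f]:
    this is the linear extension of [T] from the cone to all continuous functions. *)
Definition lin T f := T (body_of f) - T (body_of (fun u => - f u)).

Section Linear.
Variable T : SB -> R.
Hypothesis Tah : additive_homogeneous T.

(** Independence of the way [f] is written as a difference: the positive part plus [M] equals the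
    negative part plus [L]. Linearity of [lin] follows by choosing convenient [L] and [M]. *)
Lemma lin_sub f L M : continuous f ->
  (forall u, f u = radial L u - radial M u) -> lin T f = T L - T M.
Proof.
move=> fc fE; have [Ta Th] := Tah.
have E : radial_sum (body_of f) M = radial_sum (body_of (fun u => - f u)) L.
  apply: radial_inj => u; rewrite !radial_sumE !radial_body_of//; last exact: contN.
  rewrite fE opprB; have [h|h] := leP (radial L u) (radial M u).
    by rewrite max_l ?max_r; lra.
  by rewrite max_r ?max_l; lra.
by have := congr1 T E; rewrite !Ta /lin; lra.
Qed.

Lemma lin_radial L : lin T (radial L) = T L.
Proof.
have c0 : continuous (fun _ : S => 0 : R) by exact: cont_cst.
have T0 : T (body_of (fun=> 0)) = 0.
  have : T (radial_sum (body_of (fun=> 0)) (body_of (fun=> 0))) = T (body_of (fun=> 0)).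
    by congr T; apply: radial_inj => u; rewrite radial_sumE radial_body_of_ge0// addr0.
  by rewrite (proj1 Tah); lra.
rewrite (@lin_sub _ L (body_of (fun=> 0))) ?T0 ?subr0//; first exact: radial_continuous.
by move=> u; rewrite radial_body_of_ge0// subr0.
Qed.

Lemma lin_body f : continuous f -> (forall u, 0 <= f u) -> T (body_of f) = lin T f.
Proof.
move=> fc f0; rewrite -lin_radial; congr lin; apply/funext => u.
by rewrite radial_body_of_ge0.
Qed.

Lemma fun_pos_neg f : continuous f ->
  forall u, f u = radial (body_of f) u - radial (body_of (fun u => - f u)) u.
Proof.
move=> fc u; rewrite !radial_body_of//; last exact: contN.
by have [h|h] := leP 0 (f u); [rewrite max_l|rewrite max_r]; lra.
Qed.

Lemma linD f g : continuous f -> continuous g ->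
  lin T (fun u => f u + g u) = lin T f + lin T g.
Proof.
move=> fc gc; have [Ta _] := Tah.
rewrite (@lin_sub _ (radial_sum (body_of f) (body_of g))
  (radial_sum (body_of (fun u => - f u)) (body_of (fun u => - g u)))).
- by rewrite !Ta /lin; lra.
- exact: contD.
- by move=> u; rewrite !radial_sumE {1}(fun_pos_neg fc u) {1}(fun_pos_neg gc u); lra.
Qed.

Lemma linN f : continuous f -> lin T (fun u => - f u) = - lin T f.
Proof.
move=> fc; rewrite /lin opprB; congr (_ - T (body_of _)).
by apply/funext => u; rewrite opprK.
Qed.

Lemma linB f g : continuous f -> continuous g ->
  lin T (fun u => f u - g u) = lin T f - lin T g.
Proof. by move=> fc gc; rewrite linD ?linN//; exact: contN. Qed.

Lemma linZ (a : R) f : continuous f -> lin T (fun u => a * f u) = a * lin T f.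
Proof.
move=> fc; have [_ Th] := Tah.
wlog a0 : a / 0 <= a.
  move=> H; have [/H//|a0] := leP 0 a.
  have -> : (fun u => a * f u) = (fun u => - (- a * f u)).
    by apply/funext => u; rewrite mulNr opprK.
  rewrite linN; last exact: contZ.
  by rewrite H ?mulNr ?opprK// oppr_ge0 ltW.
rewrite (@lin_sub _ (dilate a0 (body_of f)) (dilate a0 (body_of (fun u => - f u)))).
- by rewrite !Th /lin mulrBr.
- exact: contZ.
- by move=> u; rewrite !radial_dilate {1}(fun_pos_neg fc u) mulrBr.
Qed.

Lemma lin_sum (I : Type) (r : seq I) (P : pred I) (h : I -> S -> R) :
  (forall i, continuous (h i)) ->
  lin T (fun u => \sum_(i <- r | P i) h i u) = \sum_(i <- r | P i) lin T (h i).
Proof.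
move=> hc; elim: r => [|i r ih].
  rewrite big_nil -[RHS](mul0r (lin T (fun=> 0))) -linZ; last exact: cont_cst.
  by congr lin; apply/funext => u; rewrite big_nil mulr0.
rewrite big_cons -ih; case: (boolP (P i)) => Pi.
  rewrite -linD//; last exact: cont_sum.
  by congr lin; apply/funext => u; rewrite big_cons Pi.
by congr lin; apply/funext => u; rewrite big_cons (negPf Pi).
Qed.

Lemma bounded_scale (C c : R) L : ball_bounded T C -> 0 < c ->
  (forall u, radial L u <= c) -> `|T L| <= C * c.
Proof.
move=> TC c0 Lc; have ci : 0 <= c^-1 by rewrite invr_ge0 ltW.
have := TC (dilate ci L); rewrite (proj2 Tah) normrM ger0_norm// => h.
rewrite -ler_pdivrMr// mulrC; apply: h => u.
by rewrite radial_dilate mulrC ler_pdivrMr// mul1r.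
Qed.

Lemma bounded_ge0 C : ball_bounded T C -> 0 <= C.
Proof.
move=> TC; apply: le_trans (TC (body_of (fun=> 0)) _) => // u.
by rewrite radial_body_of_ge0//; exact: cont_cst.
Qed.

(** The factor 2 accounts for the positive and negative parts. The slack [d] covers [c = 0], since
    [bounded_scale] asks for a positive radius. *)
Lemma lin_bounded (C c : R) f : ball_bounded T C -> continuous f ->
  (forall u, `|f u| <= c) -> `|lin T f| <= 2 * C * c.
Proof.
move=> TC fc fle; have C0 := bounded_ge0 TC.
have c0 : 0 <= c by apply: le_trans (fle point).
apply/ler_addgt0Pr => e e0.
have d0 : 0 < e / (2 * C + 1) by rewrite divr_gt0//; lra.
have dE : 2 * C * (e / (2 * C + 1)) <= e.
  by rewrite mulrCA -{2}[e]mulr1 ler_pM2l// ler_pdivrMr; lra.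
set d := e / _ in d0 dE; apply: (@le_trans _ _ (2 * C * (c + d))); last by rewrite mulrDr; lra.
have cd : 0 < c + d by lra.
have h1 : `|T (body_of f)| <= C * (c + d).
  apply: bounded_scale => // u; rewrite radial_body_of// ge_max (ltW cd)/=.
  by move: (fle u); rewrite ler_norml => /andP[]; lra.
have h2 : `|T (body_of (fun u => - f u))| <= C * (c + d).
  apply: bounded_scale => // u; rewrite radial_body_of ?ge_max ?(ltW cd)/=; last exact: contN.
  by move: (fle u); rewrite ler_norml => /andP[]; lra.
by apply: (le_trans (ler_normB _ _)); lra.
Qed.

(** Monotonicity: the unit ball is the radial sum of [L] and the body with radial function
    [1 - radial L], so its value bounds [T L]. *)
Lemma positive_bounded : (forall L, 0 <= T L) -> exists C : R, ball_bounded T C.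
Proof.
move=> T0; exists (T (body_of (fun=> 1))) => L L1; rewrite ger0_norm//.
have c1 : continuous (fun _ : S => 1 : R) by exact: cont_cst.
have E : radial_sum L (body_of (fun u => 1 - radial L u)) = body_of (fun=> 1).
  apply: radial_inj => u; rewrite radial_sumE !radial_body_of_ge0//.
  - by rewrite addrC subrK.
  - by apply: contB => //; exact: radial_continuous.
  - by move=> v; rewrite subr_ge0.
by rewrite -E (proj1 Tah) lerDl.
Qed.

End Linear.

Section JordanDecomposition.
Variables (T : SB -> R) (C : R).
Hypothesis Tah : additive_homogeneous T.
Hypothesis TC : ball_bounded T C.

Definition order_below L : set SB := [set M : SB | forall u, radial M u <= radial L u].

(** The Riesz-Kantorovich formula for the positive part of a bounded functional. *)
Definition pos_part L := sup (T @` order_below L).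

Lemma radial_bounded L : exists2 c : R, 0 < c & forall u, radial L u <= c.
Proof.
have [c c0 Lc] := cont_bounded (@sphere_compact R n) (radial_continuous (L := L)).
by exists c => // u; apply: le_trans (Lc u); exact: ler_norm.
Qed.

Lemma pos_part_ub L : has_ubound (T @` order_below L).
Proof.
have [c c0 Lc] := radial_bounded L.
exists (C * c) => _ [M ML <-]; apply: (le_trans (ler_norm _)).
by apply: (bounded_scale Tah TC) => // u; exact: le_trans (ML u) (Lc u).
Qed.

Lemma pos_part_ge L M : (forall u, radial M u <= radial L u) -> T M <= pos_part L.
Proof. by move=> ML; apply: ub_le_sup; [exact: pos_part_ub|exists M]. Qed.

Lemma pos_part_le L c : (forall M, (forall u, radial M u <= radial L u) -> T M <= c) ->
  pos_part L <= c.
Proof.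
move=> H; apply: ge_sup; first by exists (T L), L => // u.
by move=> _ [M ML <-]; exact: H.
Qed.

(** Subadditivity is the Riesz decomposition property: a body [K] below the sum of [L] and [M]
    splits into [min(K, L)], below [L], and a remainder, below [M]. *)
Lemma pos_part_additive_homogeneous : additive_homogeneous pos_part.
Proof.
have [Ta Th] := Tah; split=> [L M|].
  apply/eqP; rewrite eq_le; apply/andP; split.
    apply: pos_part_le => K KLM.
    pose f1 u := Num.min (radial K u) (radial L u).
    pose f2 u := radial K u - f1 u.
    have Kc := radial_continuous (L := K); have Lc := radial_continuous (L := L).
    have f1c : continuous f1 by exact: cont_min.
    have f2c : continuous f2 by exact: contB.
    have f10 u : 0 <= f1 u by rewrite le_min !radial_ge0.
    have f20 u : 0 <= f2 u by rewrite subr_ge0 ge_min lexx.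
    have -> : K = radial_sum (body_of f1) (body_of f2).
      by apply: radial_inj => u; rewrite radial_sumE !radial_body_of_ge0// addrC subrK.
    rewrite Ta lerD// pos_part_ge// => u; rewrite radial_body_of_ge0//.
      by rewrite ge_min lexx orbT.
    rewrite /f2 /f1 lerBlDr; have := KLM u; rewrite radial_sumE.
    have := radial_ge0 M u; case: (leP (radial K u) (radial L u)); lra.
  rewrite -lerBrDr; apply: pos_part_le => L' L'L; rewrite lerBrDr addrC -lerBrDr.
  apply: pos_part_le => M' M'M; rewrite lerBrDr -Ta pos_part_ge// => u.
  by rewrite !radial_sumE addrC lerD.
(* One inequality for every positive factor suffices: the converse is the same inequality for the
   inverse factor. *)
have le a (a0 : 0 < a) L : pos_part (dilate (ltW a0) L) <= a * pos_part L.
  apply: pos_part_le => M ML; have ai : 0 <= a^-1 by rewrite invr_ge0 ltW.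
  rewrite mulrC -ler_pdivrMr// mulrC -(Th _ ai) pos_part_ge// => u.
  by rewrite radial_dilate mulrC ler_pdivrMr// mulrC -(radial_dilate (ltW a0)).
move=> a a0 L; have [aE|aN0] := eqVneq a 0.
  rewrite [in RHS]aE mul0r; apply/eqP; rewrite eq_le; apply/andP; split.
    apply: pos_part_le => M ML; suff -> : M = dilate a0 M by rewrite Th aE mul0r.
    apply: radial_inj => u; rewrite radial_dilate aE mul0r.
    by have := ML u; rewrite radial_dilate aE mul0r; have := radial_ge0 M u; lra.
  have -> : 0 = T (dilate a0 L) by rewrite Th aE mul0r.
  by apply: pos_part_ge.
have a1 : 0 < a by rewrite lt_neqAle eq_sym aN0.
have irr (h : 0 <= a) : dilate h L = dilate (ltW a1) L.
  by congr dilate; exact: bool_irrelevance.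
rewrite (irr a0); apply/eqP; rewrite eq_le le/=.
have ai : 0 < a^-1 by rewrite invr_gt0.
have := le _ ai (dilate (ltW a1) L).
have -> : dilate (ltW ai) (dilate (ltW a1) L) = L.
  by apply: radial_inj => u; rewrite !radial_dilate mulrA mulVf// mul1r.
by rewrite mulrC ler_pdivlMr// mulrC.
Qed.

Lemma functional_jordan : exists Tp Tm : SB -> R,
  [/\ additive_homogeneous Tp, additive_homogeneous Tm,
    forall L, 0 <= Tp L, forall L, 0 <= Tm L & forall L, T L = Tp L - Tm L].
Proof.
have [Ta Th] := Tah; have [pa ph] := pos_part_additive_homogeneous.
have T0 : T (dilate (lexx 0) (body_of (fun=> 0))) = 0 by rewrite Th mul0r.
exists pos_part, (fun L => pos_part L - T L); split.
- exact: pos_part_additive_homogeneous.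
- by split=> [L M|a a0 L]; rewrite ?pa ?ph ?Ta ?Th; lra.
- move=> L; rewrite -{1}T0; apply: pos_part_ge => u.
  by rewrite radial_dilate mul0r radial_ge0.
- by move=> L; rewrite subr_ge0; exact: pos_part_ge.
- by move=> L; lra.
Qed.

End JordanDecomposition.

(* Star bodies form a cone, not a Banach space, so the uniform boundedness
   principle is proved by the gliding hump, inside the cone. *)
Section UniformBoundedness.
Variable T : nat -> SB -> R.
Hypothesis Tah : forall N, additive_homogeneous (T N).
Hypothesis Tbd : forall N, exists C : R, ball_bounded (T N) C.
Hypothesis Tpt : forall L, exists C : R, forall N, `|T N L| <= C.

(** One step of the gliding hump. Growth by at most [r / 2] and a new radius of at most [r / 2] keep
    the limit of all later steps within [r'] of [y], where some [T N] is already large. Radial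
    functions only grow, so the steps never leave the cone. *)
Definition far_step (K : R) (x : SB) (r : R) (y : SB) (r' : R) :=
  [/\ 0 < r' <= r / 2, forall u, radial x u <= radial y u <= radial x u + r / 2
    & exists N, forall z : SB, (forall u, `|radial z u - radial y u| <= r') -> K <= `|T N z|].

Lemma far_step_exists : (forall K : R, exists N (L : SB), (forall u, radial L u <= 1) /\ K < `|T N L|) ->
  forall K x r, 0 < r -> exists y r', far_step K x r y r'.
Proof.
(* Scaling [L] by [r / 2] turns this bound into [2 * (K + 1)]; adding a value [T N x] of size at
   most [K + 1] still leaves more than [K + 1]. *)
move=> H K x r r0; have [N [L [L1 TL]]] := H (4 / r * (K + 1)).
have [Ta Th] := Tah N; have [C TC] := Tbd N; have C0 := bounded_ge0 (TC).
have r2 : 0 <= r / 2 by lra.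
have [y [xy Ty]] : exists y : SB, (forall u, radial x u <= radial y u <= radial x u + r / 2) /\
    K + 1 < `|T N y|.
  have [h|h] := ltP (K + 1) `|T N x|.
    by exists x; split => // u; rewrite lexx/= lerDl.
  exists (radial_sum x (dilate r2 L)); split.
    move=> u; rewrite radial_sumE radial_dilate lerDl mulr_ge0 ?radial_ge0//=.
    by rewrite lerD2l ler_piMr.
  rewrite Ta Th; have h2 : 2 * (K + 1) < `|r / 2 * T N L|.
    rewrite normrM (ger0_norm r2) -ltr_pdivrMl ?divr_gt0//.
    by apply: le_lt_trans TL; rewrite le_eqVlt; apply/orP; left; apply/eqP; field; lra.
  have := ler_normB (T N x + r / 2 * T N L) (T N x).
  by rewrite addrC addKr; lra.
(* Within [1 / (2 * C + 1)] of [y] the functional [T N] changes by at most 1, so it stays above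
   [K]. *)
pose r' := Num.min (r / 2) (2 * C + 1)^-1.
have r'0 : 0 < r' by rewrite lt_min invr_gt0; apply/andP; split; lra.
exists y, r'; split => //; first by rewrite r'0 ge_min lexx.
exists N => z zy.
have := lin_bounded (Tah N) TC (contB (radial_continuous (L := z)) (radial_continuous (L := y))) zy.
rewrite linB//; try exact: radial_continuous.
rewrite !lin_radial// => h.
have h2 : 2 * C * r' <= 1.
  apply: (@le_trans _ _ ((2 * C + 1) * (2 * C + 1)^-1)).
    by apply: ler_pM => //; [lra|exact: ltW|lra|rewrite ge_min lexx orbT].
  by rewrite divff//; lra.
have := ler_normB (T N z) (T N z - T N y); rewrite subKr; lra.
Qed.

Lemma uniform_boundedness : exists C : R, forall N, ball_bounded (T N) C.
Proof.
apply: contrapT => nC.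
have H (K : R) : exists N (L : SB), (forall u, radial L u <= 1) /\ K < `|T N L|.
  apply: contrapT => nK; apply: nC; exists K => N L L1.
  by rewrite leNgt; apply/negP => KL; apply: nK; exists N, L.
pose St := {xr : SB * R | 0 < xr.2}.
pose rel (s t : nat * St) := t.1 = s.1.+1 /\
  far_step s.1%:R (sval s.2).1 (sval s.2).2 (sval t.2).1 (sval t.2).2.
have relP s : {t | rel s t}.
  apply: cid; case: s => k [[x r] r0].
  have [y [r' st]] := far_step_exists H k%:R x r0.
  have r'0 : 0 < (y, r').2 by case: st => /andP[].
  by exists (k.+1, exist _ (y, r') r'0); split.
have [s [s0 srel]] := dependent_choice relP (0%N, exist _ (body_of (fun=> 0), 1) ltr01 : St).
have s1 k : (s k).1 = k by elim: k => [|k ih]; rewrite ?s0//; have [-> _] := srel k; rewrite ih.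
pose x k := (sval (s k).2).1; pose r k := (sval (s k).2).2.
have r0 k : 0 < r k by exact: svalP (s k).2.
have st k : far_step k%:R (x k) (r k) (x k.+1) (r k.+1).
  by have [_] := srel k; rewrite s1.
(* [radial (x k) u] is nondecreasing in [k] while [radial (x k) u + r k] is nonincreasing; the limit
   [f] is squeezed between the two. *)
have near k j u : radial (x k) u <= radial (x (k + j)%N) u <= radial (x k) u + (r k - r (k + j)%N).
  elim: j => [|j /andP[h1 h2]]; first by rewrite addn0; apply/andP; split; lra.
  rewrite addnS; have [/andP[_ h3] h45 _] := st (k + j)%N; have /andP[h4 h5] := h45 u.
  have h6 := r0 (k + j)%N; have h7 := r0 (k + j).+1; apply/andP; split; lra.
pose f u := sup (range (fun k => radial (x k) u)).
have fub u : has_ubound (range (fun k => radial (x k) u)).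
  exists (radial (x 0%N) u + r 0%N) => _ [k _ <-].
  by have := near 0%N k u; rewrite add0n => /andP[_]; have := r0 k; lra.
have fx k u : radial (x k) u <= f u <= radial (x k) u + r k.
  apply/andP; split; first by apply: ub_le_sup => //; exists k.
  apply: ge_sup; first by exists (radial (x 0%N) u), 0%N.
  move=> _ [j _ <-]; have [jk|kj] := leqP j k.
    by have := near j (k - j)%N u; rewrite subnKC// => h1; have := r0 k; have /andP[] := h1; lra.
  by have := near k (j - k)%N u; rewrite (subnKC (ltnW kj)) => h1; have := r0 j; have /andP[] := h1; lra.
have fxn k u : `|f u - radial (x k) u| <= r k.
  by have /andP[h1 h2] := fx k u; rewrite ger0_norm; lra.
have rk k : r k <= 2^-1 ^+ k.
  elim: k => [|k ih]; first by rewrite /r s0/= expr0.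
  by have [/andP[_ h] _ _] := st k; rewrite exprS; lra.
have f0 u : 0 <= f u by have /andP[h1 _] := fx 0%N u; exact: le_trans (radial_ge0 _ _) h1.
have fc : continuous f.
  apply: uniform_approx_continuous => e e0.
  exists (radial (x (Num.bound e^-1))); first exact: radial_continuous.
  move=> u; apply: (le_trans (fxn _ u)); apply: (le_trans (rk _)).
  rewrite exprVn -[leRHS]invrK lef_pV2 ?posrE ?invr_gt0 ?exprn_gt0//.
  apply: (@le_trans _ _ (Num.bound e^-1)%:R).
    by rewrite ltW// archi_boundP// invr_ge0 ltW.
  by rewrite -natrX ler_nat ltnW// ltn_expl.
have [C TC] := Tpt (body_of f).
(* Stage [k] makes some [T N] at least [k] on a whole ball that contains the limit body; [k] above
   the pointwise bound [C] is contradictory. *)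
have [_ _ [N hN]] := st (Num.bound C).
have : (Num.bound C)%:R <= `|T N (body_of f)|.
  by apply: hN => u; rewrite radial_body_of_ge0//; exact: fxn.
have C0 : 0 <= C by exact: le_trans (TC 0%N).
by have := TC N; have := archi_boundP C0; lra.
Qed.

End UniformBoundedness.

End Functionals.

(** * Orthogonally additive polynomials *)

Section Toggle.
Variables (R : realDomainType) (T : finType).

Definition toggle (a : T) (S : {set T}) := if a \in S then S :\ a else a |: S.

Lemma toggleK a : involutive (toggle a).
Proof.
move=> S; rewrite /toggle; case: (boolP (a \in S)) => aS.
  by rewrite finset.setD11 finset.setD1K.
by rewrite finset.setU11 finset.setU1K.
Qed.

Lemma in_toggle a b S : b != a -> (b \in toggle a S) = (b \in S).
Proof. by move=> ba; rewrite /toggle; case: ifP => _; rewrite !inE (negPf ba). Qed.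

(** Toggling [a] is a sign-reversing involution on subsets, so the sum equals its own opposite. *)
Lemma sum_toggle (g : {set T} -> R) a : (forall S, g (toggle a S) = g S) ->
  \sum_(S : {set T}) (-1) ^+ #|S| * g S = 0.
Proof.
move=> ga; set s := LHS.
have : s = - s.
  rewrite {1}/s (reindex_inj (can_inj (toggleK a)))/= -sumrN.
  apply: eq_bigr => S _; rewrite ga -mulNr; congr (_ * _).
  rewrite /toggle; case: (boolP (a \in S)) => aS.
    by rewrite (cardsD1 a S) aS add1n exprS mulN1r opprK.
  by rewrite cardsU1 aS add1n exprS mulN1r.
by move=> /eqP; rewrite -addr_eq0 -mulr2n mulrn_eq0/= => /eqP.
Qed.

End Toggle.

(** * Slices and polarization of a multilinear functional *)

Section Multilinear.
Variables (R : realType) (n m : nat).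
Local Notation S := (sphere R n).
Local Notation SB := (star_body R n).
Variable F : ('I_m -> SB) -> R.
Hypothesis F_add : separately_additive F.
Hypothesis F_hom : positively_homogeneous F.

(** Convertible with [[eta Ls with i |-> L]], so the hypotheses on [F] apply to it directly. *)
Definition upd (Ls : 'I_m -> SB) i L : 'I_m -> SB := fun j => if j == i then L else Ls j.

Lemma slice_additive_homogeneous Ls i : additive_homogeneous (fun L => F (upd Ls i L)).
Proof. by split => [L M|a a0 L]; [exact: F_add|exact: F_hom]. Qed.

Lemma upd_id Ls i : upd Ls i (Ls i) = Ls.
Proof. by apply/funext => j; rewrite /upd; case: eqP => [->|]. Qed.

Lemma updC Ls i j L M : i != j -> upd (upd Ls i L) j M = upd (upd Ls j M) i L.
Proof.
move=> ij; apply/funext => k; rewrite /upd; case: (eqVneq k j) => [->|//].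
by rewrite eq_sym (negPf ij).
Qed.

Section Polarization.
Hypothesis F_sym : symmetric_function F.
Variable Ls : 'I_m -> SB.

Definition body_sum (A : {set 'I_m}) : SB :=
  body_of (fun u => \sum_(i in A) radial (Ls i) u).

Lemma radial_body_sum A u : radial (body_sum A) u = \sum_(i in A) radial (Ls i) u.
Proof.
apply: radial_body_of_ge0; last by move=> v; rewrite sumr_ge0// => *; exact: radial_ge0.
by apply: cont_sum => i _; exact: radial_continuous.
Qed.

(** Interpolates between the polynomial at [body_sum A] ([k = m]) and [F (Ls \o phi)] ([k = 0]), so
    that sums are expanded one slot at a time. *)
Let mixed (k : nat) (A : {set 'I_m}) (phi : 'I_m -> 'I_m) :=
  F (fun j => if (j < k)%N then body_sum A else Ls (phi j)).

Let setf (phi : 'I_m -> 'I_m) k b : 'I_m -> 'I_m := fun j => if j == k then b else phi j.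

Let mixedS (k : 'I_m) A phi :
  mixed k.+1 A phi = \sum_(b in A) mixed k A (setf phi k b).
Proof.
pose M (j : 'I_m) := if (j < k)%N then body_sum A else Ls (phi j).
have T := slice_additive_homogeneous M k.
have E L : F (upd M k L) = F (fun j : 'I_m => if j == k then L else M j) by [].
have -> : mixed k.+1 A phi = F (upd M k (body_sum A)).
  congr F; apply/funext => j; rewrite /upd /M ltnS leq_eqVlt.
  by rewrite val_eqE; case: (j == k).
rewrite -(lin_radial T).
have -> : radial (body_sum A) = fun u => \sum_(b in A) radial (Ls b) u.
  by apply/funext => u; rewrite radial_body_sum.
rewrite (lin_sum T); last by move=> i; exact: radial_continuous.
apply: eq_bigr => b _; rewrite (lin_radial T); congr F; apply/funext => j.
rewrite /upd /M /setf; case: eqVneq => [->|//]; by rewrite ltnn.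
Qed.

(** The indicator records that the slots already expanded chose indices of [A]. It is 1 for [k = m];
    for [k = 0] it says that [A] contains the image of [phi]. *)
Let wsum (k : nat) phi : R := \sum_(A : {set 'I_m})
  (-1) ^+ #|A| * ([forall j : 'I_m, (k <= j)%N ==> (phi j \in A)]%:R * mixed k A phi).

Let wsumS (k : 'I_m) phi : wsum k.+1 phi = \sum_b wsum k (setf phi k b).
Proof.
rewrite /wsum exchange_big/=; apply: eq_bigr => A _; rewrite -mulr_sumr; congr (_ * _).
rewrite mixedS big_mkcond mulr_sumr; apply: eq_bigr => b _.
have -> : [forall j : 'I_m, (k <= j)%N ==> (setf phi k b j \in A)] =
    (b \in A) && [forall j : 'I_m, (k.+1 <= j)%N ==> (phi j \in A)].
  apply/forallP/andP => [H|[bA /forallP H] j].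
    split; first by have := H k; rewrite leqnn /setf eqxx.
    apply/forallP => j; apply/implyP => kj; have := H j; rewrite (ltnW kj) /setf.
    by case: eqVneq kj => [->|]; rewrite ?ltnn.
  apply/implyP => kj; rewrite /setf; case: eqVneq => // jk.
  by have /implyP := H j; apply; rewrite ltn_neqAle kj andbT eq_sym; exact: jk.
by case: (b \in A); rewrite ?mulr0 ?mul0r.
Qed.

(** If [phi] misses an index, toggling it cancels the sum. Otherwise [phi] is a permutation, only
    the full set contributes, with sign [(-1) ^+ m], and symmetry of [F] removes [phi]. *)
Let wsum0 phi : exists c, [/\ 0 <= c, (phi =1 id -> 0 < c) &
  (-1) ^+ m * wsum 0 phi = c * F Ls].
Proof.
have wE : wsum 0 phi = (\sum_(A : {set 'I_m}) (-1) ^+ #|A| *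
    [forall j : 'I_m, phi j \in A]%:R) * F (Ls \o phi).
  rewrite /wsum mulr_suml; apply: eq_bigr => A _; rewrite mulrA.
  by congr (_ * _%:R * _); apply: eq_forallb.
have [/injectiveP phiI|/injectiveP nI] := boolP (injectiveb phi).
  exists 1; split => //; rewrite wE mul1r.
  have /= -> : F (Ls \o phi) = F Ls.
    rewrite -(F_sym (perm phiI) Ls); congr F.
    by apply/funext => j /=; rewrite permE.
  rewrite (bigD1 finset.setT)//= big1 ?addr0.
    rewrite cardsT card_ord mulrA.
    have -> : [forall j, phi j \in finset.setT] by apply/forallP => j; rewrite inE.
    by rewrite mulr1 -expr2 sqrr_sign mul1r.
  move=> A AT; case: (boolP [forall j, phi j \in A]) => [/forallP H|]; last by rewrite mulr0.
  case/eqP: AT; apply/finset.setP => j; rewrite inE.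
  by have := H (invF phiI j); rewrite f_invF.
exists 0; split => // [phiid|].
  by exfalso; apply: nI => i j; rewrite !phiid.
have [a aphi] : exists a, forall j, phi j != a.
  apply: contrapT => H; apply: nI; apply/injectiveP; rewrite /injectiveb /dinjectiveb.
  apply/card_uniqP; rewrite size_map -cardE; apply: eq_card => b; rewrite [RHS]inE.
  apply/negPn/negP => nb; apply: H; exists b => j; apply/eqP => jb.
  by case/negP: nb; rewrite -jb; apply: map_f; rewrite mem_enum.
rewrite wE (@sum_toggle _ _ _ a) ?mul0r ?mulr0// => A; congr (nat_of_bool _)%:R.
by apply: eq_forallb => j; rewrite in_toggle.
Qed.

(** [c] counts the permutations that agree with [phi] from [k] on; if [phi] is the identity there,
    the identity permutation is one of them. *)
Let wsum_pos k : (k <= m)%N -> forall phi, exists c, [/\ 0 <= c,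
  ((forall j : 'I_m, (k <= j)%N -> phi j = j) -> 0 < c) &
  (-1) ^+ m * wsum k phi = c * F Ls].
Proof.
elim: k => [_ phi|k ih km phi].
  by have [c [c0 cpos cE]] := wsum0 phi; exists c; split => // H; apply: cpos => j; exact: H.
have {}ih := ih (ltnW km); pose K := Ordinal km.
have /(_ _)/cid - /all_sig[c cP] := fun b => ih (setf phi K b).
exists (\sum_b c b); split.
- by rewrite sumr_ge0// => b _; have [] := cP b.
- move=> H; rewrite (bigD1 K)//= ltr_pwDl ?sumr_ge0// => [|b _]; last by have [] := cP b.
  have [_ + _] := cP K; apply => j kj; rewrite /setf; case: eqVneq => // jK.
  by apply: H; rewrite ltn_neqAle kj andbT eq_sym; exact: jK.
- rewrite (wsumS K) mulr_sumr mulr_suml; apply: eq_bigr => b _.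
  by have [] := cP b.
Qed.

(** The constant is the number of permutations of the slots; its positivity allows dividing by
    it. *)
Lemma polarization : exists2 c : R, 0 < c &
  (-1) ^+ m * (\sum_(A : {set 'I_m}) (-1) ^+ #|A| * associated_polynomial F (body_sum A))
  = c * F Ls.
Proof.
have [c [_ cpos cE]] := wsum_pos (leqnn m) id.
exists c; first exact: cpos.
rewrite -cE; congr (_ * _); apply: eq_bigr => A _; congr (_ * _).
have -> : [forall j : 'I_m, (m <= j)%N ==> (id j \in A)].
  by apply/forallP => j; rewrite leqNgt ltn_ord.
by rewrite mul1r; congr F; apply/funext => j; rewrite ltn_ord.
Qed.

Hypothesis P_orth : orthogonally_additive (associated_polynomial F).

(** Orthogonal additivity splits each term of the polarization sum into one depending on [B :&: A],
    blind to toggling [j], and one depending on [B :\: A], blind to toggling [i]. Both alternating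
    sums therefore vanish. *)
Lemma orthogonal_clusters (A : {set 'I_m}) i j : i \in A -> j \notin A ->
  (forall i j u, i \in A -> j \notin A -> radial (Ls i) u * radial (Ls j) u = 0) ->
  F Ls = 0.
Proof.
move=> iA jA orth; have [c c0 cE] := polarization.
suff sum0 : \sum_(B : {set 'I_m}) (-1) ^+ #|B| * associated_polynomial F (body_sum B) = 0.
  by move: cE; rewrite sum0 mulr0 => /esym/eqP; rewrite mulf_eq0 gt_eqF//= => /eqP.
have PE B : associated_polynomial F (body_sum B) =
    associated_polynomial F (body_sum (B :&: A)) + associated_polynomial F (body_sum (B :\: A)).
  rewrite -P_orth.
    congr associated_polynomial; apply: radial_inj => u.
    by rewrite radial_sumE !radial_body_sum -(big_setID A).
  apply/disjoint_radial => u; rewrite !radial_body_sum mulr_suml big1// => k.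
  rewrite inE => /andP[_ kA]; rewrite mulr_sumr big1// => l.
  by rewrite inE => /andP[lA _]; exact: orth.
under eq_bigr do rewrite PE mulrDr.
rewrite big_split/= (@sum_toggle _ _ (fun B => associated_polynomial F (body_sum (B :&: A))) j); last first.
  move=> B; congr (associated_polynomial F (body_sum _)); apply/finset.setP => k; rewrite !inE.
  by case: (eqVneq k j) => [->|kj]; rewrite ?(negPf jA) ?andbF// in_toggle.
rewrite (@sum_toggle _ _ (fun B => associated_polynomial F (body_sum (B :\: A))) i) ?addr0//.
move=> B; congr (associated_polynomial F (body_sum _)); apply/finset.setP => k; rewrite !inE.
by case: (eqVneq k i) => [->|ki]; rewrite ?iA// in_toggle.
Qed.

End Polarization.

End Multilinear.

(** * From orthogonal additivity to vanishing on disjoint bodies *)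

Section SeparatedSupports.
Variables (R : realType) (n m : nat).
Local Notation S := (sphere R n).
Local Notation SB := (star_body R n).
Variable F : ('I_m -> SB) -> R.
Hypothesis F_add : separately_additive F.
Hypothesis F_hom : positively_homogeneous F.

Lemma difference_bounded (Fp Fm : ('I_m -> SB) -> R) :
  separately_additive Fp -> positively_homogeneous Fp ->
  separately_additive Fm -> positively_homogeneous Fm ->
  (forall Ls, 0 <= Fp Ls) -> (forall Ls, 0 <= Fm Ls) ->
  (forall Ls, F Ls = Fp Ls - Fm Ls) -> separately_bounded F.
Proof.
move=> pa ph ma mh p0 m0 FE i Ls.
have [C1 h1] := positive_bounded (slice_additive_homogeneous pa ph Ls i) (fun=> p0 _).
have [C2 h2] := positive_bounded (slice_additive_homogeneous ma mh Ls i) (fun=> m0 _).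
exists (C1 + C2) => L /sub_unit_ballP L1; rewrite FE (le_trans (ler_normB _ _))// lerD//.
  exact: (h1 L L1).
exact: (h2 L L1).
Qed.

Hypothesis F_bd : separately_bounded F.

Lemma slice_bounded Ls i : exists C, ball_bounded (fun L => F (upd Ls i L)) C.
Proof.
by have [C HC] := F_bd i Ls; exists C => L L1; apply: HC; exact/sub_unit_ballP.
Qed.

(** Lowering one radial function by [e] moves it by at most [e] uniformly, and a bounded slice does
    not see this in the limit. This buys positive separation between supports that are only
    disjoint. *)
Lemma slice_truncated Ls i :
  (forall e, 0 < e -> F (upd Ls i (body_of (fun u => radial (Ls i) u - e))) = 0) -> F Ls = 0.
Proof.
move=> H; have T := slice_additive_homogeneous F_add F_hom Ls i.
have [C TC] := slice_bounded Ls i; have C0 := bounded_ge0 TC.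
have Lc := radial_continuous (L := Ls i).
apply/eqP; rewrite -normr_le0; apply/ler_addgt0Pr => e e0; rewrite add0r.
have d0 : 0 < e / (2 * C + 1) by rewrite divr_gt0//; lra.
have dE : 2 * C * (e / (2 * C + 1)) <= e.
  by rewrite mulrCA -{2}[e]mulr1 ler_pM2l// ler_pdivrMr; lra.
set d := e / _ in d0 dE; apply: le_trans dE.
have fc : continuous (fun u => radial (Ls i) u - d) by apply: contB => //; exact: cont_cst.
pose f u := radial (Ls i) u - radial (body_of (fun u => radial (Ls i) u - d)) u.
have -> : F Ls = lin (fun L => F (upd Ls i L)) f.
  rewrite (linB T) ?lin_radial//; last exact: radial_continuous.
  by rewrite H// subr0 upd_id.
apply: (lin_bounded T TC).
  by apply: contB => //; exact: radial_continuous.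
move=> u; rewrite /f radial_body_of//; have L0 := radial_ge0 (Ls i) u.
by have [h|h] := leP 0 (radial (Ls i) u - d); rewrite ger0_norm; lra.
Qed.

Section Separation.
Hypothesis F_clusters : forall (Ls : 'I_m -> SB) (A : {set 'I_m}) i j, i \in A -> j \notin A ->
  (forall i j u, i \in A -> j \notin A -> radial (Ls i) u * radial (Ls j) u = 0) ->
  F Ls = 0.
Variable theta : S -> R.
Hypothesis theta_cont : continuous theta.

(* The gap between the levels [a] and [b] shrinks at each step to make room for
   the splitting of one more body. *)
Lemma separated_vanish k (A B : {set 'I_m}) (a b : R) (Ls : 'I_m -> SB) i j : a < b ->
  #|~: (A :|: B)| = k -> i \in A -> j \in B -> j \notin A ->
  (forall i, i \in A -> forall u, a < theta u -> radial (Ls i) u = 0) ->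
  (forall i, i \in B -> forall u, theta u < b -> radial (Ls i) u = 0) ->
  F Ls = 0.
Proof.
elim: k A B a b Ls => [|k ih] A B a b Ls ab kE iA jB jA HA HB.
  apply: (F_clusters iA jA) => p q u pA qA.
  have qB : q \in B.
    apply/negPn/negP => qB.
    have : q \in ~: (A :|: B) by rewrite !inE negb_or qA qB.
    by rewrite (cards0_eq kE) finset.in_set0.
  have [h|h] := ltP a (theta u); first by rewrite (HA p)// mul0r.
  by rewrite [X in _ * X](HB q) ?mulr0//; lra.
have [c] : exists c, c \in ~: (A :|: B) by apply/finset.set0Pn; rewrite -card_gt0 kE.
rewrite !inE negb_or => /andP[cA cB].
(* Body [c] is cut by [phi], which rises from 0 to 1 on the middle third. The piece [phi] joins [B]
   and leaves the gap from [a] to [a']; the piece [1 - phi] joins [A] and leaves the gap from [b']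
   to [b]. *)
pose a' := (2 * a + b) / 3; pose b' := (a + 2 * b) / 3.
have [aa' a'b' b'b] : [/\ a < a', a' < b' & b' < b] by rewrite /a' /b'; split; lra.
pose phi u := Num.min 1 (Num.max 0 ((theta u - a') / (b' - a'))).
have phic : continuous phi.
  apply: cont_min; first exact: cont_cst.
  apply: cont_max; first exact: cont_cst.
  by apply: contM; [apply: contB => //; exact: cont_cst|exact: cont_cst].
have phi0 u : 0 <= phi u by rewrite le_min ler01 le_max lexx.
have phi1 u : phi u <= 1 by rewrite ge_min lexx.
have phia u : theta u < a' -> phi u = 0.
  move=> h; rewrite /phi max_l ?min_r//; rewrite pmulr_lle0 ?invr_gt0; lra.
have phib u : b' < theta u -> phi u = 1.
  move=> h; rewrite /phi min_l// le_max; apply/orP; right.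
  by rewrite ler_pdivlMr; lra.
have Lc := radial_continuous (L := Ls c).
have f1c : continuous (fun u => radial (Ls c) u * phi u) by exact: contM.
have f2c : continuous (fun u => radial (Ls c) u * (1 - phi u)).
  by apply: contM => //; apply: contB => //; exact: cont_cst.
have f10 u : 0 <= radial (Ls c) u * phi u by rewrite mulr_ge0 ?radial_ge0.
have f20 u : 0 <= radial (Ls c) u * (1 - phi u) by rewrite mulr_ge0 ?radial_ge0// subr_ge0.
have [Fa _] := slice_additive_homogeneous F_add F_hom Ls c.
have -> : F Ls = F (upd Ls c (body_of (fun u => radial (Ls c) u * phi u))) +
    F (upd Ls c (body_of (fun u => radial (Ls c) u * (1 - phi u)))).
  rewrite -Fa -[in LHS](upd_id Ls c); congr (F (upd _ _ _)); apply: radial_inj => u.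
  by rewrite radial_sumE !radial_body_of_ge0//; lra.
have card1 (X Y : {set 'I_m}) : c \in ~: X -> ~: Y = ~: X :\ c -> #|~: X| = k.+1 -> #|~: Y| = k.
  by move=> cX YE XE; move: XE; rewrite (cardsD1 c) cX add1n -YE => -[].
have cAB : c \in ~: (A :|: B) by rewrite !inE negb_or cA cB.
rewrite (ih A (c |: B) a a')//; last 4 first.
- apply: (card1 _ _ cAB) => //; apply/finset.setP => x; rewrite !inE.
  by case: (x == c); case: (x \in A); case: (x \in B).
- by rewrite !inE jB orbT.
- move=> p pA u au; rewrite /upd; case: eqVneq pA => [->|_ pA]; last exact: HA.
  by rewrite (negPf cA).
- move=> p; rewrite !inE /upd => /orP[/eqP -> u ua|pB u ua].
    by rewrite eqxx radial_body_of_ge0// phia// mulr0.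
  case: eqVneq pB => [->|_ pB]; first by rewrite (negPf cB).
  by apply: HB => //; lra.
- rewrite (ih (c |: A) B b' b) ?addr0//.
  + apply: (card1 _ _ cAB) => //; apply/finset.setP => x; rewrite !inE.
    by case: (x == c); case: (x \in A); case: (x \in B).
  + by rewrite !inE iA orbT.
  + by rewrite !inE negb_or jA andbT; apply: contraNneq cB => <-.
  + move=> p; rewrite !inE /upd => /orP[/eqP -> u ua|pA u ua].
      by rewrite eqxx radial_body_of_ge0// phib// subrr mulr0.
    case: eqVneq pA => [->|_ pA]; first by rewrite (negPf cA).
    by apply: HA => //; lra.
  + move=> p pB u ub; rewrite /upd; case: eqVneq pB => [->|_ pB]; last exact: HB.
    by rewrite (negPf cB).
Qed.

End Separation.

Lemma orthogonal_polynomial_vanishes :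
  symmetric_function F -> orthogonally_additive (associated_polynomial F) ->
  vanishes_on_disjoint F.
Proof.
move=> F_sym P_orth Ls [i [j [ij /disjoint_radial Lij]]].
apply: (@slice_truncated Ls i) => e e0; apply: (@slice_truncated _ j) => d d0.
set M := upd _ j _.
have ic : continuous (fun u => radial (Ls i) u - e).
  by apply: contB; [exact: radial_continuous|exact: cont_cst].
have jc : continuous (fun u => radial (upd Ls i (body_of (fun u => radial (Ls i) u - e)) j) u - d).
  by apply: contB; [exact: radial_continuous|exact: cont_cst].
have Mi u : radial (M i) u = Num.max 0 (radial (Ls i) u - e).
  by rewrite /M /upd (negPf ij) eqxx radial_body_of.
have Mj u : radial (M j) u = Num.max 0 (radial (Ls j) u - d).
  by rewrite /M /upd eqxx radial_body_of// /upd eq_sym (negPf ij).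
have tc : continuous (fun u => radial (Ls j) u - radial (Ls i) u).
  by apply: contB; exact: radial_continuous.
have L0 k u := radial_ge0 (Ls k) u.
have cl (Ks : 'I_m -> SB) (A : {set 'I_m}) p q : p \in A -> q \notin A ->
    (forall p q u, p \in A -> q \notin A -> radial (Ks p) u * radial (Ks q) u = 0) ->
    F Ks = 0.
  by move=> pA qA h; exact: (orthogonal_clusters F_add F_hom F_sym P_orth pA qA h).
(* Where the truncated body [i] is nonzero, the radius of [Ls i] exceeds [e] and that of [Ls j] is
   0, so [theta < - e]; symmetrically [theta > d] on the truncated body [j]. *)
apply: (separated_vanish cl tc (A := finset.set1 i) (B := finset.set1 j)
  (a := - e) (b := d) (i := i) (j := j)) => //.
- lra.
- by rewrite !inE.
- by rewrite !inE.
- by rewrite !inE eq_sym.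
- move=> k; rewrite !inE => /eqP -> u h; rewrite Mi max_l//.
  have /eqP := Lij u; rewrite mulf_eq0 => /orP[] /eqP E; first lra.
  by move: h; rewrite E; lra.
- move=> k; rewrite !inE => /eqP -> u h; rewrite Mj max_l//.
  have /eqP := Lij u; rewrite mulf_eq0 => /orP[] /eqP E; last lra.
  by move: h; rewrite E; lra.
Qed.

End SeparatedSupports.

(** * Reduction to the product of the radial functions *)

Section Tents.
Variable R : realFieldType.
Implicit Types s t : R.

Definition ramp s := Num.min 1 (Num.max 0 s).
Definition tent s := Num.max 0 (1 - `|s|).

Lemma ramp_ge0 s : 0 <= ramp s. Proof. by rewrite le_min ler01 le_max lexx. Qed.
Lemma ramp_le1 s : ramp s <= 1. Proof. by rewrite ge_min lexx. Qed.
Lemma tent_ge0 s : 0 <= tent s. Proof. by rewrite le_max lexx. Qed.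

Lemma ramp0 s : s <= 0 -> ramp s = 0.
Proof. by move=> s0; rewrite /ramp max_l// min_r. Qed.

Lemma ramp1 s : 1 <= s -> ramp s = 1.
Proof. by move=> s1; rewrite /ramp min_l// le_max s1 orbT. Qed.

Lemma ramp_id s : 0 <= s <= 1 -> ramp s = s.
Proof. by move=> /andP[s0 s1]; rewrite /ramp max_r// min_r. Qed.

Lemma tent0 s : 1 <= `|s| -> tent s = 0.
Proof. by move=> s1; rewrite /tent max_l// subr_le0. Qed.

(** Tents are differences of consecutive ramps. Hence the sums in [sum_tent] and [sum_ntent]
    telescope: the tents form a partition of unity, and weighting them by [k] gives back [t]. *)
Lemma tent_ramp s : tent (s - 1) = ramp s - ramp (s - 1).
Proof.
have [s0|s0] := leP s 0.
  by rewrite tent0 ?ramp0 ?subrr//; [lra|rewrite ler0_norm; lra].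
have [s2|s2] := leP 2 s.
  by rewrite tent0 ?ramp1 ?subrr//; [lra|lra|rewrite ger0_norm; lra].
have [s1|s1] := leP s 1.
  by rewrite (ramp0 (s := s - 1)) ?ramp_id /tent ?max_r ?ler0_norm; lra.
by rewrite (ramp1 (s := s)) ?ramp_id /tent ?max_r ?ger0_norm; lra.
Qed.

Lemma tent_ramp0 s : 0 <= s -> tent s = 1 - ramp s.
Proof.
move=> s0; have [s1|s1] := leP 1 s.
  by rewrite tent0 ?ramp1 ?subrr// ger0_norm.
by rewrite ramp_id /tent ?max_r ?ger0_norm; lra.
Qed.

Lemma sum_ramp t n : 0 <= t -> \sum_(k < n) ramp (t - k%:R) = Num.min t n%:R.
Proof.
move=> t0; elim: n => [|n ih]; first by rewrite big_ord0 min_r.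
by rewrite big_ord_recr/= ih min_layer// natr1.
Qed.

Lemma sum_tent t n : 0 <= t -> \sum_(k < n.+1) tent (t - k%:R) = 1 - ramp (t - n%:R).
Proof.
move=> t0; elim: n => [|n ih]; first by rewrite big_ord1 subr0 tent_ramp0.
rewrite big_ord_recr/= ih -natr1 opprD addrA tent_ramp; lra.
Qed.

Lemma sum_ntent t n : \sum_(k < n.+1) k%:R * tent (t - k%:R) =
  \sum_(k < n) ramp (t - k%:R) - n%:R * ramp (t - n%:R).
Proof.
elim: n => [|n ih]; first by rewrite big_ord1 big_ord0 !mul0r subrr.
rewrite big_ord_recr/= ih [in RHS]big_ord_recr/= -natr1 opprD addrA tent_ramp; lra.
Qed.

(** Equal to [s] wherever [tent s] is nonzero, yet bounded and zero for [|s| >= 2]; multiplying by a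
    ramp keeps it continuous. *)
Definition cutoff s := s * ramp (2 - `|s|).

Lemma cutoff_id s : `|s| <= 1 -> cutoff s = s.
Proof. by move=> s1; rewrite /cutoff ramp1 ?mulr1//; lra. Qed.

Lemma cutoff0 s : 2 <= `|s| -> cutoff s = 0.
Proof. by move=> s1; rewrite /cutoff ramp0 ?mulr0//; lra. Qed.

Lemma cutoff_le2 s : `|cutoff s| <= 2.
Proof.
have [s2|s2] := leP 2 `|s|; first by rewrite cutoff0// normr0.
rewrite normrM (ger0_norm (ramp_ge0 _)); have := ramp_ge0 (2 - `|s|).
by have := ramp_le1 (2 - `|s|); have := normr_ge0 s; nra.
Qed.

Lemma sum_at_most_one (I : finType) (P : pred I) (x : I -> R) c : 0 <= c ->
  (forall i, `|x i| <= c) -> (forall i j, P i -> P j -> i != j -> x i * x j = 0) ->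
  `|\sum_(i | P i) x i| <= c.
Proof.
move=> c0 xc x0; have [[i [Pi xi]]|nx] := pselect (exists i, P i /\ x i != 0).
  rewrite (bigD1 i)//= big1 ?addr0// => j /andP[Pj ji].
  by have /eqP := x0 _ _ Pi Pj ltac:(by rewrite eq_sym); rewrite mulf_eq0 (negPf xi) => /eqP.
rewrite big1 ?normr0// => i Pi; apply/eqP/negPn/negP => xi.
by apply: nx; exists i.
Qed.

End Tents.

Lemma cont_ramp (R : realType) (X : topologicalType) (f : X -> R) :
  continuous f -> continuous (fun x => ramp (f x)).
Proof. by move=> fc; apply: cont_min; [|apply: cont_max => //]; exact: cont_cst. Qed.

Lemma cont_norm (R : realType) (X : topologicalType) (f : X -> R) :
  continuous f -> continuous (fun x => `|f x|).
Proof. by move=> fc x; apply: continuous_comp; [exact: fc|exact: norm_continuous]. Qed.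

(** * A bilinear functional vanishing on disjoint pairs depends only on the product *)

Section Bilinear.
Variables (R : realType) (n : nat).
Local Notation S := (sphere R n).
Local Notation SB := (star_body R n).
Variable B : SB -> SB -> R.
Hypothesis B_l : forall M, additive_homogeneous (fun L => B L M).
Hypothesis B_r : forall L, additive_homogeneous (B L).
Hypothesis bd_l : forall M, exists C, ball_bounded (fun L => B L M) C.
Hypothesis bd_r : forall L, exists C, ball_bounded (B L) C.
Hypothesis B_disj : forall L M : SB, (forall u, radial L u * radial M u = 0) -> B L M = 0.
Implicit Types f g : S -> R.

Let b f g := lin (fun L => lin (B L) g) f.

Let b_l g : additive_homogeneous (fun L => lin (B L) g).
Proof.
split=> [L M|a a0 L]; rewrite /lin.
  by rewrite !(proj1 (B_l _)); lra.
by rewrite !(proj2 (B_l _)); lra.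
Qed.

(** [b] is linear in [f] by construction; linearity in [g] is read off from this form, available for
    nonnegative [f] such as tents and their sums. *)
Let b_body f g : continuous f -> (forall u, 0 <= f u) -> b f g = lin (B (body_of f)) g.
Proof. by move=> fc f0; rewrite /b -(lin_body (b_l g)). Qed.

Let b_disj f g : continuous f -> continuous g -> (forall u, 0 <= f u) ->
  (forall u, f u * g u = 0) -> b f g = 0.
Proof.
move=> fc gc f0 fg; rewrite b_body// /lin !B_disj ?subr0//.
  move=> u; rewrite radial_body_of_ge0// radial_body_of//; last exact: contN.
  have /eqP := fg u; rewrite mulf_eq0 => /orP[] /eqP ->; first by rewrite mul0r.
  by rewrite oppr0 maxxx mulr0.
move=> u; rewrite radial_body_of_ge0// radial_body_of//.
have /eqP := fg u; rewrite mulf_eq0 => /orP[] /eqP ->; first by rewrite mul0r.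
by rewrite maxxx mulr0.
Qed.

Let b_sum (I : Type) (r : seq I) (P : pred I) (h : I -> S -> R) g :
  (forall i, continuous (h i)) ->
  b (fun u => \sum_(i <- r | P i) h i u) g = \sum_(i <- r | P i) b (h i) g.
Proof. by move=> hc; rewrite /b (lin_sum (b_l g)). Qed.

Section Fixed.
Variables f g : S -> R.
Hypothesis f_cont : continuous f.
Hypothesis g_cont : continuous g.
Hypothesis f_ge0 : forall u, 0 <= f u.
Variables cf cg : R.
Hypothesis f_le : forall u, f u <= cf.
Hypothesis g_le : forall u, `|g u| <= cg.

(** An upper bound for [N f], so the tents of index at most [K N] already sum to 1. *)
Let K (N : nat) := Num.bound (N%:R * cf).
Let s (N k : nat) u : R := N%:R * f u - k%:R.
Let phi N k u : R := tent (s N k u).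
Let Phi N (r : nat) u : R := \sum_(k < (K N).+1 | (k %% 4 == r)%N) phi N k u.
Let q N k u : R := cutoff (s N k u) * g u.

Let s_cont N k : continuous (s N k).
Proof. by apply: contB; [exact: contZ|exact: cont_cst]. Qed.

Let phi_cont N k : continuous (phi N k).
Proof.
apply: cont_max; first exact: cont_cst.
by apply: contB; [exact: cont_cst|exact: cont_norm].
Qed.

Let q_cont N k : continuous (q N k).
Proof.
apply: contM => //; apply: contM => //; apply: cont_ramp.
by apply: contB; [exact: cont_cst|exact: cont_norm].
Qed.

Let sK N u : s N (K N) u <= 0.
Proof.
have h : N%:R * f u <= N%:R * cf by rewrite ler_wpM2l.
rewrite subr_le0 (le_trans h)// ltW// archi_boundP//.
by rewrite mulr_ge0// (le_trans (f_ge0 u)).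
Qed.

Let phi_sum N u : \sum_(k < (K N).+1) phi N k u = 1.
Proof. by rewrite sum_tent ?mulr_ge0// ramp0 ?subr0//; exact: sK. Qed.

Let phi_nsum N u : \sum_(k < (K N).+1) k%:R * phi N k u = N%:R * f u.
Proof.
rewrite sum_ntent ramp0; last exact: sK.
rewrite mulr0 subr0 sum_ramp ?mulr_ge0// min_l//.
by rewrite -subr_le0; exact: sK.
Qed.

Let Phi_cont N r : continuous (Phi N r).
Proof. by apply: cont_sum. Qed.

Let Phi_ge0 N r u : 0 <= Phi N r u.
Proof. by rewrite sumr_ge0// => k _; exact: tent_ge0. Qed.

Let Phi_le1 N r u : Phi N r u <= 1.
Proof.
rewrite -(phi_sum N u) [leRHS](bigID (fun k : 'I__ => k %% 4 == r)%N)/= lerDl.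
by rewrite sumr_ge0// => k _; exact: tent_ge0.
Qed.

(* The blocks [Phi N r] range over infinitely many functions, but all are bounded
   by 1, so the functionals [B (Phi N r)] are pointwise bounded. *)
Let Phi_bound : exists C : R, forall N r, (r < 4)%N -> ball_bounded (B (body_of (Phi N r))) C.
Proof.
have [||L|C HC] := @uniform_boundedness R n
    (fun p => B (body_of (Phi (p %/ 4)%N (p %% 4)%N))).
- by move=> p; exact: B_r.
- by move=> p; exact: bd_r.
- have [C HC] := bd_l L; exists C => p; apply: HC => u.
  by rewrite radial_body_of_ge0.
- exists C => N r r4; have := HC (N * 4 + r)%N.
  by rewrite divnMDl// divn_small// addn0 modnMDl modn_small.
Qed.

Let s_diff N k l u : s N k u - s N l u = l%:R - k%:R.
Proof. by rewrite /s; lra. Qed.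

(** The reason for the modulus 4: [q] lives where [|s| < 2], so two of them can overlap only at
    levels closer than 4, and a tent, where [|s| < 1], can meet a [q] only at levels closer than
    3. *)
Let far N k l u : (k %% 4 = l %% 4)%N -> k != l -> 4 <= `|s N k u - s N l u|.
Proof.
rewrite s_diff; wlog kl : k l / (k < l)%N.
  move=> H klr kl; case: (ltngtP k l) kl => // h _.
    by apply: H => //; rewrite ltn_eqF.
  by rewrite distrC; apply: H => //; rewrite ltn_eqF.
move=> klr _; have h : (k + 4 <= l)%N by lia.
have : (k + 4)%:R <= l%:R :> R by rewrite ler_nat.
by rewrite natrD => h'; rewrite ger0_norm; lra.
Qed.

Let b_phi N k h : b (phi N k) h = lin (B (body_of (phi N k))) h.
Proof. by rewrite b_body// => u; exact: tent_ge0. Qed.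

(* Only the values of [g] where [|N f - k| < 1] matter for [b (phi N k)]; there
   [N f - k] may be replaced by its truncation, which is bounded independently of [N]. *)
Let b_defect N : N%:R * (b f g - b (fun=> 1) (fun u => f u * g u)) =
  - \sum_(k < (K N).+1) b (phi N k) (q N k).
Proof.
have fgc : continuous (fun u => f u * g u) by exact: contM.
have -> : b (fun=> 1) (fun u => f u * g u) =
    \sum_(k < (K N).+1) b (phi N k) (fun u => f u * g u).
  by rewrite -b_sum//; congr b; apply/funext => u; rewrite phi_sum.
have E : N%:R * b f g = \sum_(k < (K N).+1) k%:R * b (phi N k) g.
  rewrite -(linZ (b_l g) N%:R f_cont).
  have -> : (fun u => N%:R * f u) = fun u => \sum_(k < (K N).+1) k%:R * phi N k u.
    by apply/funext => u; rewrite phi_nsum.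
  apply: etrans.
    apply: (@b_sum 'I_(K N).+1 (index_enum _) xpredT (fun k u => k%:R * phi N k u) g) => k.
    exact: contZ.
  by apply: eq_bigr => k _; rewrite /b (linZ (b_l g)).
rewrite mulrBr E mulr_sumr -sumrB -sumrN; apply: eq_bigr => k _.
have BR := B_r (body_of (phi N k)).
have sgc : continuous (fun u => s N k u * g u) by exact: contM.
have -> : b (phi N k) (q N k) = b (phi N k) (fun u => s N k u * g u).
  apply/esym/eqP; rewrite -subr_eq0 !b_phi -(linB BR)// -b_phi; apply/eqP.
  apply: b_disj => //; first exact: contB.
    by move=> u; exact: tent_ge0.
  move=> u; rewrite /q; have [h|h] := leP 1 `|s N k u|.
    by rewrite /phi tent0// mul0r.
  by rewrite cutoff_id ?subrr ?mulr0// ltW.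
have -> : (fun u => s N k u * g u) = fun u => N%:R * (f u * g u) - k%:R * g u.
  by apply/funext => u; rewrite /s; lra.
rewrite !b_phi (linB BR); [|exact: contZ|exact: contZ].
by rewrite !(linZ BR)//; lra.
Qed.

Let Q N (r : nat) u : R := \sum_(k < (K N).+1 | (k %% 4 == r)%N) q N k u.

Let Q_cont N r : continuous (Q N r).
Proof. by apply: cont_sum. Qed.

Let Q_le N r u : `|Q N r u| <= 2 * cg.
Proof.
have cg0 : 0 <= cg by exact: le_trans (g_le u).
apply: sum_at_most_one => [|k|k l /eqP kr /eqP lr kl].
- by rewrite mulr_ge0.
- by rewrite normrM ler_pM// cutoff_le2.
have := @far N k l u (etrans kr (esym lr)) kl => h.
rewrite /q; have [hk|hk] := leP 2 `|s N k u|; first by rewrite (cutoff0 hk) !mul0r.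
have [hl|hl] := leP 2 `|s N l u|; first by rewrite (cutoff0 hl) mul0r mulr0.
by have := ler_normB (s N k u) (s N l u); lra.
Qed.

(* Within a residue class mod 4 the supports of [phi N k] and [q N l], k <> l, are
   disjoint, so the off-diagonal terms vanish. *)
Let b_block N r : b (Phi N r) (Q N r) =
  \sum_(k < (K N).+1 | (k %% 4 == r)%N) b (phi N k) (q N k).
Proof.
rewrite b_sum//; apply: eq_bigr => k /eqP kr.
rewrite b_phi (lin_sum (B_r _))// (bigD1 k)/= ?kr// big1 ?addr0 ?b_phi//.
move=> l /andP[/eqP lr lk]; rewrite -b_phi; apply: b_disj => // u.
  exact: tent_ge0.
have := @far N l k u (etrans lr (esym kr)) lk => h.
rewrite /q /phi; have [hk|hk] := leP 1 `|s N k u|; first by rewrite (tent0 hk) mul0r.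
have [hl|hl] := leP 2 `|s N l u|; first by rewrite (cutoff0 hl) mul0r mulr0.
by have := ler_normB (s N l u) (s N k u); lra.
Qed.

Let b_defect_bound : exists C : R, forall N,
  `|N%:R * (b f g - b (fun=> 1) (fun u => f u * g u))| <= C.
Proof.
have [C HC] := Phi_bound; exists (\sum_(r < 4) (2 * C * (2 * cg))) => N.
rewrite b_defect normrN.
rewrite (partition_big (fun k : 'I_(K N).+1 => Ordinal (ltn_pmod k (isT : 0 < 4)%N)) xpredT)//=.
apply: (le_trans (ler_norm_sum _ _ _)); apply: ler_sum => r _.
have -> : \sum_(k < (K N).+1 | Ordinal (ltn_pmod k (isT : 0 < 4)%N) == r) b (phi N k) (q N k)
    = b (Phi N r) (Q N r).
  by rewrite b_block; apply: eq_bigl.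
rewrite b_body//; apply: (lin_bounded (B_r _)) => //.
exact: (HC N r (ltn_ord r)).
Qed.

Lemma bilinear_product_fun : b f g = b (fun=> 1) (fun u => f u * g u).
Proof.
have [C HC] := b_defect_bound; apply/eqP; rewrite -subr_eq0 -normr_le0.
set D := `|_| ; have D0 : 0 <= D by exact: normr_ge0.
rewrite leNgt; apply/negP => Dp.
have C0 : 0 <= C by exact: le_trans (HC 0%N).
have := HC (Num.bound (C / D)); rewrite normrM ger0_norm// -/D -ler_pdivlMr//.
have := archi_boundP (divr_ge0 C0 D0); lra.
Qed.

End Fixed.

Lemma bilinear_product L M :
  B L M = B (body_of (fun=> 1)) (body_of (fun u => radial L u * radial M u)).
Proof.
have Lc := radial_continuous (L := L); have Mc := radial_continuous (L := M).
have [cf _ hf] := radial_bounded L; have [cg _ hg] := radial_bounded M.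
have c1 : continuous (fun _ : S => 1 : R) by exact: cont_cst.
have := @bilinear_product_fun (radial L) (radial M) Lc Mc (radial_ge0 L) cf cg hf _.
rewrite b_body//; last exact: radial_ge0.
rewrite body_ofK b_body// (lin_radial (B_r L)) -(lin_body (B_r _)).
- by apply => u; rewrite ger0_norm// radial_ge0.
- exact: contM.
- by move=> u; rewrite mulr_ge0// radial_ge0.
Qed.

End Bilinear.

Section ProductFormula.
Variables (R : realType) (n m : nat).
Local Notation S := (sphere R n).
Local Notation SB := (star_body R n).
Variable F : ('I_m -> SB) -> R.
Hypothesis F_add : separately_additive F.
Hypothesis F_hom : positively_homogeneous F.
Hypothesis F_bd : separately_bounded F.
Hypothesis F_disj : vanishes_on_disjoint F.

Let one : SB := body_of (fun=> 1).

(** With the other slots frozen, [F] is a bilinear functional of slots [i] and [j] that vanishes on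
    disjoint pairs, to which [bilinear_product] applies. *)
Lemma pair_product Ls i j : i != j ->
  F Ls = F (upd (upd Ls i one) j (body_of (fun u => radial (Ls i) u * radial (Ls j) u))).
Proof.
move=> ij; pose B L M := F (upd (upd Ls i L) j M).
have BE L M : B L M = F (upd (upd Ls j M) i L) by rewrite /B updC.
have -> : F Ls = B (Ls i) (Ls j).
  by rewrite /B !upd_id.
apply: bilinear_product => [M|L|M|L|L M LM].
- have -> : B^~ M = fun L => F (upd (upd Ls j M) i L) by apply/funext => L; exact: BE.
  exact: slice_additive_homogeneous.
- exact: slice_additive_homogeneous.
- have -> : B^~ M = fun L => F (upd (upd Ls j M) i L) by apply/funext => L; exact: BE.
  exact: slice_bounded.
- exact: slice_bounded.
- apply: F_disj; exists i, j; split => //.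
  by rewrite /upd (negPf ij) !eqxx; apply/disjoint_radial.
Qed.

Lemma product_formula (i0 : 'I_m) Ls :
  F Ls = F (upd (fun=> one) i0 (body_of (fun u => \prod_i radial (Ls i) u))).
Proof.
have Lc i := radial_continuous (L := Ls i).
(* [r] lists the slots already emptied: each holds the unit ball, and its radial function has moved
   as a factor into slot [i0]. *)
have key (r : seq 'I_m) : i0 \notin r -> uniq r -> F Ls =
    F (upd (fun j => if j \in r then one else Ls j) i0
      (body_of (fun u => radial (Ls i0) u * \prod_(i <- r) radial (Ls i) u))).
  elim: r => [_ _|i r ih].
    congr F; apply/funext => j; rewrite /upd; case: eqVneq => [->|//].
    by apply: radial_inj => u; rewrite radial_body_of_ge0// ?big_nil ?mulr1 ?radial_ge0//;
      [apply: contM => //; apply: cont_prod|move=> v; rewrite big_nil mulr1 radial_ge0].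
  rewrite inE negb_or => /andP[i0i i0r] /= /andP[ir ur].
  pose X := body_of (fun u => radial (Ls i0) u * \prod_(i <- r) radial (Ls i) u).
  pose M := upd (fun j => if j \in r then one else Ls j) i0 X.
  have Mi : M i = Ls i by rewrite /M /upd eq_sym (negPf i0i) (negPf ir).
  have Mi0 : M i0 = X by rewrite /M /upd eqxx.
  have -> : F Ls = F M by exact: ih.
  rewrite (@pair_product M i i0) 1?eq_sym// Mi Mi0.
  congr F; apply/funext => j; rewrite /M /upd.
  case: (eqVneq j i0) => [_|ji0].
    congr body_of; apply/funext => u; rewrite big_cons radial_body_of_ge0.
    - by rewrite mulrCA.
    - by apply: contM => //; apply: cont_prod.
    - by move=> v; rewrite mulr_ge0 ?radial_ge0// prodr_ge0// => *; exact: radial_ge0.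
  by rewrite inE; case: eqVneq.
rewrite (key (rem i0 (enum 'I_m))).
- congr F; apply/funext => j; rewrite /upd; case: eqVneq => [_|ji].
    congr body_of; apply/funext => u.
    rewrite [RHS](bigD1 i0)//=; congr (_ * _).
    rewrite rem_filter ?enum_uniq// big_filter big_enum_cond/=.
    by [].
  by rewrite rem_filter ?enum_uniq// mem_filter mem_enum /= ji.
- by rewrite rem_filter ?enum_uniq// mem_filter /= eqxx.
- by rewrite rem_uniq ?enum_uniq.
Qed.

End ProductFormula.

(** * Representation by a signed measure *)

Section ContinuousIntegral.
Variables (R : realType) (X : ptopologicalType).
Hypothesis compactX : compact [set: X].
Local Notation B := (g_sigma_algebraType (@open X)).

Lemma continuous_integrable (mu : {finite_measure set B -> \bar R}) (f : X -> R) :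
  continuous f -> mu.-integrable [set: B] (EFin \o f).
Proof.
move=> fc; apply: measurable_bounded_integrable => //.
- by rewrite ltey_eq fin_num_measure.
- exact: cont_measurable.
- have [M M0 fM] := cont_bounded compactX fc.
  by exists M; split; [exact: num_real|move=> c Mc x _ /=; rewrite (le_trans (fM x))// ltW].
Qed.

Lemma finite_integral (mu : {finite_measure set B -> \bar R}) (f : X -> R) :
  continuous f -> (\int[mu]_(x in [set: B]) (f x)%:E = (\int[mu]_x f x)%:E)%E.
Proof.
by move=> fc; rewrite /Rintegral fineK//; apply: integrable_fin_num => //; exact: continuous_integrable.
Qed.

Section Charge.
Variable nu : {charge set B -> \bar R}.

Lemma charge_integralD (f g : X -> R) : continuous f -> continuous g ->
  charge_integral nu (fun x => f x + g x) = charge_integral nu f + charge_integral nu g.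
Proof.
move=> fc gc; rewrite /charge_integral !RintegralD//; try exact: continuous_integrable.
by lra.
Qed.

(** The variations of [nu] may differ from [mp] and [mm] by a common part. Moving terms across gives
    [charge_pos + mm = charge_neg + mp], an identity of positive measures that can be integrated. *)
Lemma charge_integral_difference (mp mm : {finite_measure set B -> \bar R}) (f : X -> R) :
  (forall A, measurable A -> nu A = (mp A - mm A)%E) ->
  continuous f -> (forall x, 0 <= f x) ->
  charge_integral nu f = \int[mp]_x f x - \int[mm]_x f x.
Proof.
move=> nuE fc f0.
have mf : measurable_fun [set: B] (fun x => (f x)%:E).
  by apply/measurable_EFinP; exact: cont_measurable.
have : (\int[measure_add (charge_pos nu) mm]_x (f x)%:E =
    \int[measure_add (charge_neg nu) mp]_x (f x)%:E)%E.
  apply: eq_measure_integral => A mA _.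
  suff : (charge_pos nu A + mm A = charge_neg nu A + mp A)%E.
    by move=> h; rewrite [LHS](measure_addE (charge_pos nu)) [RHS](measure_addE (charge_neg nu)).
  have := nuE A mA; rewrite (jordan_decomp (projT2 (cid (Hahn_pair nu))) mA).
  rewrite /cadd/= /cscale/= mulN1e -/(charge_pos nu) -/(charge_neg nu).
  rewrite -(@fineK _ (charge_pos nu A)) ?fin_num_measure//.
  rewrite -(@fineK _ (charge_neg nu A)) ?fin_num_measure//.
  rewrite -(@fineK _ (mp A)) ?fin_num_measure// -(@fineK _ (mm A)) ?fin_num_measure//.
  by rewrite -!EFinB -!EFinD => -[h]; congr EFin; lra.
rewrite !ge0_integral_measure_add//; try by move=> x _; rewrite lee_fin.
rewrite !finite_integral// -!EFinD => -[].
by rewrite /charge_integral; lra.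
Qed.

End Charge.

Hypothesis open_pos : forall U : set X, open U ->
  exists2 g : X -> R, continuous g /\ (forall x, 0 <= g x) & U = [set x | 0 < g x].

(** Each variation is approximated within [e / 2]; the union of the inner sets and the intersection
    of the outer ones serve both. *)
Lemma charge_regular (nu : {charge set B -> \bar R}) (A : set B) (e : R) :
  measurable A -> 0 < e -> exists K U : set X,
    [/\ compact K, open U, K `<=` A, A `<=` U & (charge_tv nu (U `\` K) < e%:E)%E].
Proof.
move=> mA e0; have e2 : 0 < e / 2 by rewrite divr_gt0.
pose np : {finite_measure set B -> \bar R} := charge_pos nu.
pose nn : {finite_measure set B -> \bar R} := charge_neg nu.
have [K1 [U1 [cK1 oU1 K1A AU1 h1]]] := borel_regular open_pos np mA e2.
have [K2 [U2 [cK2 oU2 K2A AU2 h2]]] := borel_regular open_pos nn mA e2.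
exists (K1 `|` K2), (U1 `&` U2); split.
- by apply: (@subclosed_compact _ _ setT) => //; exact: closedU.
- exact: openI.
- by move=> x [/K1A|/K2A].
- by move=> x Ax; split; [exact: AU1|exact: AU2].
have mD (U K : set X) : open U -> closed K -> measurable (U `\` K : set B).
  by move=> oU cK; apply: measurableD; [exact: borel_open|exact: borel_closed].
rewrite /charge_tv /charge_variation/= [e]splitr EFinD lteD//.
  apply: (le_lt_trans _ h1); apply: (@le_measure _ _ _ np); rewrite ?inE.
  - by apply: mD; [exact: openI|exact: closedU].
  - exact: mD.
  - by move=> x [[? ?] /not_orP[]].
apply: (le_lt_trans _ h2); apply: (@le_measure _ _ _ nn); rewrite ?inE.
- by apply: mD; [exact: openI|exact: closedU].
- exact: mD.
- by move=> x [[? ?] /not_orP[]].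
Qed.

End ContinuousIntegral.

Section Representation.
Variables (R : realType) (n m : nat).
Local Notation S := (sphere R n).
Local Notation SB := (star_body R n).
Local Notation B := (borel_sphere R n).

Lemma functional_measure (T : SB -> R) : additive_homogeneous T -> (forall L, 0 <= T L) ->
  exists mu : {finite_measure set B -> \bar R},
    forall L : SB, (\int[mu]_(x in [set: B]) (radial L x)%:E = (T L)%:E)%E.
Proof.
move=> Tah T0.
have [|||mu muE] := @riesz_markov R (sphere R n) (lin T) (@sphere_compact R n)
  (@sphere_open_pos R n).
- by move=> f g; exact: linD.
- by move=> a f; exact: linZ.
- by move=> f fc f0; rewrite -lin_body.
exists mu => L; rewrite muE ?lin_radial//; first exact: radial_continuous.
exact: radial_ge0.
Qed.

Lemma functional_charge (T : SB -> R) C : additive_homogeneous T -> ball_bounded T C ->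
  exists nu : {charge set B -> \bar R},
    forall f : S -> R, continuous f -> (forall u, 0 <= f u) ->
    T (body_of f) = charge_integral nu f.
Proof.
move=> Tah TC; have [Tp [Tm [Tpah Tmah Tp0 Tm0 TE]]] := functional_jordan Tah TC.
have [mp mpE] := functional_measure Tpah Tp0.
have [mm mmE] := functional_measure Tmah Tm0.
exists (cadd (charge_of_finite_measure mp) (copp (charge_of_finite_measure mm))).
move=> f fc f0; rewrite (@charge_integral_difference _ _ (@sphere_compact R n) _ mp mm)//.
have fE : f = radial (body_of f) by apply/funext => u; rewrite radial_body_of_ge0.
by rewrite TE [in RHS]fE /Rintegral mpE mmE.
Qed.

Variable F : ('I_m -> SB) -> R.

Lemma represented_symmetric : represented_by_measure F -> symmetric_function F.
Proof.
move=> [nu [_ FE]] s Ls; rewrite !FE; congr charge_integral; apply/funext => u.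
by rewrite [RHS](reindex_inj (@perm_inj _ s)).
Qed.

Lemma represented_orthogonal : (0 < m)%N -> represented_by_measure F ->
  orthogonally_additive (associated_polynomial F).
Proof.
move=> m0 [nu [_ FE]] L M /disjoint_radial LM; rewrite /associated_polynomial !FE.
rewrite -charge_integralD; [|exact: sphere_compact|apply: cont_prod|apply: cont_prod];
  try by move=> *; exact: radial_continuous.
congr charge_integral; apply/funext => u; rewrite !prodr_const card_ord radial_sumE.
have /eqP := LM u; rewrite mulf_eq0 => /orP[] /eqP ->.
  (* Here [m > 0] gives [0 ^+ m = 0]. *)
  by rewrite add0r expr0n gtn_eqF// add0r.
by rewrite addr0 expr0n gtn_eqF// addr0.
Qed.

Hypothesis F_add : separately_additive F.
Hypothesis F_hom : positively_homogeneous F.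
Hypothesis F_bd : separately_bounded F.

Lemma vanishes_represented : (0 < m)%N -> vanishes_on_disjoint F -> represented_by_measure F.
Proof.
move=> m0 F_disj; pose i0 := Ordinal m0.
have Tah := slice_additive_homogeneous F_add F_hom (fun=> body_of (fun=> 1)) i0.
have [C TC] := slice_bounded F_bd (fun=> body_of (fun=> 1)) i0.
have [nu nuE] := functional_charge Tah TC.
exists nu; split.
  by move=> A e; apply: charge_regular; [exact: sphere_compact|exact: sphere_open_pos].
move=> Ls; rewrite (product_formula F_add F_hom F_bd F_disj i0) nuE//.
  by apply: cont_prod => i _; exact: radial_continuous.
by move=> u; rewrite prodr_ge0// => i _; exact: radial_ge0.
Qed.

End Representation.

(** * Rotation-invariant functionals *)

Section Rotations.
Variable R : realType.

(** The matrix determinant lemma: one block matrix factors both as lower times upper and as upper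
    times lower triangular. *)
Lemma det_rank1 n (c : 'cV[R]_n) (r : 'rV[R]_n) : \det (1%:M + c *m r) = 1 + (r *m c) 0 0.
Proof.
pose M : 'M[R]_(1 + n) := block_mx 1%:M (- r) c 1%:M.
have M1 : M = block_mx 1%:M 0 c 1%:M *m block_mx 1%:M (- r) 0 (1%:M + c *m r).
  rewrite mulmx_block !(mul1mx, mulmx1, mul0mx, mulmx0, addr0) mulmxN.
  by rewrite addrCA addNr addr0.
have M2 : M = block_mx 1%:M (- r) 0 1%:M *m block_mx (1%:M + r *m c) 0 c 1%:M.
  rewrite mulmx_block !(mul1mx, mulmx1, mul0mx, mulmx0, add0r) mulNmx.
  by rewrite addrK.
have := congr1 determinant (etrans (esym M1) M2).
rewrite !det_mulmx !det_lblock !det_ublock !det1 !mul1r !mulr1 => ->.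
by rewrite det_mx11 !mxE eqxx.
Qed.

Variable n : nat.
Local Notation V := 'rV[R]_n.+1.
Implicit Types u v w : V.

Definition dot u v : R := (u *m v^T) 0 0.

Lemma dotE u v : dot u v = \sum_i u 0 i * v 0 i.
Proof. by rewrite /dot mxE; apply: eq_bigr => i _; rewrite mxE. Qed.

Lemma dotC u v : dot u v = dot v u.
Proof. by rewrite !dotE; apply: eq_bigr => i _; rewrite mulrC. Qed.

Lemma dot_mx u v : u *m v^T = (dot u v)%:M.
Proof. by apply/matrixP => i j; rewrite !ord1 !mxE eqxx mulr1n /dot mxE. Qed.

Lemma dotBl u v w : dot (u - v) w = dot u w - dot v w.
Proof. by rewrite /dot mulmxBl !mxE. Qed.

Lemma dotBr u v w : dot w (u - v) = dot w u - dot w v.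
Proof. by rewrite !(dotC w) dotBl. Qed.

Lemma enorm_dot u : enorm u = Num.sqrt (dot u u).
Proof. by rewrite /enorm dotE; congr Num.sqrt; apply: eq_bigr => i _; rewrite expr2. Qed.

Lemma dot_ge0 u : 0 <= dot u u.
Proof. by rewrite dotE sumr_ge0// => i _; rewrite -expr2 sqr_ge0. Qed.

Lemma dot_eq0 u : (dot u u == 0) = (u == 0).
Proof.
apply/eqP/eqP => [u0|->]; last by rewrite /dot mul0mx mxE.
by apply: enorm_eq0; rewrite enorm_dot u0 sqrtr0.
Qed.

Lemma enorm1_dot u : enorm u = 1 -> dot u u = 1.
Proof. by rewrite enorm_dot => /(congr1 (fun x => x ^+ 2)); rewrite sqr_sqrtr ?dot_ge0// expr1n. Qed.

Definition householder w : 'M[R]_n.+1 := 1%:M - (2 / dot w w) *: (w^T *m w).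

Lemma householder_mul w x : x *m householder w = x - (2 / dot w w * dot x w) *: w.
Proof.
rewrite /householder mulmxBr mulmx1 -scalemxAr mulmxA dot_mx mul_scalar_mx scalerA.
by [].
Qed.

Lemma householder_tr w : (householder w)^T = householder w.
Proof. by rewrite /householder linearB/= trmx1 linearZ/= trmx_mul trmxK. Qed.

Lemma householder_orth w : w != 0 -> householder w *m (householder w)^T = 1%:M.
Proof.
move=> w0; have d0 : dot w w != 0 by rewrite dot_eq0.
rewrite householder_tr; apply/row_matrixP => i; rewrite row_mul.
set x := row i _; have -> : x = delta_mx 0 i *m householder w by rewrite -rowE.
rewrite householder_mul householder_mul.
have dotZl (a : R) u v : dot (a *: u) v = a * dot u v by rewrite /dot -scalemxAl mxE.
rewrite dotBl dotZl row1; set e := delta_mx _ _; set a := 2 / _ * dot e w.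
have -> : 2 / dot w w * (dot e w - a * dot w w) = - a by rewrite /a; field.
by rewrite scaleNr opprK subrK.
Qed.

Lemma householder_det w : w != 0 -> \det (householder w) = -1.
Proof.
move=> w0; have d0 : dot w w != 0 by rewrite dot_eq0.
rewrite /householder -scaleN1r scalerA scalemxAl det_rank1 -scalemxAr mxE -/(dot w w).
by field.
Qed.

Lemma householder_swap u v : enorm u = 1 -> enorm v = 1 -> u != v ->
  u *m householder (u - v) = v.
Proof.
move=> /enorm1_dot u1 /enorm1_dot v1 uv; rewrite householder_mul.
have d0 : dot (u - v) (u - v) != 0 by rewrite dot_eq0 subr_eq0.
have E : dot (u - v) (u - v) = 2 * dot u (u - v).
  by rewrite dotBl !dotBr u1 v1 (dotC v u); ring.
have d1 : dot u (u - v) != 0 by move: d0; rewrite E mulf_eq0 negb_or => /andP[].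
have -> : 2 / dot (u - v) (u - v) * dot u (u - v) = 1 by rewrite E; field.
by rewrite scale1r subKr.
Qed.

Lemma householder_fix v w : dot v w = 0 -> v *m householder w = v.
Proof. by move=> vw; rewrite householder_mul vw mulr0 scale0r subr0. Qed.

Lemma exists_orthogonal v : (0 < n)%N -> exists2 w, w != 0 & dot v w = 0.
Proof.
move=> n0; pose i1 : 'I_n.+1 := Ordinal (n0 : (1 < n.+1)%N).
have i10 : i1 != 0 by [].
have dotd (i : 'I_n.+1) : dot v (delta_mx 0 i) = v 0 i.
  rewrite dotE (bigD1 i)//= big1 ?addr0 ?mxE ?eqxx ?mulr1// => j ji.
  by rewrite mxE (negPf ji) andbF mulr0.
have [v0|v0] := eqVneq (v 0 0) 0.
  exists (delta_mx 0 0); last by rewrite dotd.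
  by apply/eqP => /matrixP/(_ 0 0)/eqP; rewrite !mxE eqxx oner_eq0.
exists (v 0 i1 *: delta_mx 0 0 - v 0 0 *: delta_mx 0 i1).
  apply/eqP => /matrixP/(_ 0 i1)/eqP; rewrite !mxE !eqxx/= ?(negPf i10) mulr0 sub0r mulr1.
  by rewrite oppr_eq0 (negPf v0).
have dotZr (a : R) w : dot v (a *: w) = a * dot v w by rewrite dotC /dot -scalemxAl mxE -/(dot w v) dotC.
by rewrite dotBr !dotZr !dotd mulrC subrr.
Qed.

(** The reflection exchanging [u] and [v] has determinant -1. A second reflection along some [w]
    orthogonal to [v] fixes [v] and restores determinant 1; such a [w] needs dimension at least
    2. *)
Lemma rotation_transitive (u v : sphere R n) : (0 < n)%N ->
  exists2 A : 'M[R]_n.+1, is_rotation A & \val u *m A = \val v.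
Proof.
move=> n0; have u1 := sphere1 u; have v1 := sphere1 v.
have [uv|uv] := eqVneq (\val u) (\val v).
  by exists 1%:M; [split; rewrite ?trmx1 ?mulmx1 ?det1|rewrite mulmx1].
have [w w0 vw] := exists_orthogonal (\val v) n0.
exists (householder (\val u - \val v) *m householder w).
  have uv0 : \val u - \val v != 0 by rewrite subr_eq0.
  split; last by rewrite det_mulmx !householder_det// mulrNN mulr1.
  by rewrite trmx_mul mulmxA -(mulmxA _ (householder w)) householder_orth// mulmx1 householder_orth.
by rewrite mulmxA householder_swap// householder_fix.
Qed.

End Rotations.

(** * Finite averages over rotations *)

Section Averaging.
Variables (R : realType) (n : nat).
Local Notation S := (sphere R n).
Local Notation SB := (star_body R n).
Implicit Types (u v : S) (f g : S -> R).

Lemma enorm_triangle (x y : 'rV[R]_n.+1) : enorm (x + y) <= enorm x + enorm y.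
Proof.
rewrite -(@ler_pXn2r _ 2)// ?nnegrE ?addr_ge0 ?enorm_ge0// sqrrD.
rewrite !enorm_dot !sqr_sqrtr ?dot_ge0//.
have E : dot (x + y) (x + y) = dot x x + dot x y *+ 2 + dot y y.
  have dotDl z : dot (x + y) z = dot x z + dot y z by rewrite /dot mulmxDl mxE.
  by rewrite dotDl (dotC x) (dotC y) !dotDl (dotC y x); ring.
rewrite E lerD2r lerD2l lerMn2r/= -sqrtrM ?dot_ge0//.
apply: le_trans (ler_norm _) _; rewrite -sqrtr_sqr ler_wsqrtr//.
(* Cauchy-Schwarz from the discriminant at the minimizer *)
have [y0|y0] := eqVneq (dot y y) 0.
  have -> : y = 0 by apply/eqP; rewrite -dot_eq0 y0.
  by rewrite (dotC x) /dot !mul0mx [in leLHS]mxE [X in _ * X]mxE expr0n mulr0.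
have yp : 0 < dot y y by rewrite lt_neqAle eq_sym y0 dot_ge0.
have := dot_ge0 (dot y y *: x - dot x y *: y).
have dotZl (a : R) (u v : 'rV[R]_n.+1) : dot (a *: u) v = a * dot u v by rewrite /dot -scalemxAl mxE.
have dotZr (a : R) (u v : 'rV[R]_n.+1) : dot u (a *: v) = a * dot u v by rewrite dotC dotZl dotC.
rewrite dotBl !dotBr !dotZl !dotZr (dotC y x) => h.
have : 0 <= dot y y * (dot x x * dot y y - dot x y ^+ 2) by move: h; nra.
by rewrite pmulr_rge0// subr_ge0.
Qed.

Definition sdist u v : R := enorm (\val u - \val v).

Lemma sdistxx u : sdist u u = 0.
Proof. by rewrite /sdist subrr -(scale0r 0) enormZ normr0 mul0r. Qed.

Lemma sdist_triangle v u w : sdist u w <= sdist u v + sdist v w.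
Proof. by rewrite /sdist -{1}(subrKA (\val v) (\val u)) enorm_triangle. Qed.

Lemma sphere_ball_open u (r : R) : open [set v : S | sdist v u < r].
Proof.
apply: cont_open_lt; last exact: cont_cst.
move=> v; apply: (@continuous_comp _ _ _ (fun v : S => \val v - \val u) (@enorm R n.+1)).
  apply: (@continuousB _ _ _ (fun v : S => \val v) (fun=> \val u)).
    exact: sphere_val_continuous.
  exact: cst_continuous.
exact: enorm_continuous.
Qed.

Lemma sphere_nbhs u (P : set S) : nbhs u P ->
  exists2 r : R, 0 < r & forall v, sdist v u < r -> P v.
Proof.
rewrite nbhsE => -[_ [[W oW <-] Wu] sP].
have /nbhs_ballP[r /= r0 rW] := open_nbhs_nbhs (conj oW Wu).
exists r => // v vu; apply: sP; apply: rW; rewrite -ball_normE /ball_/=.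
by rewrite distrC (le_lt_trans (mx_norm_le_enorm _)).
Qed.

(** Lebesgue number argument: [O k] collects the centres of balls of radius larger than
    [1 / (k + 1)] on which [f] oscillates by at most [e]. The strict inequality makes [O k] open. *)
Lemma sphere_uniform_continuity f (e : R) : continuous f -> 0 < e ->
  exists2 d : R, 0 < d & forall u v, sdist u v < d -> `|f u - f v| <= e.
Proof.
move=> fc e0.
pose O (k : nat) : set S := [set x | exists2 r : R, k.+1%:R^-1 < r &
  forall v w, sdist v x < r -> sdist w x < r -> `|f v - f w| <= e].
have [|||k Ok] := @increasing_open_cover S (@sphere_compact R n) O.
- move=> k; rewrite openE => x [r kr xr]; rewrite /interior.
  have r0 : 0 < r - k.+1%:R^-1 by rewrite subr_gt0.
  apply: (@filterS _ (nbhs x) (nbhs_filter x)); last first.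
    apply: open_nbhs_nbhs; split; first exact: (sphere_ball_open x (r - k.+1%:R^-1)).
    by rewrite /= sdistxx.
  move=> y /= yx.
  exists (r - sdist y x); first by rewrite ltrBrDl -ltrBrDr.
  have tri v : sdist v y < r - sdist y x -> sdist v x < r.
    by have := sdist_triangle y v x; lra.
  by move=> v w /tri vx /tri wx; exact: xr.
- move=> k x [r kr xr]; exists r => //; apply: le_lt_trans kr.
  by rewrite lef_pV2 ?posrE// ler_nat.
- move=> x; have e2 : 0 < e / 2 by rewrite divr_gt0.
  have /(@cvgrPdist_lt _ _ _ (nbhs x) (nbhs_filter x))/(_ _ e2)/sphere_nbhs[r r0 xr] := fc x.
  exists (Num.bound r^-1), r.
    rewrite -[ltRHS]invrK ltf_pV2 ?posrE ?invr_gt0//.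
    by rewrite (lt_trans (archi_boundP _)) ?invr_ge0 ?ltW// ltr_nat.
  move=> v w /xr/= vx /xr/= wx; rewrite -(subrKA (f x)) addrC.
  rewrite (le_trans (ler_normD _ _))// distrC [X in _ + X]distrC.
  by rewrite distrC in wx; move: vx wx; rewrite (distrC (f w)); lra.
exists k.+1%:R^-1; first by rewrite invr_gt0.
move=> u v uv; have [r kr xr] : O k v by rewrite Ok.
apply: xr; first exact: lt_trans kr.
rewrite sdistxx; by apply: lt_trans kr; rewrite invr_gt0.
Qed.

Lemma sphere_net (d : R) : 0 < d -> exists N (p : 'I_N.+1 -> S),
  forall u, exists i, sdist u (p i) < d.
Proof.
move=> d0; have := @sphere_compact R n; rewrite compact_cover => cX.
have [|D _ Dcov] := cX S setT (fun p : S => [set v : S | sdist v p < d])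
    (fun p _ => sphere_ball_open p d).
  by move=> u _; exists u => //=; rewrite sdistxx.
pose s := finmap.enum_fset D.
(* The list is padded with the default [point], so that averages over the net have a nonzero number
   of terms. *)
exists (size s), (fun i => nth point s i) => u.
have [p pD up] := Dcov u I.
have ps : (index p s < size s)%N by rewrite index_mem.
by exists (Ordinal (ltnW ps : (index p s < (size s).+1)%N)); rewrite /= nth_index.
Qed.

Record rotation := Rotation { rot_mx :> 'M[R]_n.+1; rotP : is_rotation rot_mx }.

Definition rot (A : rotation) u : S := rotate_sphere (proj1 (rotP A)) u.

(** Averages are iterated, so bounds, moduli of continuity and values of invariant functionals pass
    to the hull by induction. *)
Inductive hull f : (S -> R) -> Prop :=
| hull_self : hull f f
| hull_avg g N (A : 'I_N.+1 -> rotation) : hull f g ->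
    hull f (fun u => N.+1%:R^-1 * \sum_i g (rot (A i) u)).

Lemma hull_continuous f g : continuous f -> hull f g -> continuous g.
Proof.
move=> fc; elim=> // h N A _ hc; apply: contZ; apply: cont_sum => i _ u.
by apply: (@continuous_comp _ _ _ (rot (A i)) h); [exact: rotate_sphere_continuous|exact: hc].
Qed.

Lemma avg_bound (N : nat) (x : 'I_N.+1 -> R) c : (forall i, `|x i| <= c) ->
  `|N.+1%:R^-1 * \sum_i x i| <= c.
Proof.
move=> xc; rewrite normrM ger0_norm ?invr_ge0// mulrC ler_pdivrMr//.
apply: (le_trans (ler_norm_sum _ _ _)); apply: (le_trans (ler_sum _ (fun i _ => xc i))).
by rewrite sumr_const card_ord mulr_natr.
Qed.

Lemma rot_dist A u v : sdist (rot A u) (rot A v) = sdist u v.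
Proof. by rewrite /sdist /rot/= -mulmxBl enorm_mulmx//; exact: (proj1 (rotP A)). Qed.

(** Rotations are isometries, so the [d] found for [f] serves the whole hull; one finite net can be
    fixed before [g] is chosen. *)
Lemma hull_modulus f g (d e : R) :
  (forall u v, sdist u v < d -> `|f u - f v| <= e) -> hull f g ->
  forall u v, sdist u v < d -> `|g u - g v| <= e.
Proof.
move=> fd; elim=> // h N A _ hd u v uv.
by rewrite -mulrBr -sumrB; apply: avg_bound => i; apply: hd; rewrite rot_dist.
Qed.

Lemma hull_bounded f g c : (forall u, `|f u| <= c) -> hull f g -> forall u, `|g u| <= c.
Proof.
move=> fb; elim=> // h N A _ hb u.
exact: avg_bound.
Qed.

(* A nearly minimal upper bound in the hull forces the average over rotations
   bringing a net to the minimum point to improve it, unless g is almost constant. *)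
Lemma hull_small_oscillation f (e : R) : (0 < n)%N -> continuous f -> 0 < e ->
  exists g c, hull f g /\ forall u, `|g u - c| <= e.
Proof.
move=> n0 fc e0; have e2 : 0 < e / 2 by rewrite divr_gt0.
have [d d0 fd] := sphere_uniform_continuity fc e2.
have [N [p pnet]] := sphere_net d0.
have [M M0 fM] := cont_bounded (@sphere_compact R n) fc.
pose C := [set c : R | exists2 g, hull f g & forall u, g u <= c].
have C0 : C M by exists f; [exact: hull_self|move=> u; exact: le_trans (ler_norm _) (fM u)].
have Clb : has_lbound C.
  exists (- M) => c [g fg gc]; apply: le_trans (gc point).
  by have := hull_bounded fM fg point; rewrite ler_norml => /andP[].
(* At each point only one of the [N + 1] rotated copies is known to improve, so its gain is divided
   by [N + 1]; near-minimality is measured on that scale. *)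
have eta0 : 0 < e / 2 / N.+1%:R by rewrite divr_gt0.
have [|c [g fg gc] cinf] := @inf_adherent _ C _ eta0.
  by split => //; exists M.
have gcont := hull_continuous fc fg.
have [||x0 _ x0min] := @compact_EVT_min S R g setT _ (@sphere_compact R n).
- by exists point.
- by apply: continuous_subspaceT; exact: gcont.
have {}x0min u : g x0 <= g u by apply: x0min; rewrite inE.
have /(_ _)/cid - /all_sig[A AE] := fun i => 
  let: ex_intro2 A hA E := rotation_transitive (p i) x0 n0 in
  ex_intro (fun A : rotation => \val (p i) *m A = \val x0) (Rotation hA) E.
pose h u := N.+1%:R^-1 * \sum_i g (rot (A i) u).
have fh : hull f h by exact: hull_avg.
(* The rotation attached to a net point near [u] brings [u] near [x0], so that copy of [g] is at
   most [g x0 + e / 2]; the others are at most [c]. *)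
have hle u : h u <= N.+1%:R^-1 * (N%:R * c + (g x0 + e / 2)).
  rewrite ler_pM2l ?invr_gt0//; have [i ui] := pnet u.
  rewrite (bigD1 i)//= addrC lerD//.
    apply: (@le_trans _ _ (\sum_(j < N.+1 | j != i) c)); first by apply: ler_sum => j _; exact: gc.
    by rewrite sumr_const cardC1 card_ord/= mulr_natl.
  have Ex : rot (A i) (p i) = x0 by apply: val_inj; exact: AE.
  have := hull_modulus fd fg (u := rot (A i) u) (v := rot (A i) (p i)).
  by rewrite rot_dist Ex => /(_ ui); rewrite ler_norml => /andP[_]; lra.
have infle : inf C <= N.+1%:R^-1 * (N%:R * c + (g x0 + e / 2)).
  by apply: ge_inf => //; exists h.
exists g, (g x0); split => // u; rewrite ger0_norm ?subr_ge0//.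
have gcu := gc u; have h2 : (c - inf C) * N.+1%:R < e / 2.
  by rewrite -ltr_pdivlMr// ltrBlDl.
by move: infle h2; rewrite ler_pdivlMl// -natr1; lra.
Qed.

Lemma is_rotation_tr (A : 'M[R]_n.+1) : is_rotation A -> is_rotation A^T.
Proof. by move=> hA; split; [exact: rotation_tr|rewrite det_tr; exact: (proj2 hA)]. Qed.

Section InvariantFunctional.
Variables (T : SB -> R) (C : R).
Hypothesis Tah : additive_homogeneous T.
Hypothesis TC : ball_bounded T C.
Hypothesis T_rot : forall (A : 'M[R]_n.+1) (hA : is_rotation A) L, T (rotate hA L) = T L.

Lemma cont_rot f (A : rotation) : continuous f -> continuous (fun u => f (rot A u)).
Proof.
move=> fc u; apply: (@continuous_comp _ _ _ (rot A) f); last exact: fc.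
exact: rotate_sphere_continuous.
Qed.

(** Composing with [A] rotates the body by the inverse [A^T], because [radial_rotate] evaluates at
    the inverse rotation. *)
Lemma lin_rot f (A : rotation) : continuous f -> lin T (fun u => f (rot A u)) = lin T f.
Proof.
move=> fc.
rewrite /lin -(T_rot (is_rotation_tr (rotP A)) (body_of f)).
rewrite -(T_rot (is_rotation_tr (rotP A)) (body_of (fun u => - f u))).
have E g : continuous g -> body_of (fun u => g (rot A u)) =
    rotate (is_rotation_tr (rotP A)) (body_of g).
  move=> gc; apply: radial_inj => u; rewrite radial_rotate !radial_body_of//; last exact: cont_rot.
  congr (Num.max 0 (g _)); apply: val_inj; rewrite /rot/=.
  by rewrite trmxK.
by rewrite -!E//; exact: contN.
Qed.

Lemma lin_hull f g : continuous f -> hull f g -> lin T g = lin T f.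
Proof.
move=> fc; elim=> // h N A fh ih; have hc := hull_continuous fc fh.
rewrite (linZ Tah); last by apply: cont_sum => i _; exact: cont_rot.
rewrite (@lin_sum _ _ _ Tah _ _ _ (fun i u => h (rot (A i) u))); last by move=> i; exact: cont_rot.
under eq_bigr do rewrite lin_rot// ih.
by rewrite sumr_const card_ord -[X in _ * X]mulr_natl mulKf// pnatr_eq0.
Qed.

Lemma invariant_approx f g (c e : R) : continuous f -> hull f g ->
  (forall u, `|g u - c| <= e) -> `|lin T f - c * T (body_of (fun=> 1))| <= 2 * C * e.
Proof.
move=> fc fg gc; have gcont := hull_continuous fc fg.
have c1 (a : R) : continuous (fun _ : S => a) by exact: cont_cst.
have := lin_bounded Tah TC (contB gcont (c1 c)) gc.
rewrite (linB Tah)// (lin_hull fc fg); congr (`|_ - _| <= _).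
rewrite (lin_body Tah)// -(linZ Tah)//; congr lin; apply/funext => u.
by rewrite mulr1.
Qed.

End InvariantFunctional.

(** The hull of [radial L] does not involve the functional, so the same nearly constant [g] and
    constant [c] serve [T] and [J]. Cross-multiplication eliminates [c] without dividing. *)
Lemma rotation_invariant_unique (T J : SB -> R) (CT CJ : R) : (0 < n)%N ->
  additive_homogeneous T -> ball_bounded T CT ->
  (forall (A : 'M[R]_n.+1) (hA : is_rotation A) L, T (rotate hA L) = T L) ->
  additive_homogeneous J -> ball_bounded J CJ ->
  (forall (A : 'M[R]_n.+1) (hA : is_rotation A) L, J (rotate hA L) = J L) ->
  forall L, T L * J (body_of (fun=> 1)) = J L * T (body_of (fun=> 1)).
Proof.
move=> n0 Tah TC Trot Jah JC Jrot L.
set J1 := J _; set T1 := T (body_of _).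
have CT0 := bounded_ge0 TC; have CJ0 := bounded_ge0 JC.
apply/eqP; rewrite -subr_eq0 -normr_le0; apply/ler_addgt0Pr => e e0; rewrite add0r.
pose K := 2 * CT * `|J1| + 2 * CJ * `|T1|.
have K0 : 0 <= K by rewrite addr_ge0// !mulr_ge0.
have d0 : 0 < e / (K + 1) by rewrite divr_gt0//; lra.
have dE : K * (e / (K + 1)) <= e.
  by rewrite mulrCA -{2}[e]mulr1 ler_pM2l// ler_pdivrMr; lra.
set d := e / _ in d0 dE; apply: le_trans dE.
have Lc := radial_continuous (L := L).
have [g [c [Lg gc]]] := hull_small_oscillation n0 Lc d0.
have hT := invariant_approx Tah TC Trot Lc Lg gc.
have hJ := invariant_approx Jah JC Jrot Lc Lg gc.
rewrite (lin_radial Tah) -/T1 in hT; rewrite (lin_radial Jah) -/J1 in hJ.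
have -> : T L * J1 - J L * T1 = (T L - c * T1) * J1 - (J L - c * J1) * T1 by ring.
apply: (le_trans (ler_normB _ _)); rewrite !normrM /K mulrDl lerD//.
  by rewrite mulrAC ler_wpM2r.
by rewrite mulrAC ler_wpM2r.
Qed.

End Averaging.

(** * Rotation invariance of spherical Lebesgue measure *)

Section LebesgueTranslation.
Variable R : realType.
Local Open Scope ereal_scope.

Lemma measurable_addr (a : R) :
  measurable_fun setT ((fun x => x + a)%R : measurableTypeR R -> measurableTypeR R).
Proof. by apply: measurable_funD => //; exact: measurable_id. Qed.

Lemma lebesgue_measure_translation (a : R) (A : set (measurableTypeR R)) : measurable A ->
  pushforward (@lebesgue_measure R) ((fun x => x + a)%R : _ -> measurableTypeR R) A =
  lebesgue_measure A.
Proof.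
move=> mA; apply/esym/lebesgue_measure_unique => //=; first exact: measurable_addr.
move=> _ _ [[b c] _ <-]; rewrite /pushforward.
rewrite (_ : _ @^-1` _ = `](b - a)%R, (c - a)%R]%classic); last first.
  by apply/seteqP; split => x /=; rewrite !in_itv/= ltrBlDr lerBrDr.
by rewrite !lebesgue_measure_itv/= !lte_fin ltrD2r -!EFinB; case: ifP => // _; congr EFin; lra.
Qed.

Lemma lebesgue_integral_translation (a : R) (g : R -> \bar R) :
  measurable_fun setT g -> (forall x, 0 <= g x) ->
  \int[@lebesgue_measure R]_x g (x + a)%R = \int[@lebesgue_measure R]_x g x.
Proof.
move=> mg g0; have := @ge0_integral_pushforward _ _ _ _ R _ (measurable_addr a)
  (@lebesgue_measure R) setT g measurableT mg (fun x _ => g0 x).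
rewrite preimage_setT => <-; apply: eq_measure_integral => //; first exact: measurable_addr.
by move=> mf A mA _; exact: lebesgue_measure_translation.
Qed.

End LebesgueTranslation.

Section CoordinateSigmaAlgebra.
Variable R : realType.

Definition coordinate_sets d : set (set 'rV[R]_d) :=
  [set A | exists (i : 'I_d) (B : set R), measurable B /\ A = [set x : 'rV[R]_d | B (x 0 i)]].

(* The library puts no sigma-algebra on ['rV[R]_d]; this copy carries the Borel one. *)
Definition mrV d := g_sigma_algebraType (@coordinate_sets d).

Lemma measurable_coord d (i : 'I_d) : measurable_fun setT (fun x : mrV d => x 0 i).
Proof.
move=> _ B mB; rewrite setTI; apply: sub_sigma_algebra.
by exists i, B.
Qed.

Lemma measurable_to_mrV d' (T : measurableType d') d (f : T -> mrV d) :
  (forall i, measurable_fun setT (fun x => f x 0 i)) -> measurable_fun setT f.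
Proof.
move=> mf; apply: (@measurability _ _ T (mrV d) setT f (@coordinate_sets d)) => // _ [_ [i [B [mB ->]]] <-].
by have := mf i measurableT B mB.
Qed.

(** The same row as in the recursion of [lebesgue_rV], so that the image of the product measure
    unfolds to it. *)
Definition glue d (p : measurableTypeR R * mrV d) : mrV d.+1 :=
  (row_mx (const_mx p.1) p.2 : 'rV[R]_(1 + d)).

Lemma glue_lshift d p (j : 'I_1) : @glue d p 0 (lshift d j) = p.1.
Proof.
transitivity ((const_mx p.1 : 'rV[R]_1) 0 j); last by rewrite mxE.
exact: (@row_mxEl R 1 1 d (const_mx p.1) p.2 0 j).
Qed.

Lemma glue_rshift d p (j : 'I_d) : @glue d p 0 (rshift 1 j) = p.2 0 j.
Proof. exact: (@row_mxEr R 1 1 d (const_mx p.1) p.2 0 j). Qed.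

Lemma glueD d p (a : 'rV[R]_(1 + d)) : (glue p : 'rV[R]_d.+1) + a =
  glue (p.1 + a ord0 (lshift d ord0), (p.2 : 'rV[R]_d) + rsubmx a).
Proof.
apply/rowP => i; rewrite mxE; have [j ->|j ->] := split_ordP (i : 'I_(1 + d)).
  by rewrite !glue_lshift ord1.
by rewrite !glue_rshift !mxE.
Qed.

Lemma measurable_glue d : measurable_fun setT (@glue d).
Proof.
apply: measurable_to_mrV => i.
rewrite (_ : (fun p => glue p 0 i) = fun p : measurableTypeR R * mrV d =>
   match fintype.split (i : 'I_(1 + d)) with inl _ => p.1 | inr j => p.2 0 j end); last first.
  apply/funext => p; case: split_ordP => j ->; first exact: glue_lshift.
  exact: glue_rshift.
case: (fintype.split _) => j; first exact: measurable_fst.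
exact: (measurableT_comp (measurable_coord j) measurable_snd).
Qed.

Definition cube d (r : R) : set (mrV d) := [set x | forall i, `|x 0 i| <= r].

Lemma measurable_cube d r : measurable (@cube d r).
Proof.
rewrite (_ : cube r = \bigcap_(i in [set: 'I_d]) [set x : mrV d | x 0 i \in `[- r, r]]).
  apply: fin_bigcap_measurable => // i _; apply: sub_sigma_algebra.
  by exists i, `[- r, r]%classic; split => //; exact: measurable_itv.
apply/seteqP; split => x /=.
  by move=> xr i _ /=; rewrite in_itv/= -ler_norml.
by move=> xr i; have := xr i I; rewrite /= in_itv/= -ler_norml.
Qed.

Section Glued.
Variables (d : nat) (nu : {sigma_finite_measure set (mrV d) -> \bar R}).
Local Open Scope ereal_scope.

Definition glued_measure (A : set (mrV d.+1)) : \bar R :=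
  (@lebesgue_measure R \x nu) (@glue d @^-1` A).

Let measurable_preglue A : measurable A -> measurable (@glue d @^-1` A).
Proof. by move=> mA; rewrite -[X in measurable X]setTI; exact: measurable_glue. Qed.

Let glued0 : glued_measure set0 = 0.
Proof. by rewrite /glued_measure preimage_set0 measure0. Qed.

Let glued_ge0 A : 0 <= glued_measure A.
Proof. exact: measure_ge0. Qed.

Let glued_sigma_additive : semi_sigma_additive glued_measure.
Proof.
move=> F mF tF mUF; rewrite /glued_measure preimage_bigcup.
apply: measure_semi_sigma_additive.
- by move=> n; exact: measurable_preglue.
- apply/trivIsetP => /= i j _ _ ij; rewrite -preimage_setI.
  by move/trivIsetP : tF => /(_ _ _ _ _ ij) ->//; rewrite preimage_set0.
- by rewrite -preimage_bigcup; exact: measurable_preglue.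
Qed.

HB.instance Definition _ := isMeasure.Build _ _ _ glued_measure
  glued0 glued_ge0 glued_sigma_additive.

Lemma glued_cube (r : R) : (0 <= r)%R -> glued_measure (cube r) = (r *+ 2)%:E * nu (cube r).
Proof.
move=> r0; rewrite /glued_measure.
have -> : @glue d @^-1` cube r = `[(- r)%R, r]%classic `*` cube r.
  apply/seteqP; split => -[x y] /=.
    move=> H; split => [|j /=].
      have := H (lshift d ord0 : 'I_(1 + d)); rewrite glue_lshift.
      by rewrite in_itv/= -ler_norml.
    by have := H (rshift 1 j : 'I_(1 + d)); rewrite glue_rshift.
  move=> [xr yr] i; have [j ->|j ->] := split_ordP (i : 'I_(1 + d)).
    by rewrite glue_lshift; move: xr; rewrite in_itv/= -ler_norml.
  by rewrite glue_rshift; exact: yr.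
have E : lebesgue_measure (`[(- r)%R, r]%classic : set R) = (r *+ 2)%:E.
  rewrite lebesgue_measure_itv/= lte_fin; case: ltP => h.
    by rewrite -EFinD opprK mulr2n.
  have -> : r = 0%R by move: h r0; lra.
  by rewrite mul0rn.
rewrite -E; apply: product_measure1E; [exact: measurable_itv|exact: measurable_cube].
Qed.

Lemma glued_translation (a : 'rV[R]_d.+1) (A : set (mrV d.+1)) :
  (forall (a : 'rV[R]_d) (A : set (mrV d)), measurable A ->
     nu [set x : mrV d | A ((x : 'rV[R]_d) + a)%R] = nu A) ->
  measurable A -> glued_measure [set x | A ((x : 'rV[R]_d.+1) + a)%R] = glued_measure A.
Proof.
move=> nuT mA; have mgA := measurable_preglue mA.
pose a0 := (a : 'rV[R]_(1 + d)) ord0 (lshift d ord0); pose a' : 'rV[R]_d := rsubmx (a : 'rV[R]_(1 + d)).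
pose g (t : R) := nu (xsection (@glue d @^-1` A) t).
have mg : measurable_fun setT g by exact: measurable_fun_xsection.
transitivity (\int[@lebesgue_measure R]_t g (t + a0)%R); last first.
  by rewrite lebesgue_integral_translation.
apply: eq_integral => t _ /=; rewrite /g -(nuT a'); last exact: measurable_xsection.
by congr (nu _); apply/seteqP; split => y; rewrite /xsection/= !inE/= glueD.
Qed.

Lemma glued_sigma_finite : (forall r : R, nu (cube r) < +oo) -> sigma_finite setT glued_measure.
Proof.
move=> nuc; exists (fun k => cube k%:R).
  apply/esym/seteqP; split => // x _.
  exists (Num.bound (\sum_i `|x ord0 i|)%R) => // i.
  apply: (@le_trans _ _ (\sum_i `|x ord0 i|)%R); last first.
    by rewrite ltW// archi_boundP// sumr_ge0.
  by rewrite (bigD1 i)//= lerDl sumr_ge0.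
move=> k; split; first exact: measurable_cube.
by rewrite glued_cube// lte_mul_pinfty// lee_fin mulrn_wge0.
Qed.

End Glued.

(** The induction also carries the bounds on cubes: finiteness gives sigma-finiteness in the next
    dimension, and both bounds later normalize the uniqueness argument. *)
Lemma lebesgue_rV_measure d : exists nu : {sigma_finite_measure set (mrV d) -> \bar R},
  [/\ forall A, nu A = lebesgue_rV A,
    forall r : R, (0 < r)%R -> (0 < nu (cube r) < +oo)%E
  & forall (a : 'rV[R]_d) (A : set (mrV d)), measurable A ->
     nu [set x : mrV d | A ((x : 'rV[R]_d) + a)%R] = nu A].
Proof.
elim: d => [|d [nu [nuE nuc nuT]]].
  pose z : mrV 0 := (0 : 'rV[R]_0).
  exists (\d_ z); split => [//|r r0|a A mA].
    suff : (0 < @dirac _ (mrV 0) z R (cube r) < +oo)%E by [].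
    by rewrite diracE mem_set ?lte01 ?ltry// => -[].
  suff : @dirac _ (mrV 0) z R [set x | A ((x : 'rV[R]_0) + a)] =
    @dirac _ (mrV 0) z R A by [].
  have a0 : (0 : 'rV[R]_0) + a = 0 by apply/rowP => -[].
  by rewrite !diracE; congr (nat_of_bool _)%:R%:E; apply/idP/idP; rewrite !inE/= a0.
(* The induction hypothesis covers positive radii only; any cube sits in one of radius [|r| + 1]. *)
have nuc0 (r : R) : (nu (cube r) < +oo)%E.
  have r1 : (0 < `|r| + 1)%R by rewrite ltr_pwDr.
  have /andP[_] := nuc _ r1; apply: le_lt_trans.
  apply: le_measure; rewrite ?inE; [exact: measurable_cube|exact: measurable_cube|].
  move=> x xr i; rewrite (le_trans (xr i))//.
  by rewrite (le_trans (ler_norm _))// lerDl.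
have sf := glued_sigma_finite nuc0.
pose mu : {sigma_finite_measure set (mrV d.+1) -> \bar R} :=
  HB.pack (glued_measure nu) (Measure_isSigmaFinite.Build _ _ _ (glued_measure nu) sf).
exists mu; split => [A|r r0|a A mA].
- rewrite /mu/= /glued_measure/= /product_measure1; apply: eq_integral => x _ /=.
  rewrite nuE; congr lebesgue_rV; apply/seteqP; split => y; rewrite /xsection/= inE//.
- rewrite /mu/= glued_cube ?(ltW r0)//; have /andP[h1 h2] := nuc r r0.
  rewrite mule_gt0 ?lte_mul_pinfty//= ?lee_fin ?mulrn_wge0 ?lte_fin ?mulrn_wgt0 ?(ltW r0)//.
- exact: glued_translation.
Qed.

End CoordinateSigmaAlgebra.

(** * Uniqueness of translation-invariant measures and rotations *)

Section MeasurableVectors.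
Variables (R : realType) (d : nat).
Local Notation V := 'rV[R]_d.

Definition vadd (p : mrV R d * mrV R d) : mrV R d := (p.1 : V) + (p.2 : V).
Definition vsub (p : mrV R d * mrV R d) : mrV R d := (p.2 : V) - (p.1 : V).
Definition vmul (A : 'M[R]_d) (x : mrV R d) : mrV R d := (x : V) *m A.

Lemma measurable_coord_comp d' (T : measurableType d') (f : T -> mrV R d) i :
  measurable_fun setT f -> measurable_fun setT (fun x => (f x : V) 0 i).
Proof. by move=> mf; exact: (measurableT_comp (measurable_coord i) mf). Qed.

Lemma measurable_vadd : measurable_fun setT vadd.
Proof.
apply: measurable_to_mrV => i.
rewrite (_ : (fun x => vadd x 0 i) = fun x => (x.1 : V) 0 i + (x.2 : V) 0 i); last first.
  by apply/funext => x; rewrite /vadd mxE.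
apply: measurable_funD; apply: measurable_coord_comp; [exact: measurable_fst|exact: measurable_snd].
Qed.

Lemma measurable_vsub : measurable_fun setT vsub.
Proof.
apply: measurable_to_mrV => i.
rewrite (_ : (fun x => vsub x 0 i) = fun x => (x.2 : V) 0 i - (x.1 : V) 0 i); last first.
  by apply/funext => x; rewrite /vsub !mxE.
apply: measurable_funB; apply: measurable_coord_comp; [exact: measurable_snd|exact: measurable_fst].
Qed.

Lemma measurable_vmul A : measurable_fun setT (vmul A).
Proof.
apply: measurable_to_mrV => i.
rewrite (_ : (fun x => vmul A x 0 i) = fun x => \sum_j (x : V) 0 j * A j i); last first.
  by apply/funext => x; rewrite /vmul mxE.
apply: measurable_sum => j; apply: measurable_funM; first exact: measurable_coord.
exact: measurable_cst.
Qed.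

Definition eball (r : R) : set (mrV R d) := [set x | enorm (x : V) <= r].

Lemma measurable_eball r : 0 <= r -> measurable (eball r).
Proof.
move=> r0; rewrite (_ : eball r = (fun x : mrV R d => \sum_i (x : V) 0 i ^+ 2) @^-1` `]-oo, r ^+ 2]).
  rewrite -[X in measurable X]setTI.
  suff mf : measurable_fun setT (fun x : mrV R d => \sum_i (x : V) 0 i ^+ 2).
    by apply: mf => //; exact: measurable_itv.
  by apply: measurable_sum => i; apply: measurable_funX; exact: measurable_coord.
apply/seteqP; split => x; rewrite /eball /= in_itv/= /enorm.
  have s0 : 0 <= \sum_i (x : V) 0 i ^+ 2 by rewrite sumr_ge0// => i _; rewrite sqr_ge0.
  by move=> h; rewrite -[leLHS]sqr_sqrtr// ler_pXn2r// nnegrE sqrtr_ge0.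
by move=> h; rewrite -(ger0_norm r0) -sqrtr_sqr ler_wsqrtr.
Qed.

Lemma measurable_preimageT d1 d2 (T1 : measurableType d1) (T2 : measurableType d2)
    (f : T1 -> T2) (A : set T2) :
  measurable_fun setT f -> measurable A -> measurable (f @^-1` A).
Proof. by move=> mf mA; rewrite -[X in measurable X]setTI; exact: mf. Qed.

Section HaarUniqueness.
Local Open Scope ereal_scope.

Definition translation_invariant (nu : set (mrV R d) -> \bar R) :=
  forall (a : V) (A : set (mrV R d)), measurable A ->
    nu [set x : mrV R d | A ((x : V) + a)%R] = nu A.

Variables nu mu : {sigma_finite_measure set (mrV R d) -> \bar R}.
Hypothesis nuT : translation_invariant nu.
Hypothesis muT : translation_invariant mu.

Lemma tonelli_sections (D : set (mrV R d * mrV R d)) : measurable D ->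
  \int[nu]_x mu (xsection D x) = \int[mu]_y nu (ysection D y).
Proof.
move=> mD; have := indic_fubini_tonelli nu mu mD.
by rewrite indic_fubini_tonelli_FE// indic_fubini_tonelli_GE.
Qed.

Lemma integral_scaled_indic (m : {measure set (mrV R d) -> \bar R}) (A : set (mrV R d)) k :
  measurable A -> 0 <= k -> \int[m]_x (k * (\1_A x)%:E) = k * m A.
Proof.
move=> mA k0; rewrite ge0_integralZl//; first by rewrite integral_indic// setIT.
by apply/measurable_EFinP; exact: measurable_indic.
Qed.

(* Fubini applied to {(x, y) : x + y in E, y in B} and to its shear
   {(x, y) : y in E, y - x in B}. *)
Lemma haar_unique (E B : set (mrV R d)) : measurable E -> measurable B ->
  (forall x : V, B x -> B (- x)%R) -> nu E * mu B = nu B * mu E.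
Proof.
move=> mE mB BN.
pose D := (vadd @^-1` E) `&` (snd @^-1` B) : set (mrV R d * mrV R d).
pose D' := (snd @^-1` E) `&` (vsub @^-1` B) : set (mrV R d * mrV R d).
have mD : measurable D.
  by apply: measurableI; apply: measurable_preimageT => //; exact: measurable_vadd.
have mD' : measurable D'.
  by apply: measurableI; apply: measurable_preimageT => //; exact: measurable_vsub.
have h1 : \int[mu]_y nu (ysection D y) = nu E * mu B.
  rewrite -integral_scaled_indic//; apply: eq_integral => y _.
  rewrite indicE; have [yB|yB] := boolP (y \in B).
    rewrite mule1 -(nuT (y : V) mE); congr (nu _); apply/seteqP; split => x.
      by rewrite /ysection/= inE => -[].
    by move=> Exy; rewrite /ysection/= inE; split => //; exact: set_mem.
  rewrite mule0 (_ : ysection D y = set0) ?measure0//.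
  apply/seteqP; split => // x; rewrite /ysection/= inE => -[_ By].
  by case/negP: yB; exact: mem_set.
have h2 : \int[mu]_y nu (ysection D' y) = nu B * mu E.
  rewrite -integral_scaled_indic//; apply: eq_integral => y _.
  rewrite indicE; have [yE|yE] := boolP (y \in E).
    rewrite mule1 -(nuT (- (y : V))%R mB); congr (nu _); apply/seteqP; split => x.
      rewrite /ysection/= inE => -[_ /BN]; rewrite /vsub/= opprB; exact.
    move=> /BN; rewrite opprB => Bxy; rewrite /ysection/= inE; split => //; exact: set_mem.
  rewrite mule0 (_ : ysection D' y = set0) ?measure0//.
  apply/seteqP; split => // x; rewrite /ysection/= inE => -[Ey _].
  by case/negP: yE; exact: mem_set.
rewrite -h1 -h2 -!tonelli_sections//; apply: eq_integral => x _.
rewrite -(muT (x : V) (measurable_xsection x mD')); congr (mu _).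
apply/seteqP; split => y; rewrite /xsection/= !inE /D /D' /vadd /vsub/= addrK addrC.
  by [].
by [].
Qed.

End HaarUniqueness.

Section RotationInvariance.
Variable nu : {sigma_finite_measure set (mrV R d) -> \bar R}.
Hypothesis nuT : translation_invariant nu.
Hypothesis nuc : forall r : R, 0 < r -> (0 < nu (cube r) < +oo)%E.
Local Open Scope ereal_scope.

Lemma eball_finite (r : R) : (0 < r)%R -> nu (eball r) < +oo.
Proof.
move=> r0; have /andP[_] := nuc r0; apply: le_lt_trans; apply: le_measure; rewrite ?inE.
- by apply: measurable_eball; exact: ltW.
- exact: measurable_cube.
- by move=> x xr i; apply: le_trans xr; exact: coord_le_enorm.
Qed.

(** The cube of half-side [1 / (d + 1)] lies in the ball: each squared coordinate is at most
    [1 / (d + 1)], and there are [d] of them. *)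
Lemma eball_positive : 0 < nu (eball 1).
Proof.
have d0 : (0 < (d%:R + 1)^-1 :> R)%R by rewrite invr_gt0 ltr_wpDl.
have /andP[+ _] := nuc d0; move/lt_le_trans; apply; apply: le_measure; rewrite ?inE.
- exact: measurable_cube.
- exact: measurable_eball.
move=> x xr; rewrite /eball/= -[leRHS]sqrtr1 /enorm ler_wsqrtr//.
have h i : ((x : V) ord0 i ^+ 2 <= (d%:R + 1)^-1)%R.
  rewrite -real_normK ?num_real// expr2 (le_trans (ler_pM _ _ (xr i) (xr i)))// ler_piMl ?(ltW d0)//.
  by rewrite invf_le1 ?ltr_wpDl// lerDr.
apply: (le_trans (ler_sum _ (fun i _ => h i))).
by rewrite sumr_const card_ord -[leLHS]mulr_natl ler_pdivrMr ?mul1r ?lerDl// ltr_wpDl.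
Qed.

Variable A : 'M[R]_d.
Hypothesis hA : (A *m A^T = 1%:M)%R.

Definition rotated_measure (E : set (mrV R d)) := nu (vmul A @^-1` E).

Let rotated0 : rotated_measure set0 = 0.
Proof. by rewrite /rotated_measure preimage_set0 measure0. Qed.

Let rotated_ge0 E : 0 <= rotated_measure E.
Proof. exact: measure_ge0. Qed.

Let rotated_sigma_additive : semi_sigma_additive rotated_measure.
Proof.
move=> F mF tF mUF; rewrite /rotated_measure preimage_bigcup.
have mv E : measurable E -> measurable (vmul A @^-1` E).
  by apply: measurable_preimageT; exact: measurable_vmul.
apply: measure_semi_sigma_additive.
- by move=> n; exact: mv.
- apply/trivIsetP => /= i j _ _ ij; rewrite -preimage_setI.
  by move/trivIsetP : tF => /(_ _ _ _ _ ij) ->//; rewrite preimage_set0.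
- by rewrite -preimage_bigcup; exact: mv.
Qed.

HB.instance Definition _ := isMeasure.Build _ _ _ rotated_measure
  rotated0 rotated_ge0 rotated_sigma_additive.

Lemma rotated_eball r : rotated_measure (eball r) = nu (eball r).
Proof.
congr (nu _); apply/seteqP; split => x; rewrite /eball/= /vmul enorm_mulmx//.
Qed.

Let rotated_sigma_finite : sigma_finite setT rotated_measure.
Proof.
exists (fun k => eball k.+1%:R).
  apply/esym/seteqP; split => // x _.
  exists (Num.bound (enorm (x : V))) => //; rewrite /eball/=.
  apply: (@le_trans _ _ (Num.bound (enorm (x : V)))%:R); last by rewrite ler_nat.
  by rewrite ltW// archi_boundP// enorm_ge0.
move=> k; split; first exact: measurable_eball.
by rewrite rotated_eball eball_finite.
Qed.

HB.instance Definition _ := Measure_isSigmaFinite.Build _ _ _ rotated_measure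
  rotated_sigma_finite.

(** [nu] and its rotated copy are both translation invariant, hence proportional. The unit ball,
    symmetric and rotation invariant, has the same positive finite measure under both, so the factor
    is 1. *)
Lemma lebesgue_rotation (E : set (mrV R d)) : measurable E ->
  nu (vmul A @^-1` E) = nu E.
Proof.
move=> mE; have hA' : (A^T *m A = 1%:M)%R by exact: mulmx1C.
have muT : translation_invariant rotated_measure.
  move=> a F mF; rewrite /rotated_measure.
  (* A translation by [a] after the rotation is a translation by [a *m A^T] before it. *)
  rewrite -(nuT (a *m A^T)%R (A := vmul A @^-1` F)); last first.
    by apply: measurable_preimageT => //; exact: measurable_vmul.
  congr (nu _); apply/seteqP; split => x /=.
    by rewrite /vmul mulmxDl -mulmxA hA' mulmx1.
  by rewrite /vmul mulmxDl -mulmxA hA' mulmx1.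
have := haar_unique nuT muT mE (measurable_eball ler01) _.
rewrite [X in _ * X]rotated_eball => /(_ _)/esym h.
have B0 := eball_positive; have Bfin : nu (eball 1) \is a fin_num.
  by rewrite ge0_fin_numE ?measure_ge0// eball_finite.
have {}h : nu (eball 1) * nu (vmul A @^-1` E) = nu (eball 1) * nu E.
  rewrite [RHS]muleC; apply: h => x xr; apply: le_trans xr.
  by rewrite -scaleN1r enormZ normrN1 mul1r.
by apply: le_anti; apply/andP; split; rewrite -(lee_pmul2l Bfin B0) h.
Qed.

End RotationInvariance.

End MeasurableVectors.

Section OpenMeasurable.
Variables (R : realType) (n : nat).
Local Notation V := 'rV[R]_n.+1.

Definition open_box (q : 'rV[rat]_n.+1) (e : R) : set (mrV R n.+1) :=
  [set x : mrV R n.+1 | forall i, `|ratr (q 0 i) - (x : V) 0 i| < e].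

Lemma measurable_open_box q e : measurable (open_box q e).
Proof.
rewrite (_ : open_box q e = \bigcap_(i in [set: 'I_n.+1])
    [set x : mrV R n.+1 | (x : V) 0 i \in `]ratr (q 0 i) - e, ratr (q 0 i) + e[]).
  apply: fin_bigcap_measurable => // i _; apply: sub_sigma_algebra.
  exists i, `]ratr (q 0 i) - e, ratr (q 0 i) + e[%classic; split => //.
apply/seteqP; split => [x xr i _|x xr i]; first by have := xr i; rewrite /= in_itv/= distrC ltr_distl.
by have := xr i I; rewrite /= in_itv/= distrC ltr_distl.
Qed.

Lemma sup_norm_lt (x : V) (e : R) : 0 < e -> (forall i, `|x 0 i| < e) -> `|x| < e.
Proof.
move=> e0 xe; rewrite [ltLHS]mx_normrE; apply: bigmax_lt => //.
by move=> [i j] _ /=; rewrite ord1.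
Qed.

(** Second countability: the boxes with rational centre and radius [1 / (k + 1)] contained in [O]
    exhaust it. *)
Lemma open_measurable_mrV (O : set V) : open O -> measurable (O : set (mrV R n.+1)).
Proof.
move=> oO; pose F (qk : 'rV[rat]_n.+1 * nat) : set (mrV R n.+1) :=
  if `[< open_box qk.1 qk.2.+1%:R^-1 `<=` O >] then open_box qk.1 qk.2.+1%:R^-1 else set0.
rewrite (_ : O = \bigcup_qk F qk).
  apply: countable_bigcupT_measurable; first exact: countableP.
  by move=> qk; rewrite /F; case: ifP => _; [exact: measurable_open_box|exact: measurable0].
apply/seteqP; split => [x Ox|x [qk _]]; last first.
  by rewrite /F; case: ifPn => // /asboolP h; exact: h.
have /nbhs_ballP[e /= e0 eO] := open_nbhs_nbhs (conj oO Ox).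
pose k := Num.bound (2 / e).
have k0 : 0 < k.+1%:R^-1 :> R by rewrite invr_gt0.
(* The factor 2: [x] and any other point of the box are compared through its rational centre. *)
have ke : k.+1%:R^-1 *+ 2 < e.
  rewrite -[_ *+ 2]mulr_natr mulrC ltr_pdivrMr// mulrC -ltr_pdivrMr//.
  by rewrite (lt_trans (archi_boundP _)) ?ltr_nat// divr_ge0// ltW.
have [q hq] : exists q : 'I_n.+1 -> rat, forall i, `|ratr (q i) - x 0 i| < k.+1%:R^-1.
  have h i : exists p : rat, `|ratr p - x 0 i| < k.+1%:R^-1.
    have [|p] := @rat_in_itvoo R (x 0 i - k.+1%:R^-1) (x 0 i + k.+1%:R^-1).
      by rewrite ltrD2l gtrN.
    by rewrite in_itv/= -ltr_distl => ?; exists p.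
  have [f hf] := boolp.choice h.
  by exists f.
exists (\row_i q i, k) => //; rewrite /F asboolT; last first.
  move=> y yq; apply: eO; rewrite -ball_normE /ball_/=; apply: sup_norm_lt => // i.
  rewrite !mxE; have := yq i; have := hq i; rewrite /= mxE => h1 h2.
  apply: lt_trans ke; rewrite -(subrKA (ratr (q i))) mulr2n.
  by rewrite (le_lt_trans (ler_normD _ _))// ltrD// distrC.
by move=> i; rewrite /= mxE.
Qed.

End OpenMeasurable.

(** * Spherical Lebesgue measure as a cone measure *)

Section SphereMeasure.
Variables (R : realType) (n : nat).
Local Notation V := 'rV[R]_n.+1.
Local Notation S := (sphere R n).
Local Notation B := (borel_sphere R n).

Lemma cone_unique (t t' : R) (u u' : S) : 0 < t -> 0 < t' ->
  t *: \val u = t' *: \val u' -> u = u'.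
Proof.
move=> t0 t'0 E; have := congr1 (@enorm R n.+1) E.
rewrite !enormZ !sphere1 !mulr1 !gtr0_norm// => tt'.
by move: E; rewrite -tt' => /(scalerI (lt0r_neq0 t0)) /val_inj.
Qed.

Lemma sphere_coneP (A : set S) (t : R) (u : S) : 0 < t ->
  sphere_cone A (t *: \val u) <-> t <= 1 /\ A u.
Proof.
move=> t0; split=> [[t' [u' [/andP[t'0 t'1] Au' E]]]|[t1 Au]]; last first.
  by exists t, u; rewrite t0 t1.
have uu' := cone_unique t0 t'0 E; rewrite uu'; split => //.
have := congr1 (@enorm R n.+1) E.
by rewrite !enormZ !sphere1 !mulr1 !gtr0_norm// => ->.
Qed.

Lemma sphere_coneC (A : set S) :
  sphere_cone (~` A) = sphere_cone (setT : set S) `\` sphere_cone A.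
Proof.
apply/seteqP; split => x.
  move=> [t [u [/andP[t0 t1] nA ->]]]; split; first by exists t, u; rewrite t0 t1.
  by move=> /(sphere_coneP _ _ t0)[].
move=> [[t [u [/andP[t0 t1] _ ->]]] nA]; apply/sphere_coneP => //; split => // Au.
by apply: nA; apply/sphere_coneP.
Qed.

Lemma sphere_cone_bigcup (A : (set S)^nat) :
  sphere_cone (\bigcup_i A i) = \bigcup_i sphere_cone (A i).
Proof.
apply/seteqP; split => x.
  by move=> [t [u [t01 [i _ Au] ->]]]; exists i => //; exists t, u.
by move=> [i _ [t [u [t01 Au ->]]]]; exists t, u; split => //; exists i.
Qed.

Lemma sphere_coneT : sphere_cone (setT : set S) =
  (eball (d := n.+1) (1 : R)) `\` (eball 0) :> set (mrV R n.+1).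
Proof.
apply/seteqP; split => x.
  move=> [t [u [/andP[t0 t1] _ ->]]]; rewrite /eball; split => /=;
    rewrite enormZ sphere1 mulr1 gtr0_norm//.
  by apply/negP; rewrite -ltNge.
move=> [x1 /negP]; rewrite -ltNge => x0; have [u xu] := polar x.
by exists (enorm x), u; split => //; rewrite x0.
Qed.

(** The cone is the punctured ball cut by the open set of nonzero [x] whose normalization lies in
    [O]. *)
Lemma measurable_cone_open (U : set S) : open U ->
  measurable (sphere_cone U : set (mrV R n.+1)).
Proof.
case=> O oO <-.
pose W := [set x : V | x != 0 /\ O ((enorm x)^-1 *: x)].
have -> : sphere_cone (set_val @^-1` O) = (sphere_cone (setT : set S)) `&` W :> set (mrV R n.+1).
  apply/seteqP; split => x.
    move=> [t [u [/andP[t0 t1] Ou ->]]]; split; first by exists t, u; rewrite t0 t1.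
    split; first by rewrite scaler_eq0 negb_or gt_eqF//= sphere_neq0.
    rewrite enormZ sphere1 mulr1 gtr0_norm// scalerA mulVf ?gt_eqF// scale1r.
    exact: Ou.
  move=> [[t [u [/andP[t0 t1] _ ->]]] [_]].
  rewrite enormZ sphere1 mulr1 gtr0_norm// scalerA mulVf ?gt_eqF// scale1r => Ou.
  by exists t, u; rewrite t0 t1.
apply: measurableI.
  by rewrite sphere_coneT; apply: measurableD; exact: measurable_eball.
apply: open_measurable_mrV; rewrite openE => x [x0 Ox]; rewrite /interior.
have ex0 : enorm x != 0 by apply: contra_neq x0; exact: enorm_eq0.
have xc : {for x, continuous (fun y : V => (enorm y)^-1 *: y)}.
  apply: (@continuousZ R V V (fun y : V => (enorm y)^-1) id x); last exact: cvg_id.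
  by apply: continuousV => //; exact: enorm_continuous.
have h1 : nbhs x [set y : V | O ((enorm y)^-1 *: y)].
  by apply: xc; apply: open_nbhs_nbhs.
have h2 : nbhs x [set y : V | 0 < enorm y].
  apply: open_nbhs_nbhs; split.
    by apply: cont_open_lt; [exact: cont_cst|exact: enorm_continuous].
  by rewrite /= lt_neqAle eq_sym ex0 enorm_ge0.
apply: (@filterS2 _ (nbhs x) (nbhs_filter x) _ _ _ _ h1 h2) => y Oy y0.
split => //; apply: contraTN y0 => /eqP ->.
by rewrite /enorm big1 ?sqrtr0 ?ltxx// => i _; rewrite mxE expr0n.
Qed.

Lemma measurable_cone (A : set B) : measurable A ->
  measurable (sphere_cone A : set (mrV R n.+1)).
Proof.
have mT : measurable (sphere_cone (setT : set S) : set (mrV R n.+1)).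
  by rewrite sphere_coneT; apply: measurableD; exact: measurable_eball.
move=> mA.
apply: (smallest_sub _ _ mA : [set A : set S | measurable (sphere_cone A : set (mrV R n.+1))] A).
  split=> [|C mC|C mC] /=.
  - rewrite (_ : sphere_cone set0 = set0); first exact: measurable0.
    by apply/seteqP; split => x // [t [u []]].
  - by rewrite setTD sphere_coneC; exact: measurableD.
  - by rewrite sphere_cone_bigcup; exact: bigcupT_measurable.
by move=> U oU; exact: measurable_cone_open.
Qed.

Section Cone.
Variable nu : {sigma_finite_measure set (mrV R n.+1) -> \bar R}.
Hypothesis nuT : translation_invariant nu.
Hypothesis nuc : forall r : R, 0 < r -> (0 < nu (cube r) < +oo)%E.
Local Open Scope ereal_scope.

Definition cone_measure (A : set B) : \bar R := (n.+1%:R)%:E * nu (sphere_cone A).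

Let cone0 : cone_measure set0 = 0.
Proof.
rewrite /cone_measure (_ : sphere_cone set0 = set0) ?measure0 ?mule0//.
by apply/seteqP; split => x // [t [u []]].
Qed.

Let cone_ge0 A : 0 <= cone_measure A.
Proof. by rewrite mule_ge0// lee_fin. Qed.

Let cone_sigma_additive : semi_sigma_additive cone_measure.
Proof.
move=> F mF tF mUF.
have E : (fun k => \sum_(0 <= i < k) cone_measure (F i)) =
    fun k => (n.+1%:R)%:E * \sum_(0 <= i < k) nu (sphere_cone (F i)).
  by apply/funext => k; rewrite ge0_sume_distrr.
rewrite E /cone_measure sphere_cone_bigcup; apply: cvgeZl => //.
apply: measure_semi_sigma_additive.
- by move=> i; exact: measurable_cone.
- apply/trivIsetP => i j _ _ ij; apply/seteqP; split => // x [].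
  move=> [t [u [/andP[t0 t1] Fu ->]]] /(sphere_coneP _ _ t0)[_ Fju].
  by move/eqP: ij; apply; apply: tF => //; exists u.
- by rewrite -sphere_cone_bigcup; exact: measurable_cone.
Qed.

HB.instance Definition _ := isMeasure.Build _ _ _ cone_measure
  cone0 cone_ge0 cone_sigma_additive.

Lemma cone_fin : fin_num_fun cone_measure.
Proof.
move=> A mA; rewrite ge0_fin_numE// /cone_measure lte_mul_pinfty ?lee_fin//.
apply: le_lt_trans (eball_finite nuc ltr01); apply: le_measure; rewrite ?inE.
- exact: measurable_cone.
- exact: measurable_eball.
move=> x [t [u [/andP[t0 t1] _ ->]]].
by rewrite /eball/= enormZ sphere1 mulr1 gtr0_norm.
Qed.

(** A translated small cube fits into the punctured unit ball, which is the cone over the whole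
    sphere. *)
Lemma cone_measure_positive : 0 < cone_measure setT.
Proof.
rewrite /cone_measure mule_gt0// ?lte_fin//.
(* The cube is centred at [a], half the first basis vector. This half-side keeps its points within
   [1 / 2] of [a], so of norm at most 1, with positive first coordinate. *)
pose r : R := ((n.+1%:R + 1)^-1 / 2)%R.
have r1 : (0 < (n.+1%:R + 1)^-1 :> R)%R by rewrite invr_gt0 ltr_wpDl.
have r0 : (0 < r)%R by rewrite divr_gt0.
have r12 : (r < 2^-1)%R.
  have n1 : (1 < n.+1%:R + 1 :> R)%R by rewrite ltrDr.
  by rewrite /r gtr_pMl ?invr_gt0// invf_lt1 ?(lt_trans ltr01).
pose a : V := (2^-1 *: delta_mx 0 0)%R.
have mc := @measurable_cube R n.+1 r.
have /andP[c0 _] := nuc r0.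
rewrite -(nuT (- a)%R mc) in c0; apply: (lt_le_trans c0).
apply: le_measure; rewrite ?inE.
- apply: (@measurable_preimageT _ _ _ _ (fun x : mrV R n.+1 => ((x : V) - a)%R : mrV R n.+1)) => //.
  apply: measurable_to_mrV => i.
  rewrite (_ : (fun x => _) = fun x : mrV R n.+1 => ((x : V) ord0 i - a ord0 i)%R); last first.
    by apply/funext => x; rewrite !mxE.
  by apply: measurable_funB; [exact: measurable_coord|exact: measurable_cst].
- exact: measurable_cone.
move=> x xr; rewrite sphere_coneT.
have xa : (enorm ((x : V) - a) <= 2^-1)%R.
  rewrite -[leRHS]ger0_norm ?invr_ge0// -sqrtr_sqr /enorm ler_wsqrtr//.
  have h i : (((x : V) - a) ord0 i ^+ 2 <= 4^-1 * (n.+1%:R + 1)^-1)%R.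
    have h0 : (0 <= r)%R by exact: ltW.
    rewrite -real_normK ?num_real// expr2 (le_trans (ler_pM _ _ (xr i) (xr i)))//.
    have -> : (r * r = 4^-1 * (n.+1%:R + 1)^-1 * (n.+1%:R + 1)^-1)%R by rewrite /r; field.
    by rewrite ler_piMr// invf_le1 ?ltr_wpDl// lerDr.
  apply: (le_trans (ler_sum _ (fun i _ => h i))).
  rewrite sumr_const card_ord -[leLHS]mulr_natl.
  have -> : (2^-1 ^+ 2 = 4^-1 :> R)%R by field.
  rewrite mulrCA ler_piMr// ler_pdivrMr ?mul1r ?lerDl// ltr_wpDl//.
have ea : enorm a = (2^-1)%R.
  rewrite enormZ ger0_norm// [enorm _](_ : _ = 1%R) ?mulr1//.
  rewrite /enorm (bigD1 ord0)//= big1 ?addr0; last first.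
    by move=> i /negbTE i0; rewrite mxE eqxx i0 expr0n.
  by rewrite mxE !eqxx expr1n sqrtr1.
split; rewrite /eball/=.
  rewrite -(subrK a (x : V)) (le_trans (enorm_triangle _ _))// ea.
  by move: xa; lra.
apply/negP; rewrite -ltNge; apply: lt_le_trans (coord_le_enorm _ ord0).
have := xr ord0; rewrite !mxE !eqxx mulr1 ler_norml => /andP[h _].
by rewrite (lt_le_trans _ (ler_norm _))//; move: h r12; lra.
Qed.

Lemma cone_measure_rotation (A : 'M[R]_n.+1) (hA : (A *m A^T = 1%:M)%R) (E : set B) :
  measurable E -> cone_measure (rotate_sphere hA @^-1` E) = cone_measure E.
Proof.
move=> mE; rewrite /cone_measure; congr (_ * _).
rewrite -(lebesgue_rotation nuT nuc hA (measurable_cone mE)); congr (nu _).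
have hA' : (A^T *m A = 1%:M)%R by exact: mulmx1C.
have hA'' : (A^T *m A^T^T = 1%:M)%R by rewrite trmxK.
apply/seteqP; split => x.
  move=> [t [u [t01 Eu ->]]]; exists t, (rotate_sphere hA u); split => //.
  by rewrite /vmul -scalemxAl.
move=> [t [u [t01 Eu xE]]]; exists t, (rotate_sphere hA'' u); split => //.
  rewrite /preimage/= (_ : rotate_sphere hA _ = u)//; apply: val_inj => /=.
  by rewrite -mulmxA hA' mulmx1.
by rewrite /= scalemxAl -xE /vmul -mulmxA hA mulmx1.
Qed.

End Cone.

Theorem sphere_measure_exists : exists sigma : {finite_measure set B -> \bar R},
  [/\ forall A, sigma A = sphere_measure A, (0 < sigma setT)%E
  & forall (A : 'M[R]_n.+1) (hA : A *m A^T = 1%:M) (E : set B), measurable E ->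
      sigma (rotate_sphere hA @^-1` E) = sigma E].
Proof.
have [nu [nuE nuc nuT]] := lebesgue_rV_measure R n.+1.
pose finB := @Measure_isFinite.Build _ _ R (cone_measure nu) (cone_fin nuc).
pose sigma : {finite_measure set B -> \bar R} := HB.pack (cone_measure nu) finB.
exists sigma; split.
- by move=> A; rewrite /sphere_measure -nuE.
- exact: cone_measure_positive nuT nuc.
- by move=> A hA E mE; exact: (cone_measure_rotation nuT nuc).
Qed.

End SphereMeasure.

Section SphericalIntegral.
Variables (R : realType) (n : nat).
Local Notation SB := (star_body R n).
Local Notation B := (borel_sphere R n).
Variable sigma : {finite_measure set B -> \bar R}.

Definition total_radial (L : SB) : R := \int[sigma]_u radial L u.

Lemma total_radial_additive_homogeneous : additive_homogeneous total_radial.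
Proof.
have int (L : SB) : sigma.-integrable [set: B] (EFin \o radial L).
  by apply: continuous_integrable; [exact: sphere_compact|exact: radial_continuous].
split=> [L M|a a0 L]; rewrite /total_radial.
  rewrite -RintegralD//; congr Rintegral; apply/funext => u; exact: radial_sumE.
rewrite -RintegralZl//; congr Rintegral; apply/funext => u; exact: radial_dilate.
Qed.

Lemma total_radial_ge0 L : 0 <= total_radial L.
Proof. by apply: Rintegral_ge0 => // u _; exact: radial_ge0. Qed.

Lemma total_radial1 : total_radial (body_of (fun=> 1)) = fine (sigma setT).
Proof.
have -> : total_radial (body_of (fun=> 1)) = \int[sigma]_(u in [set: B]) 1.
  congr Rintegral; apply/funext => u; rewrite radial_body_of_ge0//; exact: cont_cst.
by rewrite Rintegral_cst// mul1r.
Qed.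

Lemma measurable_rotate_sphere (A : 'M[R]_n.+1) (hA : A *m A^T = 1%:M) :
  measurable_fun [set: B] (rotate_sphere hA : B -> B).
Proof.
apply: (@measurability _ _ B B setT _ (@open (sphere R n))) => // _ [U oU <-].
rewrite setTI; apply: borel_open; move/continuousP: (@rotate_sphere_continuous R n A hA).
exact.
Qed.

Lemma total_radial_rotate :
  (forall (A : 'M[R]_n.+1) (hA : A *m A^T = 1%:M) (E : set B), measurable E ->
      sigma (rotate_sphere hA @^-1` E) = sigma E) ->
  forall (A : 'M[R]_n.+1) (hA : is_rotation A) L, total_radial (rotate hA L) = total_radial L.
Proof.
move=> sigma_rot A hA L; have hA' := rotation_tr hA.
have mf : measurable_fun [set: B] (fun u => (radial L u)%:E).
  by apply/measurable_EFinP; apply: cont_measurable; exact: radial_continuous.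
have := @ge0_integral_pushforward _ _ B B R _ (measurable_rotate_sphere hA') sigma setT
  (fun u => (radial L u)%:E) measurableT mf.
rewrite preimage_setT => h; rewrite /total_radial /Rintegral; congr fine.
transitivity (\int[sigma]_u (((fun u => (radial L u)%:E) \o rotate_sphere hA') u))%E.
  by apply: eq_integral => u _; rewrite /= radial_rotate.
rewrite -h; last by move=> u _; rewrite lee_fin radial_ge0.
apply: eq_measure_integral => [|mp E mE _]; first exact: measurable_rotate_sphere.
exact: sigma_rot.
Qed.

Lemma dual_mixed_volumeE (Ls : 'I_n.+1 -> SB) : (forall A, sigma A = sphere_measure A) ->
  dual_mixed_volume Ls =
  n.+1%:R^-1 * total_radial (body_of (fun u => \prod_i radial (Ls i) u)).
Proof.
move=> sE; rewrite /dual_mixed_volume /total_radial /Rintegral.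
have -> : @sphere_measure R n = sigma by apply/funext => A; rewrite sE.
congr (_ * fine _); apply: eq_integral => u _; rewrite radial_body_of_ge0//.
  by apply: cont_prod => i _; exact: radial_continuous.
by move=> v; rewrite prodr_ge0// => i _; exact: radial_ge0.
Qed.

End SphericalIntegral.

Lemma prod_cast_ord (R : realType) (k m : nat) (mk : m = k) (g : 'I_k -> R) :
  \prod_(i < m) g (cast_ord mk i) = \prod_(i < k) g i.
Proof. by case: k / mk g => g; apply: eq_bigr => i _; congr g; exact: val_inj. Qed.

Section RotationInvariantFunctional.
Variables (R : realType) (n m : nat).
Local Notation SB := (star_body R n).
Variable F : ('I_m -> SB) -> R.
Hypothesis F_add : separately_additive F.
Hypothesis F_hom : positively_homogeneous F.
Hypothesis F_bd : separately_bounded F.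
Hypothesis F_disj : vanishes_on_disjoint F.
Hypothesis F_rot : rotationally_invariant F.

Lemma rotation_invariant_dual_volume (mn : m = n.+1) : (0 < n)%N ->
  exists c : R, forall Ls : 'I_n.+1 -> SB,
    F (fun i : 'I_m => Ls (cast_ord mn i)) = c * dual_mixed_volume Ls.
Proof.
move=> n0; have [sigma [sE s0 s_rot]] := sphere_measure_exists R n.
pose i0 : 'I_m := cast_ord (esym mn) ord0.
pose one : SB := body_of (fun=> 1); pose T L := F (upd (fun=> one) i0 L).
have Tah : additive_homogeneous T by exact: slice_additive_homogeneous.
have [CT TC] := slice_bounded F_bd (fun=> one) i0.
have one_rot (A : 'M[R]_n.+1) (hA : is_rotation A) : rotate hA one = one.
  apply: radial_inj => u; have c1 : continuous (fun _ : sphere R n => 1 : R) by exact: cont_cst.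
  by rewrite radial_rotate !radial_body_of_ge0.
have T_rot (A : 'M[R]_n.+1) (hA : is_rotation A) L : T (rotate hA L) = T L.
  rewrite /T -[RHS](F_rot hA); congr F; apply/funext => i; rewrite /upd.
  by case: ifP => // _; rewrite one_rot.
pose J := total_radial sigma.
have Jah : additive_homogeneous J by exact: total_radial_additive_homogeneous.
have [CJ JC] := positive_bounded Jah (total_radial_ge0 sigma).
have J1 : J one != 0.
  rewrite /J total_radial1 gt_eqF// fine_gt0// s0/= ltey_eq fin_num_measure//.
(* The dual mixed volume is [J] of the product divided by [n.+1], and [J one] is the total spherical
   measure. *)
exists (n.+1%:R * T one / J one) => Ls.
rewrite (product_formula F_add F_hom F_bd F_disj i0) (dual_mixed_volumeE _ sE).
have -> : (fun u => \prod_(i < m) radial (Ls (cast_ord mn i)) u) =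
    fun u => \prod_(i < n.+1) radial (Ls i) u.
  by apply/funext => u; exact: (prod_cast_ord mn (fun i => radial (Ls i) u)).
have := rotation_invariant_unique n0 Tah TC T_rot Jah JC (total_radial_rotate s_rot)
  (body_of (fun u => \prod_(i < n.+1) radial (Ls i) u)).
rewrite -/one -/(T _) -/(J _); set X := body_of (fun u => _) => h.
have cross (a b c e k : R) : k != 0 -> e != 0 -> a * e = b * c -> a = k * c / e * (k^-1 * b).
  by move=> k0 e0 E; rewrite -[LHS](mulfK e0) E; field; rewrite k0 e0.
by apply: cross => //; rewrite pnatr_eq0.
Qed.

End RotationInvariantFunctional.

Theorem theorem3p4 (R : realType) (n m : nat) (m_gt0 : (0 < m)%N)
    (F : ('I_m -> star_body R n) -> R)
    (F_add : separately_additive F) (F_hom : positively_homogeneous F)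
    (F_AB : difference_of_positive F \/ separately_bounded F) :
  ((vanishes_on_disjoint F <->
      symmetric_function F /\ orthogonally_additive (associated_polynomial F)) /\
   (symmetric_function F /\ orthogonally_additive (associated_polynomial F) <->
      represented_by_measure F)) /\
  (forall (mn : m = n.+1), (1 < n.+1)%N ->
     [\/ vanishes_on_disjoint F,
         symmetric_function F /\ orthogonally_additive (associated_polynomial F)
       | represented_by_measure F] ->
     rotationally_invariant F ->
     exists c : R, forall Ls : 'I_n.+1 -> star_body R n,
       F (fun i : 'I_m => Ls (cast_ord mn i)) = c * dual_mixed_volume Ls).
Proof.
(* Condition (A) implies (B), since nonnegative functionals are bounded on the unit ball; the rest
   runs under (B). *)
have F_bd : separately_bounded F.
  case: F_AB => // -[Fp [Fm [[pa ph] [ma mh] p0 m0 FE]]].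
  exact: difference_bounded pa ph ma mh p0 m0 FE.
have h13 := vanishes_represented F_add F_hom F_bd m_gt0.
have h32 : represented_by_measure F ->
    symmetric_function F /\ orthogonally_additive (associated_polynomial F).
  by move=> h; split; [exact: represented_symmetric|exact: represented_orthogonal].
have h21 : symmetric_function F /\ orthogonally_additive (associated_polynomial F) ->
    vanishes_on_disjoint F.
  by move=> [F_sym P_orth]; exact: orthogonal_polynomial_vanishes.
(* The implications close the cycle (1), (3), (2), (1). *)
split; first by split; split; auto.
move=> mn n0 h F_rot; apply: rotation_invariant_dual_volume => //.
by case: h => [|/h21|/h32/h21].
Qed.
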